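(* Let $m\ge1$ and let $f,g\in H^{\otimes m}$ be symmetric. Denote by $\Lambda$ the Malliavin matrix and by $C$ the covariance matrix of the vector $(F,G)=(I_m(f),I_m(g))$. Then $$E\det\Lambda=m^2\det C+(m\,m!)^2\sum_{r=1}^{\left[\frac{m-1}{2}\right]}\left((C_{m-1}^{r})^2-(C_{m-1}^{r-1})^2\right)\left(\Vert f\otimes_r g\Vert^2-\Vert f\otimes_{m-r}g\Vert^2\right)+R_m,$$ where $R_m=\sum_{k=1}^{m-1}T_k$ with $T_k$ defined in the context, and $[x]$ denotes the integer part of $x$.
   Context: $H$ is a real separable Hilbert space with a fixed complete orthonormal system $(e_j)_{j\ge1}$, and $(W(h),h\in H)$ is an isonormal process on a probability space $(\Omega,\mathcal F,P)$, i.e. a centered Gaussian family with $E[W(h)W(g)]=\langle h,g\rangle_H$; $\mathcal F$ is generated by $W$. $I_m$ denotes the multiple Wiener-Itô integral of order $m$ with respect to $W$: on symmetric elements it is the linear map with $I_m(h^{\otimes m})=H_m(W(h))$ for $\Vert h\Vert=1$ ($H_m$ the monic Hermite polynomial of degree $m$), and it satisfies $E[I_m(f)^2]=m!\Vert f\Vert^2_{H^{\otimes m}}$ for symmetric $f$. $D$ is the Malliavin derivative with respect to $W$. The Malliavin matrix of $(F,G)$ is the random matrix $\Lambda=\begin{pmatrix}\Vert DF\Vert_H^2&\langle DF,DG\rangle_H\\ \langle DF,DG\rangle_H&\Vert DG\Vert_H^2\end{pmatrix}$. $\langle\cdot,\cdot\rangle$, $\Vert\cdot\Vert$ denote scalar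 product and norm in $H^{\otimes k}$ for any $k$ (with $H^{\otimes 0}=\mathbb R$), and $C_a^b=\binom{a}{b}$ (the unindexed $C$ is the covariance matrix). For symmetric $u=\sum\lambda_{j_1,\dots,j_p}e_{j_1}\otimes\cdots\otimes e_{j_p}\in H^{\otimes p}$ and $v=\sum\beta_{k_1,\dots,k_q}e_{k_1}\otimes\cdots\otimes e_{k_q}\in H^{\otimes q}$, the contraction of order $r$, $0\le r\le \min(p,q)$, is $$u\otimes_r v=\sum_{i_1,\dots,i_r}\sum_{j_1,\dots,j_{p-r}}\sum_{k_1,\dots,k_{q-r}}\lambda_{i_1,\dots,i_r,j_1,\dots,j_{p-r}}\beta_{i_1,\dots,i_r,k_1,\dots,k_{q-r}}\,(e_{j_1}\otimes\cdots\otimes e_{j_{p-r}})\otimes(e_{k_1}\otimes\cdots\otimes e_{k_{q-r}})\in H^{\otimes(p+q-2r)},$$ with $u\otimes_0 v=u\otimes v$; $u\tilde\otimes_r v$ is its symmetrization. Write $f=\sum\lambda_{j_1,\dots,j_m}e_{j_1}\otimes\cdots\otimes e_{j_m}$, $g=\sum\beta_{k_1,\dots,k_m}e_{k_1}\otimes\cdots\otimes e_{k_m}$ with symmetric coefficients, and for $i\ge1$ put $s_{i,f}=m\sum_{j_2,\dots,j_m\ge1}\lambda_{i,j_2,\dots,j_m}e_{j_2}\otimes\cdots\otimes e_{j_m}$ and $s_{i,g}=m\sum_{k_2,\dots,k_m\ge1}\beta_{i,k_2,\dots,k_m}e_{k_2}\otimes\cdots\otimes e_{k_m}$, both in $H^{\otimes(m-1)}$.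 For $k=0,\dots,m-1$, $$T_k=\frac12\sum_{i,l\ge1}k!^2\,(C_{m-1}^k)^4(2m-2-2k)!\,\Vert s_{i,f}\tilde\otimes_k s_{l,g}-s_{l,f}\tilde\otimes_k s_{i,g}\Vert^2.$$ An empty sum is $0$. *)

(* Defs.v *)
From HB Require Import structures.
From mathcomp Require Import all_boot all_order all_algebra all_fingroup.
From mathcomp Require Import all_classical all_reals all_analysis.

Set Implicit Arguments.
Unset Strict Implicit.
Unset Printing Implicit Defensive.

Import Order.TTheory GRing.Theory Num.Theory.
Import numFieldNormedType.Exports.

Local Open Scope classical_set_scope.
Local Open Scope ring_scope.

Section tensors.
Context {R : realType}.

(* Sum of an absolutely summable family; a junk value otherwise. *)
Definition tsum (I : choiceType) (a : I -> R) : R :=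
  fine (\esum_(i in [set: I]) ((EFin \o a)^\+ i) -
        \esum_(i in [set: I]) ((EFin \o a)^\- i))%E.

(* An element of the k-th tensor power of H is given by its coefficients on
   the orthonormal basis e_{j_1} (x) ... (x) e_{j_k}. The basis (e_j) is
   numbered from 0 instead of 1. Functions that are not square summable (see
   [sym_l2]) do not represent elements of the tensor power. *)
Definition tensor (k : nat) : Type := k.-tuple nat -> R.

Definition tdot k (u v : tensor k) : R := tsum (fun j => u j * v j).

Definition tnorm k (u : tensor k) : R := Num.sqrt (tdot u u).

Definition square_summable k (u : tensor k) : Prop :=
  (\esum_(j in [set: k.-tuple nat]) ((u j) ^+ 2)%:E < +oo)%E.

Definition permute_tuple k (s : {perm 'I_k}) (j : k.-tuple nat) :
  k.-tuple nat := [tuple tnth j (s i) | i < k].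

Definition symmetric_tensor k (u : tensor k) : Prop :=
  forall s j, u (permute_tuple s j) = u j.

Definition sym_l2 k (u : tensor k) : Prop :=
  symmetric_tensor u /\ square_summable u.

Definition symmetrize k (u : tensor k) : tensor k :=
  fun j => (k`!%:R)^-1 * \sum_(s : {perm 'I_k}) u (permute_tuple s j).

(* Only applied to sequences of size k, on which it is the identity; it avoids
   casts between the types n.-tuple nat. *)
Definition totuple (k : nat) (s : seq nat) : k.-tuple nat :=
  [tuple nth 0%N s i | i < k].

(* u (x)_r v, meaningful for r <= minn p q. *)
Definition tcontract p q r (u : tensor p) (v : tensor q) :
    tensor (p + q - r.*2) :=
  fun x => tsum (fun i : r.-tuple nat =>
    u (totuple p (i ++ take (p - r) x)) * v (totuple q (i ++ drop (p - r) x))).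
Arguments tcontract {p q} r u v.

Definition tcontract_sym p q r (u : tensor p) (v : tensor q) :=
  symmetrize (tcontract r u v).
Arguments tcontract_sym {p q} r u v.

(* The coefficients m * lambda_{i, j_2, ..., j_m} of s_{i,f}. *)
Definition slice m (f : tensor m) (i : nat) : tensor m.-1 :=
  fun j => m%:R * f (totuple m (i :: j)).

Definition Tterm m (f g : tensor m) (k : nat) : R :=
  2^-1 * tsum (fun il : nat * nat =>
    (k`!)%:R ^+ 2 * 'C(m.-1, k)%:R ^+ 4 * (2 * m - 2 - 2 * k)`!%:R *
    tnorm (tcontract_sym k (slice f il.1) (slice g il.2) \-
           tcontract_sym k (slice f il.2) (slice g il.1)) ^+ 2).

(* Monic Hermite polynomials: H_0 = 1 and H_{n+1} = X H_n - H_n'. *)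
Definition hermite (n : nat) : {poly R} :=
  iter n (fun p => 'X * p - p^`()) 1.

Definition iter_partial n (s : seq 'I_n) (phi : 'rV[R]_n -> R) :
    'rV[R]_n -> R :=
  foldr (fun i psi x => 'D_(delta_mx 0 i) psi x) phi s.

(* C^oo functions on R^n all of whose partial derivatives, including the
   function itself, have at most polynomial growth. *)
Definition smooth_polygrowth n (phi : 'rV[R]_n -> R) : Prop :=
  forall s : seq 'I_n,
    [/\ continuous (iter_partial s phi),
        forall i x, derivable (iter_partial s phi) x (delta_mx 0 i) &
        exists (c : R) (N : nat), forall x,
          `|iter_partial s phi x| <= c * (1 + `|x|) ^+ N].

End tensors.
Arguments tensor : clear implicits.
Arguments tcontract {R p q} r u v.
Arguments tcontract_sym {R p q} r u v.

Section gaussian.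
Context {R : realType} {H : completeNormedModType R}.

(* The norm of H comes from the scalar product; H is complete by its type. *)
Definition hilbert_product (ip : {dot H for idfun}) : Prop :=
  forall x, `|x| ^+ 2 = ip x x.

Definition complete_orthonormal (ip : {dot H for idfun}) (e : nat -> H) :
    Prop :=
  (forall i j, ip (e i) (e j) = (i == j)%:R) /\
  (forall x, (forall j, ip x (e j) = 0) -> x = 0).

Definition tensor_power (ip : {dot H for idfun}) (e : nat -> H)
    (m : nat) (h : H) : tensor R m :=
  fun j => \prod_(i < m) ip h (e (tnth j i)).
Arguments tensor_power ip e m h : clear implicits.

Context {d : measure_display} {Omega : measurableType d}.
Variable P : probability Omega R.

(* [normal_prob 0 0] is not a point mass in the library, hence the case
   distinction for degenerate Gaussian variables. *)
Definition centered_gaussian (X : Omega -> R) : Prop :=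
  measurable_fun setT X /\
  exists s : R, forall B : set R, measurable B ->
    P (X @^-1` B) = if s == 0 then \d_(0 : R) B else normal_prob 0 s B.

Record isonormal (ip : {dot H for idfun}) (W : H -> Omega -> R) : Prop := {
  isonormal_gaussian : forall n (a : 'I_n -> R) (h : 'I_n -> H),
    centered_gaussian (fun w => \sum_(i < n) a i * W (h i) w) ;
  isonormal_covariance : forall h g,
    'E_P[fun w => (W h w * W g w)%R]%E = (ip h g)%:E }.

Definition generated_by (W : H -> Omega -> R) : Prop :=
  @measurable d Omega =
  <<s [set A | exists h (B : set R), measurable B /\ A = W h @^-1` B] >>.

(* These properties determine I f almost surely for each symmetric f. *)
Record multiple_integral (ip : {dot H for idfun}) (e : nat -> H)
    (W : H -> Omega -> R) (m : nat) (I : tensor R m -> Omega -> R) : Prop := {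
  multiple_integral_measurable : forall f, sym_l2 f ->
    measurable_fun setT (I f) ;
  multiple_integral_linear : forall (a : R) f g, sym_l2 f -> sym_l2 g ->
    {ae P, forall w, I (fun j => a * f j + g j) w = a * I f w + I g w} ;
  multiple_integral_hermite : forall h, `|h| = 1 ->
    {ae P, forall w, I (tensor_power ip e m h) w = (hermite m).[W h w]} ;
  multiple_integral_isometry : forall f, sym_l2 f ->
    'E_P[fun w => (I f w ^+ 2)%R]%E = (m`!%:R * tnorm f ^+ 2)%:E }.

(* F = phi(W(h_1), ..., W(h_n)) and U = \sum_i (d_i phi)(W(h_1), ...) h_i. *)
Definition smooth_derivative (W : H -> Omega -> R)
    (F : Omega -> R) (U : Omega -> H) : Prop :=
  exists (n : nat) (phi : 'rV[R]_n -> R) (h : 'I_n -> H),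
    [/\ smooth_polygrowth phi,
        forall w, F w = phi (\row_i W (h i) w) &
        forall w, U w =
          \sum_(i < n) 'D_(delta_mx 0 i) phi (\row_i W (h i) w) *: h i].

Definition weakly_measurable (ip : {dot H for idfun}) (U : Omega -> H) : Prop :=
  forall h, measurable_fun setT (fun w => ip (U w) h).

(* Closure, in L^2(Omega) x L^2(Omega; H), of the graph of the derivative on
   smooth random variables. *)
Definition malliavin_graph (ip : {dot H for idfun}) (W : H -> Omega -> R)
    (F : Omega -> R) (U : Omega -> H) : Prop :=
  [/\ measurable_fun setT F, weakly_measurable ip U &
  exists (Fn : nat -> Omega -> R) (Un : nat -> Omega -> H),
    [/\ forall n, smooth_derivative W (Fn n) (Un n),
        (fun n => 'E_P[fun w => ((Fn n w - F w) ^+ 2)%R]%E) @ \oo --> 0%E &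
        (fun n => 'E_P[fun w => (`|Un n w - U w| ^+ 2)%R]%E) @ \oo --> 0%E]].

(* D is the closed extension of the derivative of smooth random variables;
   its values outside of its domain D^{1,2} are unspecified. *)
Definition malliavin_derivative (ip : {dot H for idfun}) (W : H -> Omega -> R)
    (D : (Omega -> R) -> Omega -> H) : Prop :=
  forall F U, malliavin_graph ip W F U ->
    weakly_measurable ip (D F) /\ {ae P, forall w, D F w = U w}.

Definition malliavin_matrix (ip : {dot H for idfun})
    (D : (Omega -> R) -> Omega -> H) (X : 2.-tuple (Omega -> R)) (w : Omega) :
    'M[R]_2 :=
  \matrix_(i, j) ip (D (tnth X i) w) (D (tnth X j) w).

Definition covariance_matrix (X : 2.-tuple (Omega -> R)) : 'M[R]_2 :=
  \matrix_(i, j) fine (covariance P (tnth X i) (tnth X j)).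

End gaussian.
Arguments tensor_power {R H} ip e m h.

(* Main.v *)
(* Write [m = p + 1], [X_i = <DF, e_i>] and [Y_i = <DG, e_i>]. By Parseval's formula
   and Lagrange's identity, [2 det Lambda = \sum_(i, l) (X_i Y_l - X_l Y_i)^2], where
   [X_i] and [Y_i] are the multiple integrals of order [p] of [s_{i,f}] and [s_{i,g}].
   Gaussian integration by parts expresses the expectation of a product of four
   multiple integrals of order [p] as a sum over [k] of scalar products of symmetrized
   contractions of order [k], so that [E det Lambda = \sum_(0 <= k <= p) T_k].
   In [T_0], the scalar product of two symmetrized tensor products
   [a \tilde\otimes b] and [c \tilde\otimes d] is a combination of the
   [<a \otimes_r d, c \otimes_r b>]; the sum over [i] and [l] turns these into
   [|f \otimes_r g|^2 - |f \otimes_{r+1} g|^2], and a summation by parts over [r]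
   yields the first two terms of the formula.
   All the identities are checked on finite sums of tensor powers [x^{\otimes m}],
   whose multiple integrals are Hermite polynomials in the [W(x)]; by polarization,
   every symmetric tensor with finitely many nonzero coefficients is of this form. *)

Require Import Defs.
From HB Require Import structures.
From mathcomp Require Import all_boot all_order all_algebra all_fingroup.
From mathcomp Require Import all_classical all_reals all_analysis.
From mathcomp Require Import measurable_realfun.
From mathcomp Require Import ring lra zify.

Set Implicit Arguments.
Unset Strict Implicit.
Unset Printing Implicit Defensive.

Import Order.TTheory GRing.Theory Num.Theory.
Import numFieldNormedType.Exports.

Local Open Scope classical_set_scope.
Local Open Scope ring_scope.

(** * Absolutely summable families *)

(** The hypotheses describe [I] only up to almost sure equality, and [D] only through pairs in the
    closure of the smooth graph. The gradient of [I f] therefore has to be built: it is the almost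
    sure limit of explicit gradients of Hermite sums along truncations of [f] that converge at the
    rate [8 ^- n]. Passing to the limit in the determinant itself, which is quartic in the
    gradients, would require convergence in L^4. Each minor [X_i Y_l - X_l Y_i] is treated instead:
    its approximations converge almost surely and are Cauchy in L^2 by the explicit fourth moment
    formula, so that Fatou's lemma gives its exact second moment. The sum over [i] and [l] is then a
    monotone limit. On the deterministic side, both members of an identity are quadrilinear and
    continuous along truncations, by dominated convergence of coefficients; tensor powers then
    suffice, and scalar products of symmetrized contractions are read off as coefficients of
    polynomials. Ryser's formula for permanents is used twice: for the polarization of tensors, and
    to reduce products of the [W h] to powers. *)

Lemma cvg_sumr (R : realType) (K : Type) (r : seq K) (u : K -> nat -> R)
    (l : K -> R) : (forall k, u k n @[n --> \oo] --> l k) ->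
  \sum_(k <- r) u k n @[n --> \oo] --> \sum_(k <- r) l k.
Proof.
move=> h; elim: r => [|k r IH].
  by under eq_fun do rewrite big_nil; rewrite big_nil; exact: cvg_cst.
by under eq_fun do rewrite big_cons; rewrite big_cons; exact: cvgD.
Qed.

Section absolutely_summable.
Context {R : realType}.
Implicit Types I J : choiceType.

Definition asum I (a : I -> R) : Prop :=
  (\esum_(i in [set: I]) (`|a i|)%:E < +oo)%E.

Lemma esum_le_seq I (a : I -> R) (M : R) :
  (forall s, uniq s -> \sum_(i <- s) a i <= M) ->
  (\esum_(i in [set: I]) (a i)%:E <= M%:E)%E.
Proof.
move=> h; apply: ge_ereal_sup => _ [A [finA _] <-].
rewrite fsbig_finite//= sumEFin lee_fin; apply: h; exact: finmap.fset_uniq.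
Qed.

Lemma esum_ge_seq I (a : I -> R) (s : seq I) : (forall i, 0 <= a i) -> uniq s ->
  ((\sum_(i <- s) a i)%:E <= \esum_(i in [set: I]) (a i)%:E)%E.
Proof.
move=> a0 us; apply: esum_ge; exists [set` s]; first by split.
rewrite -fsbig_seq//= sumEFin//.
Qed.

Lemma ge0_tsum I (a : I -> R) : (forall i, 0 <= a i) ->
  tsum a = fine (\esum_(i in [set: I]) (a i)%:E).
Proof.
move=> a0; rewrite /tsum [X in (_ - X)%E]esum1 ?sube0; last first.
  by move=> i _; rewrite funenegE /= max_r// lee_fin oppr_le0.
by congr fine; apply: eq_esum => i _; rewrite funeposE/= max_l// lee_fin.
Qed.

Lemma eq_tsum I (a b : I -> R) : a =1 b -> tsum a = tsum b.
Proof. by move=> /funext ->. Qed.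

Lemma asumE I (a : I -> R) : (forall i, 0 <= a i) -> asum a ->
  \esum_(i in [set: I]) (a i)%:E = (tsum a)%:E.
Proof.
move=> a0 h; rewrite ge0_tsum// fineK//.
rewrite fin_numElt; move: h; rewrite /asum.
rewrite (eq_esum (b := fun i => (a i)%:E)); last by move=> i _; rewrite ger0_norm.
move=> ->; rewrite andbT (lt_le_trans (ltNyr 0))// esum_ge0// => i _.
by rewrite lee_fin.
Qed.

Lemma asumP I (a : I -> R) (M : R) :
  (forall s, uniq s -> \sum_(i <- s) `|a i| <= M) -> asum a.
Proof. by move=> h; apply: le_lt_trans (esum_le_seq h) (ltry _). Qed.

Lemma asum_norm I (a : I -> R) : asum a -> asum (fun i => `|a i|).
Proof.
by rewrite /asum; under [in X in _ -> X]eq_esum do rewrite normr_id.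
Qed.

Lemma le_asum I (a b : I -> R) : (forall i, `|a i| <= b i) -> asum b -> asum a.
Proof.
move=> ab; apply: le_lt_trans; apply: le_esum => i _; rewrite lee_fin.
exact: le_trans (ab i) (ler_norm _).
Qed.

Lemma tsum_ge_seq I (a : I -> R) (s : seq I) : (forall i, 0 <= a i) -> asum a -> uniq s ->
  \sum_(i <- s) a i <= tsum a.
Proof. by move=> a0 ha us; rewrite -lee_fin -asumE//; exact: esum_ge_seq. Qed.

Lemma tsum_ge0 I (a : I -> R) : (forall i, 0 <= a i) -> 0 <= tsum a.
Proof.
move=> a0; rewrite ge0_tsum// fine_ge0// esum_ge0// => i _; by rewrite lee_fin.
Qed.

Lemma asum_finseq I (a : I -> R) (s : seq I) : asum a -> uniq s ->
  \sum_(i <- s) `|a i| <= tsum (fun i => `|a i|).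
Proof. by move=> ha us; apply: tsum_ge_seq => //; exact: asum_norm. Qed.

Lemma tsum_le_seq I (a : I -> R) M : (forall i, 0 <= a i) ->
  (forall s, uniq s -> \sum_(i <- s) a i <= M) -> tsum a <= M.
Proof.
move=> a0 h; rewrite -lee_fin -asumE//; first exact: esum_le_seq.
apply: (@asumP _ _ M) => s us; rewrite (le_trans _ (h s us))//.
by apply: ler_sum => i _; rewrite ger0_norm.
Qed.

Lemma asumD I (a b : I -> R) : asum a -> asum b -> asum (fun i => a i + b i).
Proof.
move=> ha hb.
apply: (@asumP _ _ (tsum (fun i => `|a i|) + tsum (fun i => `|b i|))) => s us.
apply: le_trans (lerD (asum_finseq ha us) (asum_finseq hb us)).
by rewrite -big_split/=; apply: ler_sum => i _; exact: ler_normD.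
Qed.

Lemma asumZ I (c : R) (a : I -> R) : asum a -> asum (fun i => c * a i).
Proof.
move=> ha; apply: (@asumP _ _ (`|c| * tsum (fun i => `|a i|))) => s us.
under eq_bigr do rewrite normrM.
by rewrite -mulr_sumr ler_wpM2l//; exact: asum_finseq.
Qed.

Lemma asumN I (a : I -> R) : asum a -> asum (fun i => - a i).
Proof. by move=> /(asumZ (-1)); under eq_fun do rewrite mulN1r. Qed.

Lemma asumB I (a b : I -> R) : asum a -> asum b -> asum (fun i => a i - b i).
Proof. by move=> ha hb; apply: asumD => //; exact: asumN. Qed.

Lemma asum_sum I (K : Type) (r : seq K) (a : K -> I -> R) :
  (forall k, asum (a k)) -> asum (fun i => \sum_(k <- r) a k i).
Proof.
move=> ha; elim: r => [|k r IH].
  apply: (@asumP _ _ 0) => s _; rewrite big1// => i _; by rewrite big_nil normr0.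
by under eq_fun do rewrite big_cons; apply: asumD.
Qed.

(** [esumB] allows the positive and negative parts in [tsum] to be replaced by any nonnegative
    summable families with the same difference. The linearity of [tsum] rests on this. *)
Lemma tsumB_ge0 I (p q : I -> R) : (forall i, 0 <= p i) -> (forall i, 0 <= q i) ->
  asum p -> asum q -> tsum (fun i => p i - q i) = tsum p - tsum q.
Proof.
move=> p0 q0 hp hq; rewrite /tsum.
have := @esumB R I [set: I] (EFin \o p) (EFin \o q) hp hq.
have -> : ((EFin \o p) \- (EFin \o q))%E = EFin \o (fun i => p i - q i).
  by apply/funext => i /=; rewrite EFinB.
move=> ->; try by move=> i _ /=; rewrite lee_fin.
by rewrite /= asumE// asumE//= -/(tsum p) -/(tsum q).
Qed.

Lemma tsumD_ge0 I (p q : I -> R) : (forall i, 0 <= p i) -> (forall i, 0 <= q i) ->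
  asum p -> asum q -> tsum (fun i => p i + q i) = tsum p + tsum q.
Proof.
move=> p0 q0 hp hq; apply/EFin_inj.
rewrite -asumE//; [|by move=> i; exact: addr_ge0|exact: asumD].
under eq_esum do rewrite EFinD.
by rewrite esumD ?EFinD ?asumE// => i _; rewrite lee_fin.
Qed.

Definition pospart (I : Type) (a : I -> R) i := (`|a i| + a i) / 2.
Definition negpart (I : Type) (a : I -> R) i := (`|a i| - a i) / 2.

Lemma pospart_ge0 (I : Type) (a : I -> R) i : 0 <= pospart a i.
Proof. by rewrite /pospart divr_ge0// -lerBlDr sub0r -normrN ler_norm. Qed.
Lemma negpart_ge0 (I : Type) (a : I -> R) i : 0 <= negpart a i.
Proof. by rewrite /negpart divr_ge0// subr_ge0 ler_norm. Qed.
Lemma pospart_negpart (I : Type) (a : I -> R) i : a i = pospart a i - negpart a i.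
Proof. by rewrite /pospart /negpart; lra. Qed.
Lemma asum_pos I (a : I -> R) : asum a -> asum (pospart a).
Proof.
move=> ha; rewrite /pospart; under eq_fun do rewrite mulrC.
by apply: asumZ; apply: asumD => //; exact: asum_norm.
Qed.
Lemma asum_neg I (a : I -> R) : asum a -> asum (negpart a).
Proof.
move=> ha; rewrite /negpart; under eq_fun do rewrite mulrC.
by apply: asumZ; apply: asumB => //; exact: asum_norm.
Qed.
Lemma tsum_posneg I (a : I -> R) : asum a -> tsum a = tsum (pospart a) - tsum (negpart a).
Proof.
move=> ha; rewrite -(tsumB_ge0 (pospart_ge0 a) (negpart_ge0 a)) .
- by apply: eq_tsum => i; exact: pospart_negpart.
- exact: asum_pos.
- exact: asum_neg.
Qed.

Lemma tsumD I (a b : I -> R) : asum a -> asum b ->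
  tsum (fun i => a i + b i) = tsum a + tsum b.
Proof.
move=> ha hb; rewrite (tsum_posneg ha) (tsum_posneg hb) addrACA -opprD.
have hap := asum_pos ha; have hbp := asum_pos hb.
have han := asum_neg ha; have hbn := asum_neg hb.
rewrite -(tsumD_ge0 (pospart_ge0 a) (pospart_ge0 b) hap hbp).
rewrite -(tsumD_ge0 (negpart_ge0 a) (negpart_ge0 b) han hbn) -tsumB_ge0//.
- apply: eq_tsum => i; rewrite (pospart_negpart a) (pospart_negpart b); lra.
- by move=> i; rewrite addr_ge0 ?pospart_ge0 ?negpart_ge0.
- by move=> i; rewrite addr_ge0 ?pospart_ge0 ?negpart_ge0.
- exact: asumD.
- exact: asumD.
Qed.

Lemma tsumN I (a : I -> R) : asum a -> tsum (fun i => - a i) = - tsum a.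
Proof.
move=> ha; rewrite (tsum_posneg ha) opprB -(tsumB_ge0 (negpart_ge0 a) (pospart_ge0 a)).
- by apply: eq_tsum => i; rewrite (pospart_negpart a) opprB.
- exact: asum_neg.
- exact: asum_pos.
Qed.

Lemma tsumB I (a b : I -> R) : asum a -> asum b ->
  tsum (fun i => a i - b i) = tsum a - tsum b.
Proof. by move=> ha hb; rewrite tsumD// ?tsumN//; exact: asumN. Qed.

Lemma ler_tsum I (a b : I -> R) : asum a -> asum b ->
  (forall i, a i <= b i) -> tsum a <= tsum b.
Proof.
move=> ha hb ab; rewrite -subr_ge0 -tsumB//; apply: tsum_ge0 => i.
by rewrite subr_ge0.
Qed.

Lemma tsumZ_le I (c : R) (a : I -> R) : 0 < c -> (forall i, 0 <= a i) -> asum a ->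
  tsum (fun i => c * a i) <= c * tsum a.
Proof.
move=> c0 a0 ha; apply: tsum_le_seq => [i|s us].
  by rewrite mulr_ge0// ltW.
by rewrite -mulr_sumr; apply: ler_wpM2l; [exact: ltW|exact: tsum_ge_seq].
Qed.

Lemma tsumZ_ge0 I (c : R) (a : I -> R) : 0 < c -> (forall i, 0 <= a i) -> asum a ->
  tsum (fun i => c * a i) = c * tsum a.
Proof.
move=> c0 a0 ha; apply/eqP; rewrite eq_le tsumZ_le//=.
have := @tsumZ_le I c^-1 (fun i => c * a i).
rewrite invr_gt0 c0 => /(_ erefl).
rewrite (_ : (fun i => c^-1 * (c * a i)) = a); last first.
  by apply/funext => i; rewrite mulKf// gt_eqF.
rewrite ler_pdivlMl// => -> //; first by move=> i; rewrite mulr_ge0// ltW.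
exact: asumZ.
Qed.

Lemma tsumZ I (c : R) (a : I -> R) : asum a -> tsum (fun i => c * a i) = c * tsum a.
Proof.
wlog c0 : c / 0 < c => [hw|] ha.
  have [c0|c0|<-] := ltgtP 0 c; first exact: hw.
    rewrite -[c]opprK; under eq_fun do rewrite mulNr.
    by rewrite tsumN; [rewrite mulNr hw// oppr_gt0|exact: asumZ].
  rewrite mul0r; under eq_fun do rewrite mul0r.
  by rewrite ge0_tsum// esum1.
have [hp hn] := (asum_pos ha, asum_neg ha).
rewrite (tsum_posneg ha) mulrBr.
rewrite -(tsumZ_ge0 c0 (pospart_ge0 a) hp) -(tsumZ_ge0 c0 (negpart_ge0 a) hn) -tsumB_ge0.
- by apply: eq_tsum => i; rewrite -mulrBr -pospart_negpart.
- by move=> i; rewrite mulr_ge0 ?pospart_ge0// ltW.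
- by move=> i; rewrite mulr_ge0 ?negpart_ge0// ltW.
- exact: asumZ.
- exact: asumZ.
Qed.

Lemma tsum0 I : tsum (fun _ : I => 0 : R) = 0.
Proof. by rewrite ge0_tsum// esum1. Qed.

Lemma asum0 I : asum (fun _ : I => 0 : R).
Proof. by apply: (@asumP _ _ 0) => s _; rewrite big1// => i _; rewrite normr0. Qed.

Lemma tsum_sum I (K : Type) (r : seq K) (a : K -> I -> R) :
  (forall k, asum (a k)) ->
  tsum (fun i => \sum_(k <- r) a k i) = \sum_(k <- r) tsum (a k).
Proof.
move=> ha; elim: r => [|k r IH].
  by rewrite big_nil; under eq_fun do rewrite big_nil; exact: tsum0.
under eq_fun do rewrite big_cons.
by rewrite tsumD ?big_cons ?IH//; exact: asum_sum.
Qed.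

Lemma ler_norm_tsum I (a : I -> R) : asum a -> `|tsum a| <= tsum (fun i => `|a i|).
Proof.
move=> ha; rewrite ler_norml -tsumN; last exact: asum_norm.
have h1 := asum_norm ha; have h2 := asumN h1.
rewrite !ler_tsum// => i; first exact: ler_norm.
by rewrite lerNl -normrN ler_norm.
Qed.

Lemma asum_single I (i0 : I) (a : I -> R) : (forall i, i != i0 -> a i = 0) -> asum a.
Proof.
move=> h; apply: (@asumP _ _ `|a i0|) => s us.
rewrite (bigID (pred1 i0))/= [X in _ + X]big1 ?addr0; last first.
  by move=> i /h ->; rewrite normr0.
have [i0s|/negP i0s] := boolP (i0 \in s).
  by rewrite -big_filter filter_pred1_uniq// big_seq1.
rewrite big_seq_cond big1// => i /andP[si /eqP ii]; by move: i0s; rewrite -ii si.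
Qed.

Lemma tsum_single I (i0 : I) (a : I -> R) : (forall i, i != i0 -> a i = 0) ->
  tsum a = a i0.
Proof.
wlog a0 : a / forall i, 0 <= a i => [hw h|h].
  have ha := asum_single h.
  rewrite (tsum_posneg ha) !hw -?pospart_negpart//.
  - by move=> i; exact: negpart_ge0.
  - by move=> i /h; rewrite /negpart => ->; rewrite normr0 subr0 mul0r.
  - by move=> i; exact: pospart_ge0.
  - by move=> i /h; rewrite /pospart => ->; rewrite normr0 addr0 mul0r.
have ha := asum_single h; apply/eqP; rewrite eq_le; apply/andP; split.
  apply: tsum_le_seq => // s us.
  rewrite (bigID (pred1 i0))/= [X in _ + X]big1 ?addr0; last by move=> i /h.
  have [i0s|/negP i0s] := boolP (i0 \in s).
    by rewrite -big_filter filter_pred1_uniq// big_seq1.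
  rewrite big_seq_cond big1// => i /andP[si /eqP ii]; by move: i0s; rewrite -ii si.
have := @tsum_ge_seq _ a [:: i0] a0 ha.
by rewrite big_seq1; apply.
Qed.

Lemma asum_fin I (a : I -> R) (s : seq I) : (forall i, i \notin s -> a i = 0) -> asum a.
Proof.
move=> h; pose b (k : I) i := if i == k then a k else 0.
have -> : a = fun i => \sum_(k <- undup s) b k i.
  apply/funext => i; rewrite /b; have [si|/h ai] := boolP (i \in s).
    rewrite (bigD1_seq i) ?mem_undup ?undup_uniq//= eqxx big1 ?addr0// => k.
    by rewrite eq_sym => /negPf ->.
  by rewrite ai big1// => k _; case: eqVneq => // <-.
apply: asum_sum => k; apply: (@asum_single _ k) => i; rewrite /b => /negPf ->//.
Qed.

Lemma tsum_fin I (a : I -> R) (s : seq I) : uniq s -> (forall i, i \notin s -> a i = 0) ->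
  tsum a = \sum_(i <- s) a i.
Proof.
move=> us h; pose b (k : I) i := if i == k then a k else 0.
have {1}-> : a = fun i => \sum_(k <- s) b k i.
  apply/funext => i; rewrite /b; have [si|/h ai] := boolP (i \in s).
    rewrite (bigD1_seq i) //= eqxx big1 ?addr0// => k.
    by rewrite eq_sym => /negPf ->.
  by rewrite ai big1// => k _; case: eqVneq => // <-.
rewrite tsum_sum => [|k]; last first.
  by apply: (@asum_single _ k) => i; rewrite /b => /negPf ->//.
apply: eq_bigr => k _; rewrite (@tsum_single _ k) /b ?eqxx// => i.
by move=> /negPf ->.
Qed.

Lemma set_bij_bijective (I J : Type) (h : I -> J) : bijective h ->
  set_bij [set: I] [set: J] h.
Proof.
move=> [k hk kh]; split => //.
- by move=> x y _ _ /(congr1 k); rewrite !hk.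
- by move=> y _; exists (k y) => //; rewrite kh.
Qed.

Lemma asum_reindex I J (h : I -> J) (a : J -> R) : bijective h ->
  asum (a \o h) <-> asum a.
Proof.
move=> /set_bij_bijective bh; rewrite /asum.
by rewrite (@reindex_esum R I J setT setT h _ bh).
Qed.

Lemma tsum_reindex I J (h : I -> J) (a : J -> R) : bijective h ->
  tsum (a \o h) = tsum a.
Proof.
move=> /set_bij_bijective bh; rewrite /tsum.
rewrite (@reindex_esum R I J setT setT h ((EFin \o a)^\+)%E bh).
rewrite (@reindex_esum R I J setT setT h ((EFin \o a)^\-)%E bh).
by congr (fine (_ - _)); apply: eq_esum => i _; rewrite ?funeposE ?funenegE.
Qed.

Lemma asum_ge0_lty I (a : I -> R) : (forall i, 0 <= a i) ->
  (\esum_(i in [set: I]) (a i)%:E < +oo)%E -> asum a.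
Proof.
by move=> a0; rewrite /asum; under [X in _ -> (X < _)%E]eq_esum do rewrite ger0_norm//.
Qed.

Lemma asum_pairl I J (a : I * J -> R) i : asum a -> asum (fun j => a (i, j)).
Proof.
move=> ha; apply: (@asumP _ _ (tsum (fun i => `|a i|))) => s us.
rewrite -(big_map (fun j => (i, j)) xpredT (fun p => `|a p|)).
by apply: asum_finseq => //; rewrite map_inj_uniq// => x y [].
Qed.

Lemma esum_pair_ge0 I J (a : I * J -> R) : (forall p, 0 <= a p) ->
  (forall i, asum (fun j => a (i, j))) ->
  (\esum_(p in [set: I * J]) (a p)%:E =
   \esum_(i in [set: I]) (tsum (fun j => a (i, j)))%:E)%E.
Proof.
move=> a0 ha.
under [RHS]eq_esum do rewrite -asumE//.
rewrite (@esum_esum _ _ _ _ _ (fun i j => (a (i, j))%:E)); last first.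
  by move=> i j _ _; rewrite lee_fin.
rewrite (_ : [set: I] `*`` (fun=> [set: J]) = [set: I * J]); last first.
  by apply/seteqP; split.
by apply: eq_esum => -[].
Qed.

Lemma asum_pair I J (a : I * J -> R) : (forall i, asum (fun j => a (i, j))) ->
  asum (fun i => tsum (fun j => `|a (i, j)|)) -> asum a.
Proof.
move=> h1 h2; rewrite /asum esum_pair_ge0//; last by move=> i; exact: asum_norm.
rewrite asumE ?ltry// => i; exact: tsum_ge0.
Qed.

Lemma asum_tsum I J (a : I * J -> R) : asum a ->
  asum (fun i => tsum (fun j => a (i, j))).
Proof.
move=> ha; have h i := asum_pairl i ha.
apply: (@le_asum _ _ (fun i => tsum (fun j => `|a (i, j)|))).
  by move=> i; exact: ler_norm_tsum.
apply: asum_ge0_lty => [i|]; first exact: tsum_ge0.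
rewrite -(@esum_pair_ge0 _ _ (fun p => `|a p|))//.
by move=> i; exact: asum_norm.
Qed.

Lemma tsum_pair_ge0 I J (a : I * J -> R) : (forall p, 0 <= a p) -> asum a ->
  tsum a = tsum (fun i => tsum (fun j => a (i, j))).
Proof.
move=> a0 ha; apply: EFin_inj; rewrite -asumE// esum_pair_ge0//; last first.
  by move=> i; exact: asum_pairl.
by rewrite asumE//; [move=> i; exact: tsum_ge0|exact: asum_tsum].
Qed.

Lemma tsum_pair I J (a : I * J -> R) : asum a ->
  tsum a = tsum (fun i => tsum (fun j => a (i, j))).
Proof.
move=> ha; have [hp hn] := (asum_pos ha, asum_neg ha).
rewrite (tsum_posneg ha) (tsum_pair_ge0 (pospart_ge0 a) hp).
rewrite (tsum_pair_ge0 (negpart_ge0 a) hn) -tsumB; try exact: asum_tsum.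
by apply: eq_tsum => i; rewrite (tsum_posneg (asum_pairl i ha)).
Qed.

Lemma asumM I J (a : I -> R) (b : J -> R) : asum a -> asum b ->
  asum (fun p : I * J => a p.1 * b p.2).
Proof.
move=> ha hb; apply: asum_pair => [i|] /=; first exact: asumZ.
rewrite (_ : (fun i => _) = fun i => tsum (fun j => `|b j|) * `|a i|).
  by apply: asumZ; exact: asum_norm.
apply/funext => i; rewrite mulrC -tsumZ; last exact: asum_norm.
by apply: eq_tsum => j; rewrite normrM.
Qed.

Lemma tsumM I J (a : I -> R) (b : J -> R) : asum a -> asum b ->
  tsum (fun p : I * J => a p.1 * b p.2) = tsum a * tsum b.
Proof.
move=> ha hb; rewrite tsum_pair/=; last exact: asumM.
rewrite mulrC -tsumZ//; apply: eq_tsum => i; by rewrite tsumZ// mulrC.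
Qed.

(** The finite set depends on [b] only and serves every [c] below [b]: outside [s], the sum of [c]
    is at most that of [b]. Dominated convergence needs this uniformity. *)
Lemma tsum_tail I (b : I -> R) (e : R) : (forall i, 0 <= b i) -> asum b -> 0 < e ->
  exists2 s : seq I, uniq s & forall c : I -> R,
    (forall i, 0 <= c i <= b i) -> tsum c <= \sum_(i <- s) c i + e.
Proof.
move=> b0 hb e0.
have [s us hs] : exists2 s : seq I, uniq s & tsum b - e < \sum_(i <- s) b i.
  apply: contrapT => /forall2NP h.
  have : tsum b <= tsum b - e.
    apply: tsum_le_seq => // s us; rewrite leNgt; apply/negP => hs.
    by case: (h s).
  by move: e0; lra.
exists s => // c cb.
have hc : asum c.
  by apply: le_asum hb => i; case/andP: (cb i) => c0 cbi; rewrite ger0_norm.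
have := @tsum_ge_seq _ (fun i => b i - c i) s _ (asumB hb hc) us.
rewrite tsumB// sumrB => h; have : forall i, 0 <= b i - c i.
  by move=> i; case/andP: (cb i); rewrite subr_ge0.
by move=> /h; move: hs; lra.
Qed.

Lemma tsum_dominated I (a : nat -> I -> R) (l b : I -> R) : asum b ->
  (forall n i, `|a n i| <= b i) -> (forall i, a n i @[n --> \oo] --> l i) ->
  asum l /\ tsum (a n) @[n --> \oo] --> tsum l.
Proof.
move=> hb ab al.
have lb i : `|l i| <= b i.
  have h : `|a n i| @[n --> \oo] --> `|l i| by apply: cvg_norm; exact: al.
  rewrite -(cvg_lim _ h)//; apply: limr_le; first by apply/cvg_ex; exists `|l i|.
  by apply: nearW => n; exact: ab.
have b0 i : 0 <= b i by exact: le_trans (lb i).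
have hl : asum l by exact: le_asum hb.
have ha n : asum (a n) by exact: le_asum hb.
split => //; apply/cvgrPdist_le => e e0.
have e2 : 0 < e / 2 by rewrite divr_gt0.
(* Since [|l i - a n i| <= 2 * b i], the finite set is chosen for [2 * b]; the tail and the finite
   sum get [e / 2] each. *)
have [||s us hs] := @tsum_tail _ (fun i => 2 * b i) _ _ _ e2.
- by move=> i; rewrite mulr_ge0.
- exact: asumZ.
have h0 : \sum_(i <- s) `|l i - a n i| @[n --> \oo] --> 0.
  rewrite [X in _ --> X](_ : 0 = \sum_(i <- s) 0); last by rewrite big1.
  apply: cvg_sumr => i; rewrite -(normr0 R); apply: cvg_norm.
  rewrite -(subrr (l i)); apply: cvgB; [exact: cvg_cst|exact: al].
move/cvgrPdist_le : h0 => /(_ _ e2); apply: filterS => n.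
rewrite sub0r normrN ger0_norm ?sumr_ge0// => hn.
rewrite -tsumB//; apply: le_trans (ler_norm_tsum (asumB hl (ha n))) _.
apply: le_trans (hs _ _) _ => [i|].
  rewrite normr_ge0/=; apply: le_trans (ler_normB _ _) _.
  by have := lb i; have := ab n i; lra.
by move: hn; lra.
Qed.
End absolutely_summable.

(** * Square summable families and contractions *)

Section ryser.
Context {R : comNzRingType}.

(** Inclusion-exclusion as a product: each [i] contributes the factor [1 + 0] if it lies in [T] and
    [1 + (-1)] otherwise, so the product vanishes unless [T] is everything. *)
Lemma sum_sign_supersets n (T : {set 'I_n}) :
  \sum_(S : {set 'I_n} | T \subset S) (-1) ^+ (n - #|S|) = (T == [set: 'I_n]%SET)%:R :> R.
Proof.
transitivity (\sum_(S : {set 'I_n}) \prod_i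
    (if i \in S then 1 else if i \in T then 0 else -1) : R).
  rewrite big_mkcond; apply: eq_bigr => S _; case: ifPn => [TS|/fintype.subsetPn[i iT iS]].
    rewrite (bigID (mem S))/= big1 ?mul1r => [|i ->//].
    rewrite (eq_bigr (fun=> -1)) => [|i iS]; last first.
      by rewrite (negbTE iS) ifN//; apply: contra iS => /(fintype.subsetP TS).
    rewrite prodr_const; congr (_ ^+ _).
    have := cardC (mem S); rewrite card_ord => /(congr1 (subn^~ #|S|)).
    by rewrite addKn => <-; apply: eq_card => i; rewrite !inE.
  by rewrite (bigD1 i)//= (negbTE iS) iT mul0r.
rewrite -bigA_distr; case: eqVneq => [->|TT].
  by rewrite big1// => i _; rewrite inE/= addr0.
have /existsP[i iT] : [exists i, i \notin T].
  rewrite -negb_forall; apply: contra TT => /forallP h.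
  by apply/eqP/setP => i; rewrite h inE.
by rewrite (bigD1 i)//= (negbTE iT) addrN mul0r.
Qed.

(** Ryser's formula for the permanent. Expanding the products gives all maps [f] with image in [S];
    the signs cancel every map that is not onto, and the remaining ones are permutations. *)
Lemma ryser n (A : 'I_n -> 'I_n -> R) :
  \sum_(S : {set 'I_n}) (-1) ^+ (n - #|S|) * \prod_k \sum_(l in S) A l k =
  \sum_(s : {perm 'I_n}) \prod_k A (s k) k.
Proof.
transitivity (\sum_(f : {ffun 'I_n -> 'I_n})
    (\prod_k A (f k) k) * (f @: [set: 'I_n]%SET == [set: 'I_n]%SET)%:R).
  under eq_bigr => S _ do
    rewrite (bigA_distr_big (mem S) (fun k l => A l k)) big_mkcond mulr_sumr.
  rewrite exchange_big/=; apply: eq_bigr => f _.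
  rewrite -sum_sign_supersets [X in _ = _ * X]big_mkcond/= [RHS]mulr_sumr.
  apply: eq_bigr => S _.
  have -> : (f \in ffun_on (mem S)) = (f @: [set: 'I_n]%SET \subset S).
    apply/ffun_onP/fintype.subsetP => [h _ /imsetP[i _ ->]|h i]; first exact: h.
    by apply: h; exact: imset_f.
  by case: ifP; rewrite ?mulr0// mulrC.
under eq_bigr do rewrite mulr_natr mulrb.
(* [insubd] sends a map that is not injective to the identity; this default is never reached,
   because a map of ['I_n] onto itself is injective. *)
rewrite -big_mkcond/= (reindex_onto (fun s : {perm 'I_n} => [ffun i => s i])
  (fun f => insubd (1%g : {perm 'I_n}) f)) /=; last first.
  move=> f /eqP h; apply/ffunP => i; rewrite ffunE.
  have fi : injective f.
    suff : {in [set: 'I_n]%SET &, injective f} by move=> fi x y; apply: fi; rewrite inE.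
    by apply/imset_injP; rewrite h.
  by rewrite -pvalE insubdK//; exact/injectiveP.
apply: eq_big => [s|s _]; last by apply: eq_bigr => i _; rewrite ffunE.
apply/andP; split.
  apply/eqP/setP => i; rewrite inE; apply/imsetP; exists ((s^-1)%g i); first by rewrite inE.
  by rewrite ffunE permKV.
apply/eqP/permP => i; rewrite -pvalE insubdK ?ffunE//.
by apply/injectiveP => x y; rewrite !ffunE; exact: perm_inj.
Qed.
End ryser.

Arguments totuple : simpl never.

Section square_summable_families.
Context {R : realType}.
Implicit Types I J K : choiceType.

Definition l2 I (u : I -> R) : Prop := asum (fun i => u i ^+ 2).

Lemma square_summableE k (u : tensor R k) : square_summable u <-> l2 u.
Proof.
rewrite /square_summable /l2 /asum.
by under [X in _ <-> (X < _)%E]eq_esum do rewrite ger0_norm ?sqr_ge0//.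
Qed.

Lemma asum_mul I (u v : I -> R) : l2 u -> l2 v -> asum (fun i => u i * v i).
Proof.
move=> hu hv; apply: le_asum (asumD hu hv) => i.
rewrite ler_norml; have := sqr_ge0 (u i + v i); have := sqr_ge0 (u i - v i).
rewrite sqrrB sqrrD; have := sqr_ge0 (u i); have := sqr_ge0 (v i).
by set p := u i * v i; lra.
Qed.

Lemma le_l2 I (u v : I -> R) : (forall i, `|u i| <= `|v i|) -> l2 v -> l2 u.
Proof.
move=> uv; apply: le_asum => i.
by rewrite normrX -(real_normK (num_real (v i))) lerXn2r// nnegrE.
Qed.

Lemma l2_norm I (u : I -> R) : l2 u -> l2 (fun i => `|u i|).
Proof. by apply: le_l2 => i; rewrite normr_id. Qed.

Lemma l2Z I (c : R) (u : I -> R) : l2 u -> l2 (fun i => c * u i).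
Proof. by move=> /(asumZ (c ^+ 2)); under eq_fun do rewrite -exprMn. Qed.

Lemma l2D I (u v : I -> R) : l2 u -> l2 v -> l2 (fun i => u i + v i).
Proof.
move=> hu hv; apply: le_asum (asumZ 2 (asumD hu hv)) => i.
rewrite ger0_norm ?sqr_ge0//; have := sqr_ge0 (u i - v i).
by rewrite sqrrB sqrrD; set p := u i * v i; lra.
Qed.

Lemma l2B I (u v : I -> R) : l2 u -> l2 v -> l2 (fun i => u i - v i).
Proof.
move=> hu /(l2Z (-1)) hv; apply: l2D => //.
by move: hv; under eq_fun do rewrite mulN1r.
Qed.

Lemma l2_sum I (A : Type) (r : seq A) (u : A -> I -> R) :
  (forall a, l2 (u a)) -> l2 (fun i => \sum_(a <- r) u a i).
Proof.
move=> h; elim: r => [|a r IH].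
  by under eq_fun do rewrite big_nil; apply: le_asum (asum0 _) => i; rewrite expr0n normr0.
by under eq_fun do rewrite big_cons; exact: l2D.
Qed.

Lemma cauchy_schwarz_tsum I (u v : I -> R) : l2 u -> l2 v ->
  tsum (fun i => u i * v i) ^+ 2 <=
  tsum (fun i => u i ^+ 2) * tsum (fun i => v i ^+ 2).
Proof.
move=> hu hv; set A := tsum (fun i => u i ^+ 2); set C := tsum (fun i => v i ^+ 2).
set B := tsum _.
have h t : 0 <= A - 2 * t * B + t ^+ 2 * C.
  have : 0 <= tsum (fun i => (u i - t * v i) ^+ 2).
    by apply: tsum_ge0 => i; exact: sqr_ge0.
  rewrite (_ : (fun i => _) = fun i => (u i ^+ 2 - 2 * t * (u i * v i)) + t ^+ 2 * v i ^+ 2).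
    have huv := asum_mul hu hv.
    have h1 := asumZ (2 * t) huv; have h2 := asumZ (t ^+ 2) hv.
    by rewrite tsumD//; [rewrite tsumB// !tsumZ|exact: asumB].
  by apply/funext => i; ring.
have C0 : 0 <= C by apply: tsum_ge0 => i; exact: sqr_ge0.
have [C0'|C0'] := eqVneq C 0; last first.
  (* [B / C] minimizes the quadratic. If [C = 0] and [B] is nonzero, its value -1 at
     [(A + 1) / (2 * B)] contradicts [h]. *)
  have := h (B / C); have Cp : 0 < C by rewrite lt_def C0' C0.
  rewrite (_ : _ + _ = (A * C - B ^+ 2) / C); last by field.
  by rewrite pmulr_lge0 ?invr_gt0// subr_ge0.
rewrite C0' mulr0; have [->|B0] := eqVneq B 0; first by rewrite expr0n.
have := h ((A + 1) / (2 * B)); rewrite C0' mulr0 addr0.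
rewrite (_ : _ - _ = -1); last by field.
by rewrite lerNr oppr0 ler10.
Qed.

Lemma tsum_nat_tuple k (c : nat -> R) : asum c ->
  asum (fun j : k.-tuple nat => \prod_(a <- j) c a) /\
  tsum (fun j : k.-tuple nat => \prod_(a <- j) c a) = tsum c ^+ k.
Proof.
move=> hc; elim: k => [|k [IH1 IH2]].
  have h : forall i : 0.-tuple nat, i != [tuple] -> \prod_(a <- i) c a = 0.
    by move=> i; rewrite tuple0 eqxx.
  split; first exact: asum_single h.
  by rewrite (tsum_single h) big_nil.
pose h (p : nat * k.-tuple nat) : k.+1.-tuple nat := cons_tuple p.1 p.2.
have bh : bijective h.
  exists (fun t => (thead t, behead_tuple t)) => [[a t]|t].
    by rewrite /h theadE; congr pair; exact: val_inj.
  by rewrite [RHS]tuple_eta; exact: val_inj.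
pose F (j : k.+1.-tuple nat) := \prod_(a <- j) c a.
have E : F \o h = fun p => c p.1 * \prod_(a <- p.2) c a.
  by apply/funext => -[a t]; rewrite /F/= big_cons.
split.
  by apply/(asum_reindex F bh); rewrite E; exact: (asumM hc IH1).
by rewrite -(tsum_reindex F bh) E (tsumM hc IH1) IH2 exprS.
Qed.

Lemma totupleK k (s : seq nat) : size s = k -> totuple k s = s :> seq nat.
Proof.
move=> sk; apply: (@eq_from_nth _ 0%N); first by rewrite size_tuple.
move=> i; rewrite size_tuple => ik.
by rewrite -[i]/(val (Ordinal ik)) -tnth_nth tnth_mktuple.
Qed.

Lemma totuple_tuple k (t : k.-tuple nat) : totuple k t = t.
Proof. by apply: val_inj; rewrite /= totupleK// size_tuple. Qed.

Lemma cat_tuple_bij r s : bijective (fun p : r.-tuple nat * s.-tuple nat =>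
  cat_tuple p.1 p.2).
Proof.
exists (fun t : (r + s).-tuple nat => (totuple r (take r t), totuple s (drop r t))) => [[t1 t2]|t].
  by rewrite /= take_size_cat ?drop_size_cat ?size_tuple// !totuple_tuple.
apply: val_inj; rewrite /= !totupleK ?cat_take_drop//.
  by rewrite size_drop size_tuple addKn.
by rewrite size_take_min size_tuple (minn_idPl (leq_addr _ _)).
Qed.

(** [F] takes sequences, so that tuples of sizes [n] and [r + s] are compared without a cast. *)
Lemma asum_cat r s n (F : seq nat -> R) : n = (r + s)%N ->
  asum (fun p : r.-tuple nat * s.-tuple nat => F (p.1 ++ p.2)) <->
  asum (fun x : n.-tuple nat => F x).
Proof.
move=> ->; exact: (asum_reindex (fun x : (r + s).-tuple nat => F x) (cat_tuple_bij r s)).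
Qed.

Lemma tsum_cat r s n (F : seq nat -> R) : n = (r + s)%N ->
  tsum (fun x : n.-tuple nat => F x) =
  tsum (fun p : r.-tuple nat * s.-tuple nat => F (p.1 ++ p.2)).
Proof.
move=> ->; exact/esym/(tsum_reindex (fun x : (r + s).-tuple nat => F x) (cat_tuple_bij r s)).
Qed.

Lemma permute_tupleM k (s t : {perm 'I_k}) j :
  permute_tuple s (permute_tuple t j) = permute_tuple (s * t)%g j.
Proof. by apply: eq_from_tnth => i; rewrite !tnth_mktuple permM. Qed.

Lemma permute_tuple1 k (j : k.-tuple nat) : permute_tuple 1%g j = j.
Proof. by apply: eq_from_tnth => i; rewrite !tnth_mktuple perm1. Qed.

Lemma permute_tuple_bij k (s : {perm 'I_k}) : bijective (@permute_tuple k s).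
Proof.
exists (permute_tuple (s^-1)%g) => j; rewrite permute_tupleM.
  by rewrite mulVg permute_tuple1.
by rewrite mulgV permute_tuple1.
Qed.

Lemma fact_neq0 k : k`!%:R != 0 :> R.
Proof. by rewrite pnatr_eq0 -lt0n fact_gt0. Qed.

Lemma symmetrize_sym k (u : tensor R k) : symmetric_tensor (symmetrize u).
Proof.
move=> s j; rewrite /symmetrize; congr (_ * _).
rewrite (reindex_inj (mulIg (s^-1)%g))/=; apply: eq_bigr => t _.
by rewrite permute_tupleM -mulgA mulVg mulg1.
Qed.

Lemma l2_permute k (s : {perm 'I_k}) (u : tensor R k) : l2 u ->
  l2 (fun j => u (permute_tuple s j)).
Proof.
move=> hu; exact/(asum_reindex (fun j => u j ^+ 2) (permute_tuple_bij s)).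
Qed.

Lemma l2_symmetrize k (u : tensor R k) : l2 u -> l2 (symmetrize u).
Proof.
by move=> hu; apply: l2Z; apply: l2_sum => s; exact: l2_permute.
Qed.

Lemma tdotC k (u v : tensor R k) : tdot u v = tdot v u.
Proof. by apply: eq_tsum => i; rewrite mulrC. Qed.

Lemma tdotZl k c (u v : tensor R k) : l2 u -> l2 v ->
  tdot (fun j => c * u j) v = c * tdot u v.
Proof.
move=> hu hv; rewrite -tsumZ; last exact: asum_mul.
by apply: eq_tsum => j; rewrite mulrA.
Qed.

Lemma tdot_suml k (A : Type) (r : seq A) (u : A -> tensor R k) v :
  (forall a, l2 (u a)) -> l2 v ->
  tdot (fun j => \sum_(a <- r) u a j) v = \sum_(a <- r) tdot (u a) v.
Proof.
move=> hu hv; rewrite -tsum_sum => [|a]; last exact: asum_mul.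
by apply: eq_tsum => j; rewrite mulr_suml.
Qed.

Lemma tdot_sumr k (A : Type) (r : seq A) (u : A -> tensor R k) v :
  (forall a, l2 (u a)) -> l2 v ->
  tdot v (fun j => \sum_(a <- r) u a j) = \sum_(a <- r) tdot v (u a).
Proof.
by move=> hu hv; rewrite tdotC tdot_suml//; apply: eq_bigr => a _; exact: tdotC.
Qed.

Lemma tdot_symmetrizel k (u v : tensor R k) : l2 u -> l2 v -> symmetric_tensor v ->
  tdot (symmetrize u) v = tdot u v.
Proof.
move=> hu hv sv; rewrite /symmetrize tdotZl//; last first.
  by apply: l2_sum => s; exact: l2_permute.
rewrite tdot_suml// => [|s]; last exact: l2_permute.
rewrite (eq_bigr (fun=> tdot u v)) => [|s _].
  by rewrite sumr_const card_Sn -[X in _ * X]mulr_natl mulrA mulVf ?mul1r ?fact_neq0.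
rewrite /tdot -[RHS](tsum_reindex _ (permute_tuple_bij s)).
by apply: eq_tsum => j /=; rewrite sv.
Qed.

Lemma tdot_ge0 k (u : tensor R k) : 0 <= tdot u u.
Proof. by apply: tsum_ge0 => j; rewrite -expr2 sqr_ge0. Qed.

Lemma tnorm_sqr k (u : tensor R k) : tnorm u ^+ 2 = tdot u u.
Proof. by rewrite sqr_sqrtr// tdot_ge0. Qed.

Lemma tdot_sqr k (u : tensor R k) : tdot u u = tsum (fun j => u j ^+ 2).
Proof. by apply: eq_tsum => j; rewrite expr2. Qed.

(** Symmetrization is an orthogonal projection: with [B] the left side, [B = tdot u (symmetrize u)],
    and Cauchy-Schwarz gives [B ^+ 2 <= tdot u u * B]. *)
Lemma tdot_symmetrize_le k (u : tensor R k) : l2 u ->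
  tdot (symmetrize u) (symmetrize u) <= tdot u u.
Proof.
move=> hu; have hs := l2_symmetrize hu; set B := tdot (symmetrize u) _.
have E : B = tdot u (symmetrize u).
  by rewrite /B tdot_symmetrizel//; exact: symmetrize_sym.
have := cauchy_schwarz_tsum hu hs; rewrite -/(tdot u (symmetrize u)) -E.
rewrite -!tdot_sqr -/B expr2; have : 0 <= B by exact: tdot_ge0.
rewrite le_eqVlt => /predU1P[<- _|B0]; first exact: tdot_ge0.
by rewrite ler_pM2r.
Qed.
End square_summable_families.

Section contractions.
Context {R : realType}.
Implicit Types I J K : choiceType.

Lemma l2_sectionr I J (u : I * J -> R) i : l2 u -> l2 (fun j => u (i, j)).
Proof. exact: (asum_pairl (a := fun p => u p ^+ 2)). Qed.

Lemma swap_bij I J : bijective (fun p : I * J => (p.2, p.1)).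
Proof. by exists (fun p => (p.2, p.1)) => -[]. Qed.

Lemma l2_swap I J (u : I * J -> R) : l2 u -> l2 (fun p : J * I => u (p.2, p.1)).
Proof.
by move=> hu; apply/(asum_reindex (fun p => u p ^+ 2) (swap_bij J I)).
Qed.

Lemma l2_sectionl I J (u : I * J -> R) j : l2 u -> l2 (fun i => u (i, j)).
Proof. by move=> /l2_swap /(l2_sectionr j). Qed.

Lemma asum_contract I J K (u : I * J -> R) (v : I * K -> R) j k :
  l2 u -> l2 v -> asum (fun i => u (i, j) * v (i, k)).
Proof. by move=> /(l2_sectionl j) hu /(l2_sectionl k) hv; exact: asum_mul. Qed.

(** The Hilbert-Schmidt norm is submultiplicative: Cauchy-Schwarz in [i] for each [(j, k)], after
    which the double sum of the bounds factors. *)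
Lemma l2_contract_le I J K (u : I * J -> R) (v : I * K -> R) : l2 u -> l2 v ->
  l2 (fun p : J * K => tsum (fun i => u (i, p.1) * v (i, p.2))) /\
  tsum (fun p : J * K => tsum (fun i => u (i, p.1) * v (i, p.2)) ^+ 2) <=
  tsum (fun p => u p ^+ 2) * tsum (fun p => v p ^+ 2).
Proof.
move=> hu hv.
pose alpha (L : choiceType) (w : I * L -> R) l := tsum (fun i => w (i, l) ^+ 2).
have hal (L : choiceType) (w : I * L -> R) : l2 w -> asum (alpha L w) /\
    tsum (alpha L w) = tsum (fun p => w p ^+ 2).
  move=> /[dup] hw /l2_swap hw'; split; first exact: (asum_tsum hw').
  rewrite -[RHS](tsum_reindex _ (swap_bij L I)) tsum_pair//; exact: hw'.
have le_ p : tsum (fun i => u (i, p.1) * v (i, p.2)) ^+ 2 <=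
    alpha J u p.1 * alpha K v p.2.
  by apply: cauchy_schwarz_tsum; exact: l2_sectionl.
have [[au eu] [av ev]] := (hal _ _ hu, hal _ _ hv).
have h : l2 (fun p : J * K => tsum (fun i => u (i, p.1) * v (i, p.2))).
  by apply: le_asum (asumM au av) => p; rewrite ger0_norm ?sqr_ge0.
by split => //; rewrite -eu -ev -(tsumM au av); apply: ler_tsum => //; exact: asumM.
Qed.

(* [u] as a matrix whose rows are indexed by the first [r] coordinates. *)
Definition unfold p r (u : tensor R p) (ij : r.-tuple nat * (p - r).-tuple nat) :=
  u (totuple p (ij.1 ++ ij.2)).

Lemma l2_unfold p r (u : tensor R p) : (r <= p)%N -> l2 u ->
  l2 (@unfold p r u).
Proof.
move=> rp hu; have E : p = (r + (p - r))%N by rewrite subnKC.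
apply/(asum_cat (fun s => u (totuple p s) ^+ 2) E).
by move: hu; rewrite /l2; under eq_fun do rewrite -[X in u X]totuple_tuple.
Qed.

Lemma tsum_unfold p r (u v : tensor R p) : (r <= p)%N ->
  tsum (fun ij => unfold (r := r) u ij * unfold v ij) = tdot u v.
Proof.
move=> rp; have E : p = (r + (p - r))%N by rewrite subnKC.
have := esym (tsum_cat (fun s => u (totuple p s) * v (totuple p s)) E).
by move=> ->; apply: eq_tsum => j; rewrite totuple_tuple.
Qed.

(** The contraction with its two blocks of free coordinates kept as a pair: no cast between the
    sizes [p + q - r.*2] and [(p - r) + (q - r)] arises, and sums over the blocks separate. *)
Definition contr p q r (u : tensor R p) (v : tensor R q)
    (yz : (p - r).-tuple nat * (q - r).-tuple nat) : R :=
  tsum (fun i : r.-tuple nat => unfold u (i, yz.1) * unfold v (i, yz.2)).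

Arguments contr {p q} r u v yz.

Lemma l2_contr p q r (u : tensor R p) (v : tensor R q) : (r <= p)%N -> (r <= q)%N ->
  l2 u -> l2 v -> l2 (contr r u v).
Proof.
move=> rp rq hu hv; exact: (l2_contract_le (l2_unfold rp hu) (l2_unfold rq hv)).1.
Qed.

(* [tcontract], as a function of sequences instead of tuples, which avoids casts. *)
Definition tcontract_seq p q r (u : tensor R p) (v : tensor R q) (x : seq nat) :=
  tsum (fun i : r.-tuple nat => u (totuple p (i ++ take (p - r) x)) *
    v (totuple q (i ++ drop (p - r) x))).

Lemma tcontract_seq_cat p q r (u : tensor R p) (v : tensor R q)
    (yz : (p - r).-tuple nat * (q - r).-tuple nat) :
  tcontract_seq r u v (yz.1 ++ yz.2) = contr r u v yz.
Proof.
by rewrite /tcontract_seq take_size_cat ?drop_size_cat ?size_tuple.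
Qed.

Lemma tcontract_dim p q r : (r <= p)%N -> (r <= q)%N ->
  (p + q - r.*2 = (p - r) + (q - r))%N.
Proof. by move=> rp rq; rewrite -addnn subnDA; lia. Qed.

Lemma l2_tcontract p q r (u : tensor R p) (v : tensor R q) : (r <= p)%N ->
  (r <= q)%N -> l2 u -> l2 v -> l2 (tcontract r u v).
Proof.
move=> rp rq hu hv.
apply/(asum_cat (fun s => tcontract_seq r u v s ^+ 2) (tcontract_dim rp rq)).
by under eq_fun do rewrite tcontract_seq_cat; exact: l2_contr.
Qed.

Lemma tdot_tcontract p q r (u u' : tensor R p) (v v' : tensor R q) : (r <= p)%N ->
  (r <= q)%N -> tdot (tcontract r u v) (tcontract r u' v') =
  tsum (fun yz => contr r u v yz * contr r u' v' yz).
Proof.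
move=> rp rq.
rewrite /tdot (tsum_cat (fun s => tcontract_seq r u v s * tcontract_seq r u' v' s)
  (tcontract_dim rp rq)).
by apply: eq_tsum => yz; rewrite !tcontract_seq_cat.
Qed.

Lemma tdot_tcontract_le p q r (u : tensor R p) (v : tensor R q) : (r <= p)%N ->
  (r <= q)%N -> l2 u -> l2 v ->
  tdot (tcontract r u v) (tcontract r u v) <= tdot u u * tdot v v.
Proof.
move=> rp rq hu hv; rewrite tdot_tcontract// -(tsum_unfold u u rp) -(tsum_unfold v v rq).
have := (l2_contract_le (l2_unfold rp hu) (l2_unfold rq hv)).2.
by under eq_tsum do rewrite expr2; under [X in _ <= X * _]eq_tsum do rewrite expr2;
   under [X in _ <= _ * X]eq_tsum do rewrite expr2.
Qed.

Lemma asum_tcontract p q r (u : tensor R p) (v : tensor R q)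
    (x : (p + q - r.*2).-tuple nat) : (r <= p)%N -> (r <= q)%N ->
  l2 u -> l2 v -> asum (fun i : r.-tuple nat =>
    u (totuple p (i ++ take (p - r) x)) * v (totuple q (i ++ drop (p - r) x))).
Proof.
move=> rp rq hu hv; have sx : size x = (p - r + (q - r))%N.
  by rewrite size_tuple; exact: tcontract_dim.
have st : totuple (p - r) (take (p - r) x) = take (p - r) x :> seq nat.
  by apply: totupleK; rewrite size_take_min sx (minn_idPl (leq_addr _ _)).
have sd : totuple (q - r) (drop (p - r) x) = drop (p - r) x :> seq nat.
  by apply: totupleK; rewrite size_drop sx addKn.
have := asum_contract (totuple (p - r) (take (p - r) x))
  (totuple (q - r) (drop (p - r) x)) (l2_unfold rp hu) (l2_unfold rq hv).
by rewrite /unfold/= st sd.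
Qed.

Lemma tcontract_suml p q r (A : Type) (s : seq A) (c : A -> R) (u : A -> tensor R p)
    (v : tensor R q) : (r <= p)%N -> (r <= q)%N -> (forall a, l2 (u a)) -> l2 v ->
  tcontract r (fun j => \sum_(a <- s) c a * u a j) v =
  fun x => \sum_(a <- s) c a * tcontract r (u a) v x.
Proof.
move=> rp rq hu hv; apply/funext => x; rewrite /tcontract.
under eq_tsum do rewrite mulr_suml.
rewrite tsum_sum => [|a].
  apply: eq_bigr => a _; rewrite -tsumZ; last exact: asum_tcontract.
  by apply: eq_tsum => i; rewrite mulrA.
by under eq_fun do rewrite -mulrA; apply: asumZ; exact: asum_tcontract.
Qed.

Lemma tcontract_sumr p q r (A : Type) (s : seq A) (c : A -> R) (v : A -> tensor R q)
    (u : tensor R p) : (r <= p)%N -> (r <= q)%N -> (forall a, l2 (v a)) -> l2 u ->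
  tcontract r u (fun j => \sum_(a <- s) c a * v a j) =
  fun x => \sum_(a <- s) c a * tcontract r u (v a) x.
Proof.
move=> rp rq hv hu; apply/funext => x; rewrite /tcontract.
under eq_tsum do rewrite mulr_sumr.
rewrite tsum_sum => [|a].
  apply: eq_bigr => a _; rewrite -tsumZ; last exact: asum_tcontract.
  by apply: eq_tsum => i; rewrite mulrCA.
by under eq_fun do rewrite mulrCA; apply: asumZ; exact: asum_tcontract.
Qed.

Lemma symmetrize_sum k (A : Type) (s : seq A) (c : A -> R) (u : A -> tensor R k) :
  symmetrize (fun j => \sum_(a <- s) c a * u a j) =
  fun j => \sum_(a <- s) c a * symmetrize (u a) j.
Proof.
apply/funext => j; rewrite /symmetrize exchange_big mulr_sumr/=.
by apply: eq_bigr => a _; rewrite -mulr_sumr mulrCA.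
Qed.

Lemma normr_tcontract p q r (u u' : tensor R p) (v v' : tensor R q) x : (r <= p)%N ->
  (r <= q)%N -> l2 u' -> l2 v' -> (forall j, `|u j| <= u' j) ->
  (forall j, `|v j| <= v' j) -> `|tcontract r u v x| <= tcontract r u' v' x.
Proof.
move=> rp rq hu hv uu vv.
have h (i : r.-tuple nat) : `|u (totuple p (i ++ take (p - r) x)) * v (totuple q (i ++ drop (p - r) x))|
   <= u' (totuple p (i ++ take (p - r) x)) * v' (totuple q (i ++ drop (p - r) x)).
  by rewrite normrM ler_pM.
have h1 := asum_tcontract (r := r) x rp rq hu hv; have h2 := le_asum h h1.
apply: le_trans (ler_norm_tsum h2) _.
by apply: ler_tsum => //; exact: asum_norm.
Qed.

Lemma cvg_tcontract p q r (un : nat -> tensor R p) (u u' : tensor R p)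
    (vn : nat -> tensor R q) (v v' : tensor R q) x : (r <= p)%N -> (r <= q)%N ->
  l2 u' -> l2 v' -> (forall n j, `|un n j| <= u' j) -> (forall n j, `|vn n j| <= v' j) ->
  (forall j, un n j @[n --> \oo] --> u j) -> (forall j, vn n j @[n --> \oo] --> v j) ->
  tcontract r (un n) (vn n) x @[n --> \oo] --> tcontract r u v x.
Proof.
move=> rp rq hu hv uu vv cu cv.
apply: (tsum_dominated (asum_tcontract (r := r) x rp rq hu hv) _ _).2 => [n i|i].
  by rewrite normrM ler_pM.
exact: cvgM.
Qed.

Lemma normr_symmetrize k (u u' : tensor R k) x : (forall j, `|u j| <= u' j) ->
  `|symmetrize u x| <= symmetrize u' x.
Proof.
move=> h; rewrite /symmetrize normrM ger0_norm ?invr_ge0// ler_wpM2l ?invr_ge0//.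
by apply: le_trans (ler_norm_sum _ _ _) _; apply: ler_sum => s _.
Qed.

Lemma cvg_symmetrize k (un : nat -> tensor R k) (u : tensor R k) x :
  (forall j, un n j @[n --> \oo] --> u j) ->
  symmetrize (un n) x @[n --> \oo] --> symmetrize u x.
Proof.
by move=> h; apply: cvgM; [exact: cvg_cst|apply: cvg_sumr => s; exact: h].
Qed.
End contractions.
Arguments contr {R p q} r u v yz.

Section tensor_powers.
Context {R : realType}.
Implicit Types x y z : nat -> R.

Definition tpow (x : nat -> R) (k : nat) : tensor R k :=
  fun j => \prod_(a <- j) x a.
Arguments tpow : clear implicits.

Definition sdot (x y : nat -> R) : R := tsum (fun a => x a * y a).

Lemma sdotC x y : sdot x y = sdot y x.
Proof. by apply: eq_tsum => a; rewrite mulrC. Qed.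

Lemma l2_tpow x k : l2 x -> l2 (tpow x k).
Proof.
move=> hx; rewrite /l2 /tpow; under eq_fun do rewrite -prodrXl.
by have [] := tsum_nat_tuple k hx.
Qed.

Lemma tdot_tpow x y k : l2 x -> l2 y -> tdot (tpow x k) (tpow y k) = sdot x y ^+ k.
Proof.
move=> hx hy; have [_ <-] := tsum_nat_tuple k (asum_mul hx hy).
by apply: eq_tsum => j; rewrite -big_split.
Qed.

Lemma tpow_sym x k : symmetric_tensor (tpow x k).
Proof.
move=> s j; rewrite /tpow !big_tuple [RHS](reindex_inj (@perm_inj _ s)) /=.
by under eq_bigr do rewrite tnth_mktuple.
Qed.

Lemma tpow_totuple x k (s : seq nat) : size s = k ->
  tpow x k (totuple k s) = \prod_(a <- s) x a.
Proof. by move=> sk; rewrite /tpow totupleK. Qed.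

Lemma contr_tpow p q r x y yz : (r <= p)%N -> (r <= q)%N -> l2 x -> l2 y ->
  contr r (tpow x p) (tpow y q) yz =
  sdot x y ^+ r * (tpow x (p - r) yz.1 * tpow y (q - r) yz.2).
Proof.
move=> rp rq hx hy; have [h1 <-] := tsum_nat_tuple r (asum_mul hx hy).
rewrite mulrC -tsumZ; last exact: h1.
apply: eq_tsum => i; rewrite /unfold/= !tpow_totuple ?size_cat ?size_tuple ?subnKC//.
by rewrite !big_cat/= big_split/= /tpow; ring.
Qed.

Lemma tdot_tcontract_tpow p q r x y (x' y' : nat -> R) : (r <= p)%N -> (r <= q)%N ->
  l2 x -> l2 y -> l2 x' -> l2 y' ->
  tdot (tcontract r (tpow x p) (tpow y q)) (tcontract r (tpow x' p) (tpow y' q)) =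
  sdot x y ^+ r * sdot x' y' ^+ r * sdot x x' ^+ (p - r) * sdot y y' ^+ (q - r).
Proof.
move=> rp rq hx hy hx' hy'; rewrite tdot_tcontract//.
under eq_tsum do rewrite !contr_tpow//.
have h k z (z' : nat -> R) : l2 z -> l2 z' -> asum (fun j => tpow z k j * tpow z' k j).
  by move=> hz hz'; apply: asum_mul; exact: l2_tpow.
rewrite -(tdot_tpow (p - r) hx hx') -(tdot_tpow (q - r) hy hy') -[RHS]mulrA.
rewrite [X in _ = _ * X](_ : _ = tsum (fun yz : (p - r).-tuple nat * (q - r).-tuple nat =>
  (tpow x (p - r) yz.1 * tpow x' (p - r) yz.1) *
  (tpow y (q - r) yz.2 * tpow y' (q - r) yz.2))); last first.
  exact/esym/(tsumM (h _ _ _ hx hx') (h _ _ _ hy hy')).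
rewrite -tsumZ; last exact: (asumM (h _ _ _ hx hx') (h _ _ _ hy hy')).
by apply: eq_tsum => yz; ring.
Qed.
End tensor_powers.
Arguments tpow {R} x k _.

(** * Polarization and contractions of tensor powers *)

Section linear_powers.
Context {F : numFieldType}.

Definition linpow (a b : F) n : {poly F} := (a *: 'X + b%:P) ^+ n.

Lemma coef_linpow (a b : F) n j :
  (linpow a b n)`_j = 'C(n, j)%:R * a ^+ j * b ^+ (n - j).
Proof.
rewrite /linpow addrC exprDn coef_sum.
have E (i : 'I_n.+1) : ((b%:P ^+ (n - i) * (a *: 'X) ^+ i) *+ 'C(n, i))`_j =
    ('C(n, i)%:R * a ^+ i * b ^+ (n - i)) * (j == i)%:R.
  rewrite exprZn -polyC_exp -scalerAr coefMn coefZ coefCM coefXn.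
  by rewrite -mulr_natl; ring.
rewrite (eq_bigr _ (fun i _ => E i)); have [jn|jn] := leqP j n.
  rewrite (bigD1 (Ordinal (jn : (j < n.+1)%N)))//= eqxx mulr1 big1 ?addr0// => i ij.
  by rewrite (_ : (j == i) = false) ?mulr0//; apply: contraNF ij => /eqP ji; apply/eqP/val_inj.
rewrite bin_small// !mul0r big1// => i _; case: eqP => [ji|]; rewrite ?mulr0//.
by move: jn; rewrite ji ltnNge -ltnS ltn_ord.
Qed.

Lemma size_linear (a b : F) : (size (a *: 'X + b%:P)%R <= 2)%N.
Proof.
apply: leq_trans (size_polyD _ _) _; rewrite geq_max.
rewrite (leq_trans (size_scale_leq _ _)) ?size_polyX//=.
by rewrite size_polyC; case: eqP.
Qed.

Lemma size_polyM_bound (p q : {poly F}) a b : (size p <= a.+1)%N ->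
  (size q <= b.+1)%N -> (size (p * q)%R <= (a + b).+1)%N.
Proof.
by move=> hp hq; apply: leq_trans (size_polyMleq p q) _; move: hp hq; lia.
Qed.

Lemma size_linpow (a b : F) n : (size (linpow a b n) <= n.+1)%N.
Proof.
apply: leq_trans (size_poly_exp_leq _ _) _; rewrite ltnS.
rewrite -[X in (_ <= X)%N]mul1n leq_mul2r; apply/orP; right.
by have := size_linear a b; case: size.
Qed.

Lemma horner_linpow (a b t : F) n : (linpow a b n).[t] = (t * a + b) ^+ n.
Proof. by rewrite /linpow horner_exp !hornerE mulrC. Qed.

(** In characteristic 0 the points [0, ..., N - 1] are [N] distinct roots of a difference of size at
    most [N]. *)
Lemma horner_coef_unique N (c : nat -> F) (p : {poly F}) : (size p <= N)%N ->
  (forall t, \sum_(a < N) t ^+ a * c a = p.[t]) -> forall a : 'I_N, c a = p`_a.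
Proof.
move=> sp h a; pose q := \poly_(i < N) c i.
suff -> : p = q by rewrite coef_poly ltn_ord.
apply/eqP; rewrite -subr_eq0; apply/eqP.
apply: (@roots_geq_poly_eq0 _ _ [seq i%:R | i <- iota 0 N]).
- apply/allP => t _; rewrite /root hornerD hornerN -h horner_poly.
  by rewrite subr_eq0; apply/eqP/eq_bigr => i _; rewrite mulrC.
- rewrite map_inj_uniq ?iota_uniq// => i j /eqP.
  by rewrite eqr_nat => /eqP.
- rewrite size_map size_iota; apply: leq_trans (size_polyD _ _) _.
  by rewrite geq_max sp size_polyN size_poly.
Qed.
End linear_powers.

Section polarization.
Context {R : realType}.
Implicit Types x y z w : nat -> R.

(** Coordinates of the sum of the basis vectors [e_(j_l)] over [l] in [S]; polarization uses the
    tensor powers of these vectors. *)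
Definition subset_sum n (j : n.-tuple nat) (S : {set 'I_n}) : nat -> R :=
  fun b => \sum_(l in S) (tnth j l == b)%:R.

Lemma l2_subset_sum n (j : n.-tuple nat) S : l2 (subset_sum j S).
Proof.
apply: (@asum_fin _ _ _ j) => b bj; rewrite /subset_sum big1 ?expr0n// => l _.
by case: eqVneq bj => // <-; rewrite mem_tnth.
Qed.

(** Ryser's formula for the 0-1 matrix with entries [j_l == i_k]. Up to the factor [n!], the right
    side is the symmetrization of the basis tensor of index [j]. *)
Lemma polarization n (j i : n.-tuple nat) :
  \sum_(S : {set 'I_n}) (-1) ^+ (n - #|S|) * tpow (subset_sum j S) n i =
  \sum_(s : {perm 'I_n}) (permute_tuple s j == i)%:R.
Proof.
under eq_bigr do rewrite /tpow big_tuple /subset_sum.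
rewrite (ryser (fun l k => (tnth j l == tnth i k)%:R : R)).
apply: eq_bigr => s _; case: eqVneq => [<-|ji].
  by rewrite big1// => k _; rewrite tnth_mktuple eqxx.
have [/forallP h|] := boolP [forall k, tnth j (s k) == tnth i k].
  case/eqP: ji; apply: eq_from_tnth => k; rewrite tnth_mktuple; exact/eqP.
by rewrite negb_forall => /existsP[k /negbTE jk]; rewrite (bigD1 k)//= jk mul0r.
Qed.

(** A symmetric [u] is the sum over [j] of [u j] times the symmetrized basis tensor of index [j],
    and [polarization] turns each of these into tensor powers. *)
Lemma fin_tensor_powers n (u : tensor R n) (B : seq (n.-tuple nat)) :
  symmetric_tensor u -> uniq B -> (forall j, j \notin B -> u j = 0) ->
  u = fun i => \sum_(j <- B) \sum_(S : {set 'I_n})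
    u j / n`!%:R * (-1) ^+ (n - #|S|) * tpow (subset_sum j S) n i.
Proof.
move=> su uB hu; apply/funext => i.
transitivity (n`!%:R^-1 * \sum_(s : {perm 'I_n}) u i).
  by rewrite sumr_const card_Sn -[X in _ * X]mulr_natl mulrA mulVf ?mul1r ?fact_neq0.
rewrite mulr_sumr.
under [RHS]eq_bigr => j _ do
  (under eq_bigr do rewrite -mulrA; rewrite -mulr_sumr polarization mulr_sumr).
rewrite [RHS]exchange_big/=; apply: eq_bigr => s _.
have h : \sum_(j <- B) u j / n`!%:R * (permute_tuple s j == i)%:R =
    \sum_(j <- B | j == permute_tuple s^-1 i) u j / n`!%:R.
  rewrite [RHS]big_mkcond; apply: eq_bigr => j _.
  rewrite (_ : (j == _) = (permute_tuple s j == i)).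
    by case: eqP; rewrite ?mulr1 ?mulr0.
  apply/eqP/eqP => [->|<-]; rewrite permute_tupleM ?mulgV ?mulVg permute_tuple1//.
rewrite h mulrC -(su s^-1%g i).
have [iB|iB] := boolP (permute_tuple s^-1 i \in B).
  by rewrite -big_filter filter_pred1_uniq// big_seq1.
rewrite (hu _ iB) mul0r big_seq_cond big1// => j /andP[jB /eqP ji].
by move: iB; rewrite -ji jB.
Qed.

(** By [polarization], pairing a symmetric [f] with a signed sum of tensor powers returns
    [n! * f j]. *)
Lemma tpow_total n (u v : tensor R n) : l2 u -> l2 v ->
  symmetric_tensor u -> symmetric_tensor v ->
  (forall w, l2 w -> tdot u (tpow w n) = tdot v (tpow w n)) -> u = v.
Proof.
move=> lu lv su sv h; apply/funext => j.
have key (f : tensor R n) : l2 f -> symmetric_tensor f ->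
    \sum_(S : {set 'I_n}) (-1) ^+ (n - #|S|) * tdot f (tpow (subset_sum j S) n) =
    n`!%:R * f j.
  move=> lf sf.
  transitivity (tdot f (fun i => \sum_(S : {set 'I_n})
      (-1) ^+ (n - #|S|) * tpow (subset_sum j S) n i)).
    rewrite tdot_sumr// => [|S]; last by apply: l2Z; apply: l2_tpow; exact: l2_subset_sum.
    apply: eq_bigr => S _; rewrite [RHS]tdotC tdotZl//; first by rewrite tdotC.
    by apply: l2_tpow; exact: l2_subset_sum.
  under [X in tdot f X]eq_fun do rewrite polarization.
  rewrite tdot_sumr// => [|s]; last first.
    by apply: (@asum_single _ _ (permute_tuple s j)) => i; rewrite eq_sym => /negPf ->; rewrite expr0n.
  rewrite (eq_bigr (fun=> f j)) => [|s _].
    by rewrite sumr_const card_Sn -[LHS]mulr_natl.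
  rewrite /tdot (@tsum_single _ _ (permute_tuple s j)).
    by rewrite eqxx mulr1 sf.
  by move=> i; rewrite eq_sym => /negPf ->; rewrite mulr0.
have := key _ lu su; under eq_bigr => S _.
  rewrite h; last exact: l2_subset_sum.
  over.
by rewrite key// => /(mulfI (fact_neq0 _)).
Qed.

(* The coefficients of [(t x + y)^{\otimes N}], seen as a polynomial in [t]. *)
Definition mixpoly x y (s : seq nat) : {poly R} :=
  \prod_(b <- s) (x b *: 'X + (y b)%:P).

Definition mixed x y (a N : nat) : tensor R N := fun j => (mixpoly x y j)`_a.
Arguments mixed : clear implicits.

Lemma size_mixpoly x y s : (size (mixpoly x y s) <= (size s).+1)%N.
Proof.
rewrite /mixpoly; elim: s => [|b s IH]; first by rewrite big_nil size_poly1.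
rewrite big_cons; exact: (size_polyM_bound (size_linear _ _) IH).
Qed.

Lemma tpow_mixed x y N (t : R) :
  tpow (fun b => t * x b + y b) N =
  fun j => \sum_(a < N.+1) t ^+ a * mixed x y a N j.
Proof.
apply/funext => j; rewrite /tpow.
have := @horner_coef_wide _ N.+1 (mixpoly x y j) t.
rewrite (leq_trans (size_mixpoly _ _ _)) ?size_tuple// => /(_ isT).
rewrite horner_prod => h; under [RHS]eq_bigr do rewrite mulrC.
by rewrite -h; apply: eq_bigr => b _; rewrite !hornerE mulrC.
Qed.

Lemma mixed_sym x y a N : symmetric_tensor (mixed x y a N).
Proof.
move=> s j; rewrite /mixed /mixpoly; congr (_`_a).
rewrite !big_tuple [X in _ = polyseq X](reindex_inj (@perm_inj _ s)) /=.
by congr polyseq; apply: eq_bigr => i _; rewrite tnth_mktuple.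
Qed.

(** Each coefficient of the product of the [x b *: 'X + y b] is at most the product of the
    [|x b| + |y b|], which is a tensor power of a square summable vector. *)
Lemma l2_mixed x y a N : l2 x -> l2 y -> l2 (mixed x y a N).
Proof.
move=> hx hy; have h := l2_tpow N (l2D (l2_norm hx) (l2_norm hy)).
apply: le_l2 h => j; apply: le_trans (ler_norm _); rewrite /mixed /tpow.
elim: (tval j) a => [|b s IH] a.
  by rewrite /mixpoly !big_nil coef1; case: eqP => _; rewrite ?normr1 ?normr0.
rewrite /mixpoly !big_cons -/(mixpoly x y s) mulrDl coefD -scalerAl coefZ coefXM coefCM.
rewrite mulrDl; apply: le_trans (ler_normD _ _) _; rewrite !normrM lerD// ler_wpM2l//.
case: eqP => _; last exact: IH.
by rewrite normr0 prodr_ge0// => i _; rewrite addr_ge0.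
Qed.

(** Both numbers are the coefficient of [t ^+ a] in the scalar product of [u] with the tensor power
    of [t x + y]. *)
Lemma tdot_mixed n (u : tensor R n) x y (p : {poly R}) : l2 u -> l2 x -> l2 y ->
  (size p <= n.+1)%N ->
  (forall t : R, tdot u (tpow (fun b => t * x b + y b) n) = p.[t]) ->
  forall a, (a <= n)%N -> tdot u (mixed x y a n) = p`_a.
Proof.
move=> hu hx hy sp h a an.
have := @horner_coef_unique _ n.+1 (fun a => tdot u (mixed x y a n)) p sp.
move=> /(_ _ (Ordinal (an : a < n.+1)%N)); apply => t.
rewrite -h tpow_mixed tdot_sumr// => [|b]; last by apply: l2Z; exact: l2_mixed.
apply: eq_bigr => b _; rewrite [RHS]tdotC tdotZl//; first by rewrite tdotC.
exact: l2_mixed.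
Qed.

Lemma sdot_lin x y z (t : R) : l2 x -> l2 y -> l2 z ->
  sdot z (fun b => t * x b + y b) = t * sdot z x + sdot z y.
Proof.
move=> hx hy hz; rewrite /sdot; under eq_tsum do rewrite mulrDr mulrCA.
by have := asum_mul hz hx; have := asum_mul hz hy => h1 h2; rewrite tsumD ?tsumZ//; exact: asumZ.
Qed.

Lemma l2_lin x y (t : R) : l2 x -> l2 y -> l2 (fun b => t * x b + y b).
Proof. by move=> hx hy; apply: l2D => //; exact: l2Z. Qed.

Section contracted_powers.
Variables (p k : nat).
Hypothesis kp : (k <= p)%N.
Let n := (p - k)%N.
Let N := (p + p - k.*2)%N.

Definition cpow x y : tensor R (p + p - k.*2) :=
  tcontract_sym k (tpow x p) (tpow y p).

Lemma l2_cpow x y : l2 x -> l2 y -> l2 (cpow x y).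
Proof. by move=> hx hy; apply: l2_symmetrize; apply: l2_tcontract => //; exact: l2_tpow. Qed.

Lemma tdot_cpow_tpow x y w : l2 x -> l2 y -> l2 w ->
  tdot (cpow x y) (tpow w N) = sdot x y ^+ k * sdot x w ^+ n * sdot y w ^+ n.
Proof.
move=> hx hy hw; rewrite tdot_symmetrizel; last exact: tpow_sym; last exact: l2_tpow.
  rewrite /tdot (tsum_cat (fun s => tcontract_seq k (tpow x p) (tpow y p) s *
    \prod_(b <- s) w b) (tcontract_dim kp kp)).
  under eq_tsum do rewrite tcontract_seq_cat contr_tpow// big_cat/=.
  have h z : l2 z -> asum (fun j => tpow z n j * tpow w n j).
    by move=> hz; apply: asum_mul; exact: l2_tpow.
  rewrite -!(tdot_tpow n)// -mulrA /tdot -(tsumM (h _ hx) (h _ hy)) -tsumZ.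
    by apply: eq_tsum => yz; rewrite /tpow; ring.
  exact: (asumM (h _ hx) (h _ hy)).
by apply: l2_tcontract => //; exact: l2_tpow.
Qed.

(** The coefficient of [t ^+ n] in the tensor power of order [2 * n] of [t x + y] is ['C(2 * n, n)]
    times the symmetrized product of the powers of order [n] of [x] and [y]. Testing against tensor
    powers, which is enough by [tpow_total], replaces a count of permutations. *)
Lemma cpow_mixed x y : l2 x -> l2 y ->
  cpow x y = fun j => sdot x y ^+ k / 'C(N, n)%:R * mixed x y n N j.
Proof.
move=> hx hy; have Nn : N = (n + n)%N by exact: tcontract_dim.
apply: tpow_total.
- exact: l2_cpow.
- by apply: l2Z; exact: l2_mixed.
- exact: symmetrize_sym.
- by move=> s j; rewrite mixed_sym.
move=> w hw; rewrite tdot_cpow_tpow// tdotZl; [|exact: l2_mixed|exact: l2_tpow].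
rewrite tdotC (@tdot_mixed _ _ _ _ (linpow (sdot w x) (sdot w y) N))//.
- rewrite coef_linpow Nn addnK -!mulrA [sdot x w]sdotC [sdot y w]sdotC; congr (_ * _).
  by rewrite mulKf// pnatr_eq0 -lt0n bin_gt0 leq_addr.
- exact: l2_tpow.
- exact: size_linpow.
- move=> t; rewrite tdot_tpow//; last exact: l2_lin.
  by rewrite sdot_lin// horner_linpow.
- by rewrite -/N Nn leq_addr.
Qed.

(** Pairing [cpow x y] with the tensor power of [s z + t] gives [<x,y>^k (s<x,z> + <x,t>)^n (s<y,z>
    + <y,t>)^n], and the coefficient of [s^n] is the sum on the right. The factor [N!] absorbs
    [1 / 'C(N, n)] and leaves [n!^2]. *)
Lemma tdot_cpow x y z (t : nat -> R) : l2 x -> l2 y -> l2 z -> l2 t ->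
  (N`!)%:R * tdot (cpow x y) (cpow z t) = (sdot x y * sdot z t) ^+ k * n`!%:R ^+ 2 *
  \sum_(j < n.+1) 'C(n, j)%:R ^+ 2 * (sdot x z * sdot y t) ^+ j *
     (sdot x t * sdot y z) ^+ (n - j).
Proof.
move=> hx hy hz ht; have Nn : N = (n + n)%N by exact: tcontract_dim.
rewrite (cpow_mixed hz ht) tdotC tdotZl; [|exact: l2_mixed|exact: l2_cpow].
rewrite tdotC (@tdot_mixed _ _ _ _ (sdot x y ^+ k *:
  (linpow (sdot x z) (sdot x t) n * linpow (sdot y z) (sdot y t) n)))//.
- rewrite coefZ coefM !mulr_sumr; apply: eq_bigr => -[j /= jn] _.
  rewrite !coef_linpow subKn// bin_sub//.
  have -> : N`!%:R = 'C(N, n)%:R * (n`!%:R * n`!%:R) :> R.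
    by rewrite -!natrM -(@bin_fact N n) Nn ?leq_addr// addnK.
  have C0 : 'C(N, n)%:R != 0 :> R by rewrite pnatr_eq0 -lt0n bin_gt0 Nn leq_addr.
  by rewrite !exprMn; field.
- exact: l2_cpow.
- apply: leq_trans (size_scale_leq _ _) _; rewrite -/N Nn.
  exact: (size_polyM_bound (size_linpow _ _ _) (size_linpow _ _ _)).
- move=> s; rewrite tdot_cpow_tpow//; last exact: l2_lin.
  by rewrite hornerZ hornerM !horner_linpow !sdot_lin// mulrA.
- by rewrite -/N Nn leq_addr.
Qed.
End contracted_powers.
End polarization.

Section quadrilinear.
Context {R : realType}.

Definition lincomb p (A : Type) (s : seq A) (c : A -> R) (u : A -> tensor R p) :
  tensor R p := fun j => \sum_(a <- s) c a * u a j.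

Lemma l2_lincomb p (A : Type) (s : seq A) (c : A -> R) (u : A -> tensor R p) :
  (forall a, l2 (u a)) -> l2 (lincomb s c u).
Proof. by move=> h; apply: l2_sum => a; exact: l2Z. Qed.

Lemma tdot_lincombl p (A : Type) (s : seq A) (c : A -> R) (u : A -> tensor R p) v :
  (forall a, l2 (u a)) -> l2 v ->
  tdot (lincomb s c u) v = \sum_(a <- s) c a * tdot (u a) v.
Proof.
move=> hu hv; rewrite tdot_suml// => [|a]; last exact: l2Z.
by apply: eq_bigr => a _; rewrite tdotZl.
Qed.

(** Linearity is required on square summable tensors, where the sums that define contractions
    converge absolutely, and directly for finite combinations, the form in which truncated tensors
    come. *)
Definition l2_bilinear p N (B : tensor R p -> tensor R p -> tensor R N) : Prop :=
  [/\ forall u v, l2 u -> l2 v -> l2 (B u v),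
      forall (A : Type) (s : seq A) c u v, (forall a, l2 (u a)) -> l2 v ->
        B (lincomb s c u) v = lincomb s c (fun a => B (u a) v) &
      forall (A : Type) (s : seq A) c u v, l2 u -> (forall a, l2 (v a)) ->
        B u (lincomb s c v) = lincomb s c (fun a => B u (v a))].

Definition quadlinear p
    (Q : tensor R p -> tensor R p -> tensor R p -> tensor R p -> R) : Prop :=
  [/\ forall (A : Type) (s : seq A) c u v w z, (forall a, l2 (u a)) ->
        l2 v -> l2 w -> l2 z ->
        Q (lincomb s c u) v w z = \sum_(a <- s) c a * Q (u a) v w z,
      forall (A : Type) (s : seq A) c u v w z, l2 u -> (forall a, l2 (v a)) ->
        l2 w -> l2 z ->
        Q u (lincomb s c v) w z = \sum_(a <- s) c a * Q u (v a) w z,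
      forall (A : Type) (s : seq A) c u v w z, l2 u -> l2 v ->
        (forall a, l2 (w a)) -> l2 z ->
        Q u v (lincomb s c w) z = \sum_(a <- s) c a * Q u v (w a) z &
      forall (A : Type) (s : seq A) c u v w z, l2 u -> l2 v -> l2 w ->
        (forall a, l2 (z a)) ->
        Q u v w (lincomb s c z) = \sum_(a <- s) c a * Q u v w (z a)].

(** Two quadrilinear forms that agree on tensor powers agree on truncated symmetric tensors: this
    expansion reduces both to the same fourfold sum. *)
Lemma quadlinear_expand p (Q : tensor R p -> tensor R p -> tensor R p -> tensor R p -> R)
    (A1 A2 A3 A4 : Type) (s1 : seq A1) (s2 : seq A2) (s3 : seq A3) (s4 : seq A4)
    c1 c2 c3 c4 u1 u2 u3 u4 : quadlinear Q ->
  (forall a, l2 (u1 a)) -> (forall a, l2 (u2 a)) ->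
  (forall a, l2 (u3 a)) -> (forall a, l2 (u4 a)) ->
  Q (lincomb s1 c1 u1) (lincomb s2 c2 u2) (lincomb s3 c3 u3) (lincomb s4 c4 u4) =
  \sum_(a1 <- s1) c1 a1 * \sum_(a2 <- s2) c2 a2 *
  \sum_(a3 <- s3) c3 a3 * \sum_(a4 <- s4) c4 a4 * Q (u1 a1) (u2 a2) (u3 a3) (u4 a4).
Proof.
move=> [Q1 Q2 Q3 Q4] h1 h2 h3 h4.
have H2 := l2_lincomb s2 c2 h2; have H3 := l2_lincomb s3 c3 h3.
have H4 := l2_lincomb s4 c4 h4.
rewrite Q1//; apply: eq_bigr => a1 _; congr (_ * _).
rewrite Q2//; apply: eq_bigr => a2 _; congr (_ * _).
rewrite Q3//; apply: eq_bigr => a3 _; congr (_ * _).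
by rewrite Q4.
Qed.

Lemma quadlinear_tdot p N (B B' : tensor R p -> tensor R p -> tensor R N) :
  l2_bilinear B -> l2_bilinear B' ->
  quadlinear (fun u v w z => tdot (B u v) (B' w z)).
Proof.
move=> [h Bl Br] [h' Bl' Br']; split => A s c u v w z hu hv hw hz.
- rewrite Bl// tdot_lincombl// => [a|]; [exact: h|exact: h'].
- rewrite Br// tdot_lincombl// => [a|]; [exact: h|exact: h'].
- rewrite tdotC Bl'// tdot_lincombl// => [|a|]; last by exact: h.
    by apply: eq_bigr => a _; rewrite tdotC.
  exact: h'.
- rewrite tdotC Br'// tdot_lincombl// => [|a|]; last by exact: h.
    by apply: eq_bigr => a _; rewrite tdotC.
  exact: h'.
Qed.

Lemma quadlinear_sum p n (k : 'I_n -> R)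
    (Q : 'I_n -> tensor R p -> tensor R p -> tensor R p -> tensor R p -> R) :
  (forall i, quadlinear (Q i)) ->
  quadlinear (fun u v w z => \sum_i k i * Q i u v w z).
Proof.
move=> hQ; split => A s c u v w z hu hv hw hz;
  under [RHS]eq_bigr do rewrite mulr_sumr; rewrite exchange_big/=;
  apply: eq_bigr => i _; have [Q1 Q2 Q3 Q4] := hQ i.
- by rewrite Q1// mulr_sumr; apply: eq_bigr => a _; rewrite mulrCA.
- by rewrite Q2// mulr_sumr; apply: eq_bigr => a _; rewrite mulrCA.
- by rewrite Q3// mulr_sumr; apply: eq_bigr => a _; rewrite mulrCA.
- by rewrite Q4// mulr_sumr; apply: eq_bigr => a _; rewrite mulrCA.
Qed.

Lemma quadlinearZ p (k : R) (Q : tensor R p -> tensor R p -> tensor R p -> tensor R p -> R) :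
  quadlinear Q -> quadlinear (fun u v w z => k * Q u v w z).
Proof.
move=> hQ; have := @quadlinear_sum p 1 (fun=> k) (fun=> Q) (fun=> hQ).
by under eq_fun do under eq_fun do under eq_fun do under eq_fun do rewrite big_ord1.
Qed.

Lemma quadlinear_swap24 p (Q : tensor R p -> tensor R p -> tensor R p -> tensor R p -> R) :
  quadlinear Q -> quadlinear (fun u v w z => Q u z w v).
Proof. by move=> [Q1 Q2 Q3 Q4]; split=> A s c u v w z *; rewrite ?Q1 ?Q2 ?Q3 ?Q4. Qed.

Lemma tcontract_bilinear p k : (k <= p)%N ->
  l2_bilinear (fun u v : tensor R p => tcontract k u v).
Proof.
move=> kp; split.
- by move=> u v; exact: l2_tcontract.
- by move=> A s c u v hu hv; exact: tcontract_suml.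
- by move=> A s c u v hu hv; exact: tcontract_sumr.
Qed.

Lemma tcontract_sym_bilinear p k : (k <= p)%N ->
  l2_bilinear (fun u v : tensor R p => tcontract_sym k u v).
Proof.
move=> kp; split.
- by move=> u v hu hv; apply: l2_symmetrize; exact: l2_tcontract.
- move=> A s c u v hu hv; rewrite /tcontract_sym tcontract_suml//.
  exact: symmetrize_sum.
- move=> A s c u v hu hv; rewrite /tcontract_sym tcontract_sumr//.
  exact: symmetrize_sum.
Qed.

Lemma l2_tcontract_sym p k (u v : tensor R p) : (k <= p)%N -> l2 u -> l2 v ->
  l2 (tcontract_sym k u v).
Proof. by move=> /tcontract_sym_bilinear[h _ _]; exact: h. Qed.

Lemma tdot_tcontract_sym_le p k (u v : tensor R p) : (k <= p)%N -> l2 u -> l2 v ->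
  tdot (tcontract_sym k u v) (tcontract_sym k u v) <= tdot u u * tdot v v.
Proof.
move=> kp hu hv; apply: le_trans (tdot_tcontract_le kp kp hu hv).
by apply: tdot_symmetrize_le; exact: l2_tcontract.
Qed.
End quadrilinear.

(** * Truncated tensors and the scalar product of symmetrized tensor products *)

Section truncation.
Context {R : realType}.

(** Cutting all coordinates at the same level [M] preserves symmetry; the finite support makes
    polarization applicable. *)
Definition trunc n (M : nat) (u : tensor R n) : tensor R n :=
  fun j => if all (ltn^~ M) j then u j else 0.

Lemma trunc_sym n M (u : tensor R n) : symmetric_tensor u ->
  symmetric_tensor (trunc M u).
Proof.
move=> su s j; rewrite /trunc su; congr (if _ then _ else _).
apply/perm_all/tuple_permP; by exists s.
Qed.

Lemma normr_trunc n M (u : tensor R n) j : `|trunc M u j| <= `|u j|.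
Proof. by rewrite /trunc; case: ifP; rewrite ?normr0. Qed.

Lemma l2_trunc n M (u : tensor R n) : l2 u -> l2 (trunc M u).
Proof. by apply: le_l2 => j; exact: normr_trunc. Qed.

Lemma cvg_trunc n (u : tensor R n) j : trunc M u j @[M --> \oo] --> u j.
Proof.
apply: (@cvg_near_cst _ _ _ _ _ _); exists (\max_(a <- j) a).+1 => //= M /= hM.
rewrite /trunc (_ : all _ _ = true)//; apply/allP => a aj.
by apply: leq_trans hM; rewrite ltnS; exact: leq_bigmax_seq.
Qed.

Definition box n (M : nat) : seq (n.-tuple nat) :=
  [seq map_tuple (@nat_of_ord M) t | t <- enum {: n.-tuple 'I_M}].

Lemma box_uniq n M : uniq (box n M).
Proof.
rewrite map_inj_uniq ?enum_uniq// => s t /(congr1 val)/= h.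
by apply: val_inj; move: h; exact/inj_map/val_inj.
Qed.

Lemma mem_box n M (j : n.-tuple nat) : (j \in box n M) = all (ltn^~ M) j.
Proof.
apply/mapP/allP => [[t _ ->] a /mapP[b _ ->]|h]; first exact: ltn_ord.
have hi i : (tnth j i < M)%N by apply: h; exact: mem_tnth.
exists [tuple Ordinal (hi i) | i < n]; first by rewrite mem_enum.
by apply: eq_from_tnth => i; rewrite tnth_map tnth_mktuple.
Qed.

Definition trunc_index n (M : nat) : seq (n.-tuple nat * {set 'I_n}) :=
  [seq (j, B) | j <- box n M, B <- index_enum {set 'I_n}].

Definition trunc_coef n (u : tensor R n) (a : n.-tuple nat * {set 'I_n}) : R :=
  u a.1 / n`!%:R * (-1) ^+ (n - #|a.2|).

Lemma truncE n M (u : tensor R n) : symmetric_tensor u ->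
  trunc M u = lincomb (trunc_index n M) (trunc_coef u)
    (fun a => tpow (subset_sum a.1 a.2) n).
Proof.
move=> su; have := @fin_tensor_powers _ _ (trunc M u) (box n M).
move=> ->; [|exact: trunc_sym|exact: box_uniq|].
  apply/funext => i; rewrite /lincomb big_allpairs_dep /=.
  rewrite big_seq [RHS]big_seq; apply: eq_bigr => j; rewrite mem_box => hj.
  by apply: eq_bigr => S _; rewrite /trunc_coef/= /trunc hj.
by move=> j; rewrite mem_box /trunc => /negbTE ->.
Qed.

Lemma cvg_tdot N (u v : nat -> tensor R N) (u0 v0 b b' : tensor R N) :
  l2 b -> l2 b' -> (forall n j, `|u n j| <= b j) -> (forall n j, `|v n j| <= b' j) ->
  (forall j, u n j @[n --> \oo] --> u0 j) -> (forall j, v n j @[n --> \oo] --> v0 j) ->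
  tdot (u n) (v n) @[n --> \oo] --> tdot u0 v0.
Proof.
move=> hb hb' ub vb cu cv; apply: (tsum_dominated (asum_mul hb hb') _ _).2 => [n j|j].
  by rewrite normrM ler_pM.
exact: cvgM.
Qed.

Section limits.
Variables (p k : nat) (kp : (k <= p)%N).
Implicit Types a b c d : tensor R p.

Let absT a : tensor R p := fun j => `|a j|.

Lemma cvg_tcontract_trunc a b x : l2 a -> l2 b ->
  tcontract k (trunc n a) (trunc n b) x @[n --> \oo] --> tcontract k a b x.
Proof.
move=> /l2_norm ha /l2_norm hb; apply: (cvg_tcontract _ _ ha hb) => //.
- by move=> n j; exact: normr_trunc.
- by move=> n j; exact: normr_trunc.
- by move=> j; exact: cvg_trunc.
- by move=> j; exact: cvg_trunc.
Qed.

(** The dominating tensor is the contraction of [|a|] and [|b|], which is square summable and does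
    not depend on [n]. *)
Lemma normr_tcontract_trunc a b x n : l2 a -> l2 b ->
  `|tcontract k (trunc n a) (trunc n b) x| <= tcontract k (absT a) (absT b) x.
Proof.
move=> /l2_norm ha /l2_norm hb; apply: normr_tcontract => // j; exact: normr_trunc.
Qed.

Lemma cvg_tdot_tcontract a b c d : l2 a -> l2 b -> l2 c -> l2 d ->
  tdot (tcontract k (trunc n a) (trunc n b)) (tcontract k (trunc n c) (trunc n d))
    @[n --> \oo] --> tdot (tcontract k a b) (tcontract k c d).
Proof.
move=> ha hb hc hd; have := @l2_tcontract R p p k _ _ kp kp.
move=> h; apply: (cvg_tdot (h _ _ (l2_norm ha) (l2_norm hb)) (h _ _ (l2_norm hc) (l2_norm hd))).
- by move=> n j; exact: normr_tcontract_trunc.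
- by move=> n j; exact: normr_tcontract_trunc.
- by move=> j; exact: cvg_tcontract_trunc.
- by move=> j; exact: cvg_tcontract_trunc.
Qed.

Lemma cvg_tcontract_sym_trunc a b x : l2 a -> l2 b ->
  tcontract_sym k (trunc n a) (trunc n b) x @[n --> \oo] --> tcontract_sym k a b x.
Proof. by move=> ha hb; apply: cvg_symmetrize => j; exact: cvg_tcontract_trunc. Qed.

Lemma normr_tcontract_sym_trunc a b x n : l2 a -> l2 b ->
  `|tcontract_sym k (trunc n a) (trunc n b) x| <= tcontract_sym k (absT a) (absT b) x.
Proof. by move=> ha hb; apply: normr_symmetrize => j; exact: normr_tcontract_trunc. Qed.

Lemma cvg_tdot_tcontract_sym a b c d : l2 a -> l2 b -> l2 c -> l2 d ->
  tdot (tcontract_sym k (trunc n a) (trunc n b)) (tcontract_sym k (trunc n c) (trunc n d))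
    @[n --> \oo] --> tdot (tcontract_sym k a b) (tcontract_sym k c d).
Proof.
move=> ha hb hc hd; have [h _ _] := @tcontract_sym_bilinear R p k kp.
apply: (cvg_tdot (h _ _ (l2_norm ha) (l2_norm hb)) (h _ _ (l2_norm hc) (l2_norm hd))).
- by move=> n j; exact: normr_tcontract_sym_trunc.
- by move=> n j; exact: normr_tcontract_sym_trunc.
- by move=> j; exact: cvg_tcontract_sym_trunc.
- by move=> j; exact: cvg_tcontract_sym_trunc.
Qed.

Definition antisym (a b c d : tensor R p) : tensor R (p + p - k.*2) :=
  tcontract_sym k a b \- tcontract_sym k c d.

Lemma l2_antisym a b c d : l2 a -> l2 b -> l2 c -> l2 d -> l2 (antisym a b c d).
Proof. by move=> *; apply: l2B; exact: l2_tcontract_sym. Qed.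

Let antisym_trunc n a b c d :=
  antisym (trunc n a) (trunc n b) (trunc n c) (trunc n d).

Let bound a b c d : tensor R (p + p - k.*2) :=
  fun x => tcontract_sym k (absT a) (absT b) x + tcontract_sym k (absT c) (absT d) x.

Let l2_bound a b c d : l2 a -> l2 b -> l2 c -> l2 d -> l2 (bound a b c d).
Proof. by move=> *; apply: l2D; apply: l2_tcontract_sym => //; exact: l2_norm. Qed.

Let antisym_le a b c d n x : l2 a -> l2 b -> l2 c -> l2 d ->
  `|antisym_trunc n a b c d x| <= bound a b c d x.
Proof.
move=> ha hb hc hd; apply: le_trans (ler_normB _ _) _.
by rewrite lerD//; exact: normr_tcontract_sym_trunc.
Qed.

Let cvg_antisym a b c d x : l2 a -> l2 b -> l2 c -> l2 d ->
  antisym_trunc n a b c d x @[n --> \oo] --> antisym a b c d x.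
Proof. by move=> ha hb hc hd; apply: cvgB; exact: cvg_tcontract_sym_trunc. Qed.

Lemma cvg_tdot_antisym a b c d : l2 a -> l2 b -> l2 c -> l2 d ->
  tdot (antisym_trunc n a b c d) (antisym_trunc n a b c d) @[n --> \oo] -->
  tdot (antisym a b c d) (antisym a b c d).
Proof.
move=> ha hb hc hd; have h := l2_bound ha hb hc hd.
by apply: (cvg_tdot h h) => [n j|n j|j|j];
  [exact: antisym_le|exact: antisym_le|exact: cvg_antisym|exact: cvg_antisym].
Qed.

(** This distance is the error term in the L^2 Cauchy estimate for the approximations of the minors
    of the two gradients. *)
Lemma cvg_antisym_dist a b c d : l2 a -> l2 b -> l2 c -> l2 d ->
  tdot (antisym_trunc n a b c d \- antisym a b c d)
       (antisym_trunc n a b c d \- antisym a b c d) @[n --> \oo] --> 0.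
Proof.
move=> ha hb hc hd; have h := l2Z 2 (l2_bound ha hb hc hd).
have le_ n j : `|antisym_trunc n a b c d j - antisym a b c d j| <= 2 * bound a b c d j.
  apply: le_trans (ler_normB _ _) _.
  rewrite [X in _ <= X]mulr_natl [X in _ <= X]mulr2n.
  apply: lerD; first exact: antisym_le.
  have cn : `|antisym_trunc n' a b c d j| @[n' --> \oo] --> `|antisym a b c d j|.
    by apply: cvg_norm; exact: cvg_antisym.
  rewrite -(cvg_lim _ cn)//; apply: limr_le; first by apply/cvg_ex; eexists; exact: cn.
  by apply: nearW => n'; exact: antisym_le.
have cv j : antisym_trunc n a b c d j - antisym a b c d j @[n --> \oo] --> (0 : R).
  by rewrite -(subrr (antisym a b c d j)); apply: cvgB; [exact: cvg_antisym|exact: cvg_cst].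
have -> : 0 = tdot (fun=> 0 : R) (fun _ : (p + p - k.*2).-tuple nat => 0 : R).
  by rewrite /tdot; under eq_tsum do rewrite mul0r; rewrite tsum0.
exact: (cvg_tdot h h).
Qed.
End limits.

(** A permutation that matches the slots of [a] and [b] with those of [c] and [d] joins [r] slots of
    [a] to [d], hence [r] slots of [c] to [b], and [(p! * 'C(p, r)) ^+ 2] permutations do so. The
    proof avoids this count: both sides are compared on tensor powers, then on truncations, then in
    the limit. *)
Lemma sym_tensor_product p (a b c d : tensor R p) :
  l2 a -> l2 b -> l2 c -> l2 d -> symmetric_tensor a -> symmetric_tensor b ->
  symmetric_tensor c -> symmetric_tensor d ->
  (2 * p)`!%:R * tdot (tcontract_sym 0 a b) (tcontract_sym 0 c d) =
  p`!%:R ^+ 2 * \sum_(r < p.+1) 'C(p, r)%:R ^+ 2 *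
    tdot (tcontract r a d) (tcontract r c b).
Proof.
move=> ha hb hc hd sa sb sc sd.
pose x := fun i : p.-tuple nat * {set 'I_p} => subset_sum (R := R) i.1 i.2.
have hx i : l2 (tpow (x i) p) by apply: l2_tpow; exact: l2_subset_sum.
have E n : (2 * p)`!%:R * tdot (tcontract_sym 0 (trunc n a) (trunc n b))
      (tcontract_sym 0 (trunc n c) (trunc n d)) =
    p`!%:R ^+ 2 * \sum_(r < p.+1) 'C(p, r)%:R ^+ 2 *
    tdot (tcontract r (trunc n a) (trunc n d)) (tcontract r (trunc n c) (trunc n b)).
  rewrite !truncE//.
  rewrite (quadlinear_expand (Q := fun u v w z => (2 * p)`!%:R *
    tdot (tcontract_sym 0 u v) (tcontract_sym 0 w z)))//; last first.
    apply: quadlinearZ; apply: quadlinear_tdot; exact: tcontract_sym_bilinear.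
  rewrite (quadlinear_expand (Q := fun u v w z => p`!%:R ^+ 2 *
    \sum_(r < p.+1) 'C(p, r)%:R ^+ 2 * tdot (tcontract r u z) (tcontract r w v)))//; last first.
    apply: quadlinearZ; apply: quadlinear_sum => -[r /= rp].
    apply: (quadlinear_swap24 (Q := fun u v w z => tdot (tcontract r u v) (tcontract r w z))).
    apply: quadlinear_tdot; exact: tcontract_bilinear.
  apply: eq_bigr => a1 _; congr (_ * _); apply: eq_bigr => a2 _; congr (_ * _).
  apply: eq_bigr => a3 _; congr (_ * _); apply: eq_bigr => a4 _; congr (_ * _).
  have -> : (2 * p)`! = (p + p - 0.*2)`! by rewrite subn0 mul2n addnn.
  rewrite (tdot_cpow (leq0n p))//; try exact: l2_subset_sum.
  rewrite expr0 mul1r subn0; congr (_ * _).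
  (* [tdot_cpow] counts the slots of [a] joined to [c]; the reversal counts those joined to [d]. *)
  rewrite (reindex_inj rev_ord_inj)/=; apply: eq_bigr => -[r /= rp] _.
  rewrite subSS bin_sub// tdot_tcontract_tpow//; try exact: l2_subset_sum.
  rewrite (_ : (p - (p - r))%N = r) ?subKn// !exprMn.
  rewrite (sdotC (subset_sum a4.1 a4.2) (subset_sum a2.1 a2.2)).
  rewrite (sdotC (subset_sum a3.1 a3.2) (subset_sum a2.1 a2.2)).
  by ring.
have c1 : (2 * p)`!%:R * tdot (tcontract_sym 0 (trunc n a) (trunc n b))
      (tcontract_sym 0 (trunc n c) (trunc n d)) @[n --> \oo] -->
   (2 * p)`!%:R * tdot (tcontract_sym 0 a b) (tcontract_sym 0 c d).
  by apply: cvgMr; exact: cvg_tdot_tcontract_sym.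
have c2 : p`!%:R ^+ 2 * (\sum_(r < p.+1) 'C(p, r)%:R ^+ 2 *
    tdot (tcontract r (trunc n a) (trunc n d)) (tcontract r (trunc n c) (trunc n b)))
    @[n --> \oo] -->  p`!%:R ^+ 2 * \sum_(r < p.+1) 'C(p, r)%:R ^+ 2 *
    tdot (tcontract r a d) (tcontract r c b).
  apply: cvgMr; apply: cvg_sumr => -[r /= rp]; apply: cvgMr.
  exact: cvg_tdot_tcontract.
move: c1; rewrite (funext E) => c1.
by rewrite -(cvg_lim _ c1)// -(cvg_lim _ c2).
Qed.
End truncation.

(** * The slices of f and g, and the term of index 0 *)

Section slices.
Context {R : realType}.

Lemma symmetric_perm_eq n (u : tensor R n) (s s' : seq nat) : symmetric_tensor u ->
  size s = n -> perm_eq s s' -> u (totuple n s) = u (totuple n s').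
Proof.
move=> su sn ss'; have sn' : size s' = n by rewrite -(perm_size ss').
have /tuple_permP[t ht] : perm_eq (totuple n s) (totuple n s').
  by rewrite !totupleK.
rewrite -[RHS](su t); congr (u _); apply: val_inj; rewrite /= ht.
by [].
Qed.

Lemma cons_tuple_bij n n' : n = n'.+1 ->
  bijective (fun q : nat * n'.-tuple nat => totuple n (q.1 :: q.2)).
Proof.
move=> ->; exists (fun t => (thead t, behead_tuple t)) => [[a t]|t].
  have -> : totuple n'.+1 (a :: t) = cons_tuple a t.
    by apply: val_inj; apply: (totupleK (s := a :: t)); rewrite /= size_tuple.
  by rewrite theadE; congr pair; exact: val_inj.
apply: val_inj; transitivity (thead t :: behead_tuple t : seq nat).
  by apply: totupleK; rewrite /= size_behead size_tuple.
by rewrite [in RHS](tuple_eta t).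
Qed.

Variable p : nat.
Implicit Types f g : tensor R p.+1.

Lemma l2_slices f : l2 f -> l2 (fun q : nat * p.-tuple nat => slice f q.1 q.2).
Proof.
move=> hf; apply: (@l2Z _ _ p.+1%:R (fun q : nat * p.-tuple nat => f (totuple p.+1 (q.1 :: q.2)))).
exact/(asum_reindex (fun j => f j ^+ 2) (cons_tuple_bij (erefl p.+1))).
Qed.

Lemma l2_slice f i : l2 f -> @l2 R (p.-tuple nat) (slice f i).
Proof. by move=> /l2_slices; exact: l2_sectionr. Qed.

Lemma slice_sym f i : symmetric_tensor f -> @symmetric_tensor R p (slice f i).
Proof.
move=> sf s j; rewrite /slice; congr (_ * _).
apply: symmetric_perm_eq => //; first by congr S; exact: size_tuple.
rewrite perm_cons; apply/tuple_permP; by exists s.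
Qed.

Lemma asum_slice_norm f : l2 f -> asum (fun i => tdot (slice f i : tensor R p) (slice f i)).
Proof.
move=> /l2_slices hf; have := asum_tsum hf.
by under eq_fun do under eq_tsum do rewrite expr2.
Qed.

Lemma asum_tcontract_sym_slices f g k : (k <= p)%N -> l2 f -> l2 g ->
  asum (fun il : nat * nat => tdot (tcontract_sym k (slice f il.1 : tensor R p) (slice g il.2))
    (tcontract_sym k (slice f il.1 : tensor R p) (slice g il.2))).
Proof.
move=> kp hf hg; apply: le_asum (asumM (asum_slice_norm hf) (asum_slice_norm hg)) => -[i l] /=.
rewrite ger0_norm ?tdot_ge0//; apply: tdot_tcontract_sym_le => //; exact: l2_slice.
Qed.

Lemma tdot_subE N (u v : tensor R N) : l2 u -> l2 v ->
  tdot (u \- v) (u \- v) = tdot u u - 2 * tdot u v + tdot v v.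
Proof.
move=> hu hv; have huv := asum_mul hu hv; have huu := asum_mul hu hu.
have hvv := asum_mul hv hv.
rewrite /tdot -tsumZ// -tsumB//; last exact: asumZ.
rewrite -tsumD//; last by apply: asumB => //; exact: asumZ.
by apply: eq_tsum => j /=; ring.
Qed.

Lemma tdot_sub_le N (u v : tensor R N) : l2 u -> l2 v ->
  tdot (u \- v) (u \- v) <= 2 * (tdot u u + tdot v v).
Proof.
move=> hu hv; rewrite tdot_subE//.
have : 0 <= tdot (u \+ v) (u \+ v) by exact: tdot_ge0.
have -> : tdot (u \+ v) (u \+ v) = tdot u u + 2 * tdot u v + tdot v v.
  have := tdot_subE hu (l2Z (-1) hv).
  rewrite (_ : u \- (fun j => -1 * v j) = u \+ v); last first.
    by apply/funext => j /=; rewrite mulN1r opprK.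
  have e1 : tdot u (fun j => -1 * v j) = - tdot u v.
    by rewrite tdotC (tdotZl (-1) hv hu) tdotC mulN1r.
  have e2 : tdot (fun j => -1 * v j) (fun j => -1 * v j) = tdot v v.
    by rewrite (tdotZl (-1) hv (l2Z (-1) hv)) tdotC (tdotZl (-1) hv hv); ring.
  by move=> ->; rewrite e1 e2; ring.
by lra.
Qed.

Definition slice_antisym f g k (il : nat * nat) : tensor R (p + p - k.*2) :=
  antisym (k := k) (slice f il.1) (slice g il.2) (slice f il.2) (slice g il.1).

Arguments slice_antisym : clear implicits.

Lemma asum_slice_antisym f g k : (k <= p)%N -> l2 f -> l2 g ->
  asum (fun il => tdot (slice_antisym f g k il) (slice_antisym f g k il)).
Proof.
move=> kp hf hg; have h := asum_tcontract_sym_slices kp hf hg.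
have h' := (asum_reindex _ (@swap_bij _ _)).2 h.
apply: le_asum (asumZ 2 (asumD h h')) => -[i l] /=.
have [l1 l2' l3 l4] : [/\ l2 (slice f i : tensor R p), l2 (slice g l : tensor R p),
   l2 (slice f l : tensor R p) & l2 (slice g i : tensor R p)] by split; exact: l2_slice.
rewrite ger0_norm ?tdot_ge0// /slice_antisym/antisym.
set u := tcontract_sym k _ _; set v := tcontract_sym k _ _.
have hu : l2 u by exact: l2_tcontract_sym. have hv : l2 v by exact: l2_tcontract_sym.
exact: tdot_sub_le.
Qed.

Lemma contr_slices f g r i l (yz : (p - r).-tuple nat * (p - r).-tuple nat) :
  (r <= p)%N -> l2 f -> l2 g -> contr r (slice f i : tensor R p) (slice g l) yz =
  p.+1%:R ^+ 2 * tsum (fun I : r.-tuple nat =>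
    f (totuple p.+1 (i :: I ++ yz.1)) * g (totuple p.+1 (l :: I ++ yz.2))).
Proof.
move=> rp hf hg.
have h := asum_contract yz.1 yz.2 (l2_unfold rp (l2_slice i hf)) (l2_unfold rp (l2_slice l hg)).
have sz (I : r.-tuple nat) (y : (p - r).-tuple nat) :
    totuple p (I ++ y) = I ++ y :> seq nat.
  by apply: totupleK; rewrite size_cat !size_tuple subnKC.
have p0 : p.+1%:R != 0 :> R by rewrite pnatr_eq0.
have E (I : r.-tuple nat) : unfold (slice f i : tensor R p) (I, yz.1) *
    unfold (slice g l : tensor R p) (I, yz.2) = p.+1%:R ^+ 2 *
    (f (totuple p.+1 (i :: I ++ yz.1)) * g (totuple p.+1 (l :: I ++ yz.2))).
  by rewrite /unfold /slice !sz; ring.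
rewrite -tsumZ; first by apply: eq_tsum => I; exact: E.
have := asumZ (p.+1%:R ^- 2) h; congr asum; apply/funext => I.
by rewrite E mulKf// expf_neq0.
Qed.

(** [i] and [l] become one more free coordinate in each block. The factor [p.+1 ^+ 4] comes from the
    factor [m] in each of the four slices. *)
Lemma tsum_tcontract_slices f g r : (r <= p)%N -> l2 f -> l2 g ->
  symmetric_tensor f -> symmetric_tensor g ->
  asum (fun il : nat * nat => tdot (tcontract r (slice f il.1 : tensor R p) (slice g il.2))
    (tcontract r (slice f il.1 : tensor R p) (slice g il.2))) /\
  tsum (fun il : nat * nat => tdot (tcontract r (slice f il.1 : tensor R p) (slice g il.2))
    (tcontract r (slice f il.1 : tensor R p) (slice g il.2))) =
  p.+1%:R ^+ 4 * tdot (tcontract r f g) (tcontract r f g).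
Proof.
move=> rp hf hg sf sg.
have E : (p.+1 - r = (p - r).+1)%N by rewrite subSn.
have [ki h1 h2] := cons_tuple_bij E.
pose ka (q : nat * (p - r).-tuple nat) : (p.+1 - r).-tuple nat :=
  totuple (p.+1 - r) (q.1 :: q.2).
pose beta (q : (nat * nat) * ((p - r).-tuple nat * (p - r).-tuple nat)) :=
  (ka (q.1.1, q.2.1), ka (q.1.2, q.2.2)).
have bb : bijective beta.
  exists (fun yz => (((ki yz.1).1, (ki yz.2).1), ((ki yz.1).2, (ki yz.2).2))).
    by move=> [[i l] [y z]]; rewrite /beta /ka/= (h1 (i, y)) (h1 (l, z)).
  move=> [y z]; rewrite /beta /ka/=; congr pair.
    by rewrite -[RHS]h2; case: (ki y).
  by rewrite -[RHS]h2; case: (ki z).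
pose G yz := p.+1%:R ^+ 4 * (contr r f g yz * contr r f g yz).
have rp1 : (r <= p.+1)%N by exact: leqW.
have aG : asum G.
  by apply: asumZ; apply: asum_mul; exact: l2_contr.
have aGb := (asum_reindex G bb).2 aG.
have EG il yz : contr r (slice f il.1 : tensor R p) (slice g il.2) yz *
    contr r (slice f il.1 : tensor R p) (slice g il.2) yz = (G \o beta) (il, yz).
  rewrite contr_slices//.
  pose h i (y : (p - r).-tuple nat) (I : r.-tuple nat) := totuple p.+1 (i :: I ++ y).
  (* By symmetry of [u], the free index [i] may be moved past the contracted block [I]. *)
  have sz (u : tensor R p.+1) (y : (p - r).-tuple nat) i (I : r.-tuple nat) :
      symmetric_tensor u -> unfold u (I, ka (i, y)) = u (h i y I).
    move=> su; rewrite /unfold.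
    have -> : (I, ka (i, y)).2 = i :: y :> seq nat.
      by apply: totupleK; rewrite /= size_tuple E.
    apply: symmetric_perm_eq => //; first by rewrite size_cat/= !size_tuple addnS subnKC.
    by rewrite -cat1s perm_catCA.
  have -> : (G \o beta) (il, yz) = p.+1%:R ^+ 4 * (tsum (fun I : r.-tuple nat =>
      f (h il.1 yz.1 I) * g (h il.2 yz.2 I)) ^+ 2).
    rewrite expr2 /G /beta/= /contr; congr (_ * (_ * _)); apply: eq_tsum => I;
    by rewrite !sz.
  by rewrite /h; ring.
have ET il : tdot (tcontract r (slice f il.1 : tensor R p) (slice g il.2))
    (tcontract r (slice f il.1 : tensor R p) (slice g il.2)) =
    tsum (fun yz => (G \o beta) (il, yz)).
  by rewrite tdot_tcontract//; apply: eq_tsum => yz; exact: EG.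
split.
  by under eq_fun do rewrite ET; exact: (asum_tsum aGb).
under eq_tsum do rewrite ET.
by rewrite -(tsum_pair aGb) tsum_reindex// tdot_tcontract// -tsumZ//; apply: asum_mul; exact: l2_contr.
Qed.

(** With equal slice indices, [i] is one more contracted coordinate, so the order rises from [r] to
    [r.+1]. *)
Lemma tsum_contr_slices f g r (yz : (p - r).-tuple nat * (p - r).-tuple nat) :
  (r <= p)%N -> l2 f -> l2 g ->
  asum (fun i => contr r (slice f i : tensor R p) (slice g i) yz) /\
  tsum (fun i => contr r (slice f i : tensor R p) (slice g i) yz) =
  p.+1%:R ^+ 2 * @contr _ p.+1 p.+1 r.+1 f g yz.
Proof.
move=> rp hf hg; have cb := cons_tuple_bij (erefl r.+1).
pose G (I : r.+1.-tuple nat) := f (totuple p.+1 (I ++ yz.1)) * g (totuple p.+1 (I ++ yz.2)).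
have aG : asum G.
  exact: (asum_contract yz.1 yz.2 (@l2_unfold _ p.+1 r.+1 f rp hf)
    (@l2_unfold _ p.+1 r.+1 g rp hg)).
pose ka (q : nat * r.-tuple nat) := totuple r.+1 (q.1 :: q.2).
have aGb : asum (G \o ka) := (asum_reindex G cb).2 aG.
have E i : contr r (slice f i : tensor R p) (slice g i) yz =
    p.+1%:R ^+ 2 * tsum (fun I => (G \o ka) (i, I)).
  rewrite contr_slices//; congr (_ * _); apply: eq_tsum => I.
  have sz : ka (i, I) = i :: I :> seq nat.
    by apply: totupleK; rewrite /= size_tuple.
  by rewrite /G /comp sz.
under eq_fun do rewrite E.
split; first by apply: asumZ; exact: (asum_tsum aGb).
rewrite tsumZ; last exact: (asum_tsum aGb).
by rewrite -(tsum_pair aGb) tsum_reindex.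
Qed.

(** For fixed [j] the double sum over [I * I] factors into a square, which reduces summability to a
    bound on that square. *)
Lemma asum_sqr_abs (I J : choiceType) (a : I -> J -> R) (b : J -> R) : asum b ->
  (forall j, asum (a^~ j)) -> (forall j, tsum (fun i => `|a i j|) ^+ 2 <= b j) ->
  asum (fun q : (I * I) * J => a q.1.1 q.2 * a q.1.2 q.2).
Proof.
move=> hb ha le_.
apply/(asum_reindex _ (swap_bij J (I * I)%type))/asum_pair => [j|]/=.
  exact: (asumM (ha j) (ha j)).
apply: le_asum hb => j; rewrite ger0_norm ?tsum_ge0//.
apply: le_trans (le_ j); rewrite expr2 -(tsumM (asum_norm (ha j)) (asum_norm (ha j))).
by under eq_tsum do rewrite normrM.
Qed.

(** Summing over both slice indices inside the scalar product contracts one more coordinate in each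
    factor. The exchange of sums needs absolute convergence, which comes from the contraction of
    order [r.+1] of [|f|] and [|g|]. *)
Lemma tsum_tcontract_diag f g r : (r <= p)%N -> l2 f -> l2 g ->
  asum (fun il : nat * nat => tdot (tcontract r (slice f il.1 : tensor R p) (slice g il.1))
    (tcontract r (slice f il.2 : tensor R p) (slice g il.2))) /\
  tsum (fun il : nat * nat => tdot (tcontract r (slice f il.1 : tensor R p) (slice g il.1))
    (tcontract r (slice f il.2 : tensor R p) (slice g il.2))) =
  p.+1%:R ^+ 4 * tdot (@tcontract _ p.+1 p.+1 r.+1 f g) (tcontract r.+1 f g).
Proof.
move=> rp hf hg.
pose a i yz := contr r (slice f i : tensor R p) (slice g i) yz.
pose fa : tensor R p.+1 := fun j => `|f j|; pose ga : tensor R p.+1 := fun j => `|g j|.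
have hfa : l2 fa by exact: l2_norm. have hga : l2 ga by exact: l2_norm.
pose b yz := (p.+1%:R ^+ 2 * @contr _ p.+1 p.+1 r.+1 fa ga yz) ^+ 2.
have hb : asum b by apply: l2Z; exact: l2_contr.
have haA : asum (fun q : (nat * nat) * _ => a q.1.1 q.2 * a q.1.2 q.2).
  apply: (asum_sqr_abs hb) => yz; first exact: (tsum_contr_slices yz rp hf hg).1.
  rewrite /b -(tsum_contr_slices yz rp hfa hga).2.
  rewrite lerXn2r// ?nnegrE ?tsum_ge0// => [i|].
    apply: tsum_ge0 => I; rewrite /unfold /slice /fa /ga.
    by rewrite !mulr_ge0 ?ler0n ?normr_ge0.
  apply: ler_tsum => [||i].
  - by apply: asum_norm; exact: (tsum_contr_slices yz rp hf hg).1.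
  - exact: (tsum_contr_slices yz rp hfa hga).1.
  have h := asum_contract yz.1 yz.2 (l2_unfold rp (l2_slice i hf)) (l2_unfold rp (l2_slice i hg)).
  apply: le_trans (ler_norm_tsum h) _.
  suff -> : tsum (fun I : r.-tuple nat => `|unfold (slice f i : tensor R p) (I, yz.1) *
    unfold (slice g i : tensor R p) (I, yz.2)|) = contr r (slice fa i : tensor R p) (slice ga i) yz by [].
  by apply: eq_tsum => I; rewrite /unfold /slice /fa /ga !normrM normr_nat.
have E il : tdot (tcontract r (slice f il.1 : tensor R p) (slice g il.1))
    (tcontract r (slice f il.2 : tensor R p) (slice g il.2)) =
    tsum (fun yz => a il.1 yz * a il.2 yz) by rewrite tdot_tcontract.
split; first by under eq_fun do rewrite E; exact: (asum_tsum haA).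
under eq_tsum do rewrite E.
rewrite -(tsum_pair haA) -(tsum_reindex _ (swap_bij _ _)) tsum_pair; last first.
  exact/(asum_reindex _ (swap_bij _ _)).
rewrite tdot_tcontract// -tsumZ; last by apply: asum_mul; exact: l2_contr.
apply: eq_tsum => yz /=; have [h1 h2] := tsum_contr_slices yz rp hf hg.
by rewrite (tsumM h1 h1) /a h2; ring.
Qed.

(** When the square is expanded, [sym_tensor_product] gives the terms [X] (free slice indices) for
    the two squared norms and [Y] (contracted ones) for the cross term. The constants combine as
    [p! ^+ 2 * p.+1 ^+ 4 = (m * m!) ^+ 2]. *)
Lemma Tterm0_sum f g : l2 f -> l2 g -> symmetric_tensor f -> symmetric_tensor g ->
  Tterm f g 0 = (p.+1%:R * p.+1`!%:R) ^+ 2 * \sum_(r < p.+1) 'C(p, r)%:R ^+ 2 *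
    (tdot (tcontract r f g) (tcontract r f g) -
     tdot (tcontract r.+1 f g) (tcontract r.+1 f g)).
Proof.
move=> hf hg sf sg.
pose X r (il : nat * nat) := tdot (tcontract r (slice f il.1 : tensor R p) (slice g il.2))
    (tcontract r (slice f il.1 : tensor R p) (slice g il.2)).
pose Y r (il : nat * nat) := tdot (tcontract r (slice f il.1 : tensor R p) (slice g il.1))
    (tcontract r (slice f il.2 : tensor R p) (slice g il.2)).
have hX (r : 'I_p.+1) := tsum_tcontract_slices (ltn_ord r) hf hg sf sg.
have hY (r : 'I_p.+1) := tsum_tcontract_diag (ltn_ord r) hf hg.
have bs := @swap_bij nat nat.
have hX' (r : 'I_p.+1) : asum (X r \o (fun q => (q.2, q.1))) /\
    tsum (X r \o (fun q => (q.2, q.1))) = tsum (X r).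
  split; first exact/(asum_reindex _ bs)/(hX r).1.
  exact: tsum_reindex.
have E il : (2 * p)`!%:R * tdot (slice_antisym f g 0 il) (slice_antisym f g 0 il) =
  p`!%:R ^+ 2 * \sum_(r < p.+1) 'C(p, r)%:R ^+ 2 *
    (X r il - 2 * Y r il + X r (il.2, il.1)).
  have [l1 l2' l3 l4] : [/\ l2 (slice f il.1 : tensor R p), l2 (slice g il.2 : tensor R p),
    l2 (slice f il.2 : tensor R p) & l2 (slice g il.1 : tensor R p)].
    by split; exact: l2_slice.
  have [s1 s2 s3 s4] : [/\ symmetric_tensor (slice f il.1 : tensor R p),
    symmetric_tensor (slice g il.2 : tensor R p),
    symmetric_tensor (slice f il.2 : tensor R p) &
    symmetric_tensor (slice g il.1 : tensor R p)] by split; exact: slice_sym.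
  rewrite /slice_antisym /antisym tdot_subE; try exact: l2_tcontract_sym.
  rewrite mulrDr mulrBr [_ * (2 * _)]mulrCA !sym_tensor_product//.
  rewrite [2 * (_ * _)]mulrCA -mulrBr -mulrDr; congr (_ * _).
  rewrite mulr_sumr -sumrB -big_split/=; apply: eq_bigr => r _.
  by rewrite /X /Y/=; ring.
rewrite /Tterm.
transitivity (2^-1 * tsum (fun il => p`!%:R ^+ 2 * \sum_(r < p.+1) 'C(p, r)%:R ^+ 2 *
    (X r il - 2 * Y r il + X r (il.2, il.1)))).
  congr (_ * _); apply: eq_tsum => il; rewrite -E tnorm_sqr.
  have -> : (2 * p.+1 - 2 - 2 * 0)%N = (2 * p)%N by lia.
  by rewrite bin0 fact0 !expr1n !mul1r.
have hr (r : 'I_p.+1) : asum (fun il => 'C(p, r)%:R ^+ 2 *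
    (X r il - 2 * Y r il + X r (il.2, il.1))).
  apply: asumZ; apply: asumD; last exact: (hX' r).1.
  by apply: asumB; [exact: (hX r).1|apply: asumZ; exact: (hY r).1].
rewrite tsumZ; last exact: asum_sum.
rewrite tsum_sum// !mulr_sumr; apply: eq_bigr => r _.
have h1 : asum (fun il => X r il - 2 * Y r il).
  by apply: asumB; [exact: (hX r).1|apply: asumZ; exact: (hY r).1].
rewrite tsumZ; last by apply: asumD => //; exact: (hX' r).1.
rewrite tsumD//; last exact: (hX' r).1.
rewrite tsumB; [|exact: (hX r).1|by apply: asumZ; exact: (hY r).1].
rewrite tsumZ; last exact: (hY r).1.
rewrite (hX' r).2 (hX r).2 (hY r).2 factS natrM; by field.
Qed.
End slices.
Arguments slice_antisym {R p} f g k il.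

(** * Contractions of order 0 and of full order, and rearrangement of the binomial sum *)

Section extreme_contractions.
Context {R : realType}.
Implicit Types p : nat.

(** Together with [tdot_tcontractn], this turns the two boundary terms of the summation by parts
    into the Gram determinant of [f] and [g]. *)
Lemma tdot_tcontract0 p (f g : tensor R p) : l2 f -> l2 g ->
  tdot (tcontract 0 f g) (tcontract 0 f g) = tdot f f * tdot g g.
Proof.
move=> hf hg; rewrite tdot_tcontract//.
have E (y z : (p - 0).-tuple nat) : contr 0 f g (y, z) = f (totuple p y) * g (totuple p z).
  by rewrite /contr (@tsum_single _ _ [tuple])// => i; rewrite tuple0 eqxx.
have h (u : tensor R p) : l2 u -> asum (fun y : (p - 0).-tuple nat =>
      u (totuple p y) * u (totuple p y)) /\
    tsum (fun y : (p - 0).-tuple nat => u (totuple p y) * u (totuple p y)) = tdot u u.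
  move=> hu; have E0 : (p - 0)%N = p by rewrite subn0.
  rewrite E0; under eq_fun do rewrite totuple_tuple.
  by split => //; exact: asum_mul.
have [[h1 <-] [h2 <-]] := (h f hf, h g hg).
by rewrite -(tsumM h1 h2); apply: eq_tsum => -[y z]; rewrite E/=; ring.
Qed.

Lemma tsum_tuple0 n (F : n.-tuple nat * n.-tuple nat -> R) : n = 0%N ->
  tsum F = F (totuple n [::], totuple n [::]).
Proof.
by move=> n0; subst n; apply: tsum_single => -[y z] /negP[]; apply/eqP;
  congr pair; exact: (etrans (tuple0 _) (esym (tuple0 _))).
Qed.

Lemma tdot_tcontractn p (f g : tensor R p) :
  tdot (tcontract p f g) (tcontract p f g) = tdot f g ^+ 2.
Proof.
rewrite tdot_tcontract// tsum_tuple0 ?subnn// expr2.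
suff -> : contr p f g (totuple (p - p) [::], totuple (p - p) [::]) = tdot f g by [].
apply: eq_tsum => i; rewrite /unfold/=.
have -> : totuple (p - p) [::] = [::] :> seq nat by apply: totupleK; rewrite subnn.
by rewrite cats0 totuple_tuple.
Qed.
End extreme_contractions.

Section binomial_rearrangement.
Context {R : realType}.

(** The index [r] is paired with [p.+1 - r]. When [p] is odd, [p./2.+1] is its own partner, hence
    the condition that [F] vanishes there. *)
Lemma sum_nat_fold (F : nat -> R) p : (forall r, (0 < r <= p)%N -> F (p.+1 - r)%N = F r) ->
  (forall r, (r.*2 = p.+1)%N -> F r = 0) ->
  \sum_(1 <= r < p.+1) F r = 2 * \sum_(1 <= r < p./2.+1) F r.
Proof.
move=> sF F0.
have [hp E] : (p./2 <= p)%N /\ (p - p./2 = p./2 + odd p)%N.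
  by have := odd_double_half p; lia.
rewrite (big_cat_nat (n := p./2.+1))//=.
have -> : \sum_(p./2.+1 <= r < p.+1) F r = \sum_(1 <= r < (p - p./2).+1) F r.
  rewrite big_nat_rev/= -[in LHS](add1n p./2) big_addn subSn//.
  rewrite big_nat [RHS]big_nat; apply: eq_bigr => r hr.
  by rewrite -[RHS]sF; [congr F; lia|lia].
rewrite E; case: (boolP (odd p)) => po; last by rewrite addn0 mulr_natl mulr2n.
rewrite addn1 [X in _ + X]big_nat_recr//= [F p./2.+1]F0; last first.
  by have := odd_double_half p; rewrite po; lia.
by rewrite addr0 mulr_natl mulr2n.
Qed.

(** After summation by parts the weights [D r] change sign under [r -> p.+1 - r], because
    ['C(p, p.+1 - r) = 'C(p, r.-1)]. This antisymmetry folds the sum in half and produces the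
    differences [A r - A (p.+1 - r)]. *)
Lemma sum_binomial_telescope (A : nat -> R) p :
  \sum_(r < p.+1) 'C(p, r)%:R ^+ 2 * (A r - A r.+1) =
  A 0%N - A p.+1 + \sum_(1 <= r < p./2.+1)
    ('C(p, r)%:R ^+ 2 - 'C(p, r.-1)%:R ^+ 2) * (A r - A (p.+1 - r)%N).
Proof.
pose D r : R := 'C(p, r)%:R ^+ 2 - 'C(p, r.-1)%:R ^+ 2.
have sD r : (0 < r <= p)%N -> D (p.+1 - r)%N = - D r.
  move=> /andP[r0 rp]; rewrite /D opprB; congr (_ ^+ 2 - _ ^+ 2).
    by rewrite -[in RHS]bin_sub; [congr (_%:R); congr ('C(_, _)); lia|lia].
  by rewrite -[in RHS]bin_sub; [congr (_%:R); congr ('C(_, _)); lia|lia].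
transitivity (A 0%N - A p.+1 + \sum_(1 <= r < p.+1) D r * A r).
  rewrite -(big_mkord xpredT (fun r => 'C(p, r)%:R ^+ 2 * (A r - A r.+1))).
  under eq_bigr do rewrite mulrBr.
  rewrite sumrB big_nat_recl//= [X in _ - X]big_nat_recr//= bin0 binn !expr1n !mul1r.
  under [in RHS]eq_bigr do rewrite /D mulrBl.
  rewrite sumrB; rewrite !big_add1/=; ring.
congr (_ + _); apply: (@mulfI _ 2); first by rewrite pnatr_eq0.
rewrite -(@sum_nat_fold (fun r => D r * (A r - A (p.+1 - r)%N))).
- transitivity (\sum_(1 <= r < p.+1) D r * A r +
    \sum_(1 <= r < p.+1) D (p.+1 - r)%N * A (p.+1 - r)%N).
    rewrite mulr_natl mulr2n; congr (_ + _); rewrite big_nat_rev/=.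
    by apply: eq_bigr => r _; rewrite add1n subSS.
  rewrite -big_split/= big_nat [RHS]big_nat; apply: eq_bigr => r hr.
  by rewrite sD; [ring|lia].
- move=> r hr; rewrite sD//; have -> : (p.+1 - (p.+1 - r) = r)%N by lia.
  by ring.
- move=> r hr; have -> : (p.+1 - r = r)%N by lia.
  by rewrite subrr mulr0.
Qed.
End binomial_rearrangement.

(** * Gaussian moments and integration by parts *)

Section normal_moments.
Context {R : realType}.
Variable s : R.
Hypothesis s0 : s != 0.
Local Notation mu := (@lebesgue_measure R).
Local Notation phi := (normal_pdf 0 s).

(** The Radon-Nikodym derivative of the normal law agrees almost everywhere with its density, since
    both have the same integral on every measurable set. *)
Lemma ge0_integral_normal_prob (f : R -> \bar R) : measurable_fun [set: R] f ->
  (forall x, 0 <= f x)%E ->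
  (\int[normal_prob 0 s]_x f x = \int[mu]_x (f x * (phi x)%:E))%E.
Proof.
move=> mf f0; have dom := normal_prob_dominates 0 s.
rewrite -(Radon_Nikodym_SigmaFinite.change_of_variables dom f0)//.
have iRN := Radon_Nikodym_SigmaFinite.f_integrable dom.
apply: ae_eq_integral => //.
- by apply: emeasurable_funM => //; exact: (measurable_int mu).
- apply: emeasurable_funM => //; apply/measurable_EFinP; exact: measurable_normal_pdf.
- apply: ae_eqe_mul2l; apply: integral_ae_eq => //.
  + by apply/measurable_EFinP; exact: measurable_normal_pdf.
  + by move=> E _ mE; rewrite -Radon_Nikodym_SigmaFinite.f_integral.
Qed.

(** An exponential tilt of a Gaussian density is a multiple of a shifted one. With [m = 1] and
    [m = -1], it bounds [|x| ^+ n * phi x] by a multiple of a sum of two densities. *)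
Lemma normal_pdf_tilt m x : expR (m * x) * phi x =
  expR (m ^+ 2 * s ^+ 2 / 2) * normal_pdf (m * s ^+ 2) s x.
Proof.
rewrite !normal_pdfE// /normal_fun mulrCA [RHS]mulrCA; congr (_ * _).
rewrite -!expRD; congr expR; rewrite -mulr_natl; field.
by [].
Qed.

Lemma normr_exp_le n (x : R) : `|x| ^+ n <= n`!%:R * (expR x + expR (- x)).
Proof.
have f0 : 0 < n`!%:R :> R by rewrite ltr0n fact_gt0.
apply: (@le_trans _ _ (n`!%:R * expR `|x|)).
  rewrite -ler_pdivrMl// mulrC; case: n f0 => [|n] f0.
    by rewrite expr0 fact0 invr1 mulr1 -[leLHS]expR0 ler_expR.
  by apply: le_trans (expR_ge1Dxn n (normr_ge0 x)); rewrite lerDr.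
rewrite ler_pM2l//; case: (ger0P x) => _; first by rewrite lerDl expR_ge0.
by rewrite lerDr expR_ge0.
Qed.

Lemma integrable_normal_moment n :
  mu.-integrable setT (fun x => (x ^+ n * phi x)%:E).
Proof.
have mphi : measurable_fun [set: R] phi by exact: measurable_normal_pdf.
have mx : measurable_fun [set: R] (fun x : R => x ^+ n * phi x).
  by apply: measurable_funM => //; exact: measurable_funX.
pose C := n`!%:R * expR (s ^+ 2 / 2).
pose g x := C * (normal_pdf (s ^+ 2) s x + normal_pdf (- s ^+ 2) s x).
have ig : mu.-integrable setT (fun x => (g x)%:E).
  rewrite /g; under eq_fun do rewrite EFinM EFinD.
  apply: integrableZl => //; apply: integrableD => //; exact: integrable_normal_pdf.
apply: (le_integrable measurableT _ _ ig) => /=; first exact/measurable_EFinP.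
move=> x _; rewrite lee_fin normrM normrX (ger0_norm (normal_pdf_ge0 _ _ _)).
apply: le_trans (ler_norm _); rewrite /g /C.
apply: le_trans (ler_wpM2r (normal_pdf_ge0 _ _ _) (normr_exp_le n x)) _.
rewrite -(mulrA _ (expR (s ^+ 2 / 2))) -mulrA ler_wpM2l// mulrDl.
have := normal_pdf_tilt 1 x; have := normal_pdf_tilt (-1) x.
rewrite !mul1r !mulN1r sqrrN !expr1n !mul1r => -> ->.
by rewrite mulrDr.
Qed.

Let c := (s ^+ 2 *+ 2)^-1.
Let E (x : R) := expR (- x ^+ 2 * c).

Let phiE x : phi x = normal_peak s * E x.
Proof. by rewrite normal_pdfE// /normal_fun subr0. Qed.

Let c0 : 0 < c.
Proof. by rewrite invr_gt0 pmulrn_lgt0// exprn_even_gt0. Qed.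

(** [g k] will be the derivative of [G k]. That its integral vanishes is the moment recursion; at
    [k = 0] the factor [k%:R] kills the term with the truncated predecessor. *)
Let G k (x : R) := x ^+ k * phi x.
Let g k (x : R) := k%:R * (x ^+ k.-1 * phi x) - s ^- 2 * (x ^+ k.+1 * phi x).

Let is_derive_G k (x : R) : is_derive x (1 : R) (G k : R -> R) (g k x).
Proof.
have -> : G k = fun x => normal_peak s * (x ^+ k * E x).
  by apply/funext => y; rewrite /G phiE; ring.
have dE : is_derive x (1 : R) E (E x * (- (2 * x) * c)).
  have h : is_derive x (1 : R) (fun x : R => - x ^+ 2 * c) (- (2 * x) * c).
    apply: is_derive_eq; rewrite /GRing.scale/=; ring.
  exact: (is_derive1_comp (is_derive_expR _) h).
have -> : (fun x => normal_peak s * (x ^+ k * E x)) =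
    normal_peak s \*: ((@id R) ^+ k * E).
  by apply/funext => y; rewrite !fctE.
have d2 := is_deriveM (is_deriveX k (is_derive_id x 1)) dE.
apply: (is_derive_eq (is_deriveZ (normal_peak s) d2)).
have -> : ((@id R) ^+ k) x = x ^+ k by rewrite exprfctE.
rewrite /g !phiE /GRing.scale/= /c [x ^+ k.+1]exprS -[s ^+ 2 *+ 2]mulr_natl.
move: (x ^+ k) (x ^+ k.-1) (E x) (normal_peak s) => a b q r. field.
by rewrite s0.
Qed.

(** The term of degree [k.+2] of the exponential series bounds [E x] by a multiple of
    [|x| ^- (2 * k + 4)], more than enough decay when [|x| >= 1]. *)
Let G_le k : exists A : R, forall x : R, 1 <= `|x| -> `|G k x| <= A / `|x|.
Proof.
pose A := normal_peak s * ((k.+2)`!%:R / c ^+ k.+2); exists A => x x1.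
have x0 : 0 < `|x| by exact: lt_le_trans x1.
have u0 : 0 <= x ^+ 2 * c by rewrite mulr_ge0 ?sqr_ge0// ltW.
have h : (x ^+ 2 * c) ^+ k.+2 / k.+2`!%:R <= expR (x ^+ 2 * c).
  by apply: le_trans (expR_ge1Dxn k.+1 u0); rewrite lerDr.
have f0 : 0 < k.+2`!%:R :> R by rewrite ltr0n fact_gt0.
have EE : E x * expR (x ^+ 2 * c) = 1 by rewrite /E -expRD mulNr addNr expR0.
have E0 : 0 <= E x by exact: expR_ge0.
have hE : E x * (`|x| ^+ k.+2 * `|x| ^+ k.+2) <= k.+2`!%:R / c ^+ k.+2.
  rewrite ler_pdivlMr ?exprn_gt0// -mulrA.
  have -> : `|x| ^+ k.+2 * `|x| ^+ k.+2 * c ^+ k.+2 = (x ^+ 2 * c) ^+ k.+2.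
    by rewrite -!exprMn -expr2 real_normK ?num_real.
  move: h; rewrite ler_pdivrMr// => h.
  by apply: le_trans (ler_wpM2l E0 h) _; rewrite mulrA EE mul1r.
rewrite ler_pdivlMr// /G phiE !normrM normrX (ger0_norm (normal_peak_ge0 _)) (ger0_norm E0).
rewrite /A mulrCA -mulrA ler_wpM2l ?normal_peak_ge0//.
apply: le_trans hE; rewrite mulrAC mulrC ler_wpM2l// -exprSr -exprD.
by apply: ler_weXn2l => //; lia.
Qed.

Let cvg_G k : G k n.+1%:R - G k (- n.+1%:R) @[n --> \oo] --> 0.
Proof.
have [A hA] := G_le k.
have cA : (2 * A) * n.+1%:R^-1 @[n --> \oo] --> 0.
  by rewrite -[X in _ --> X](mulr0 (2 * A)); apply: cvgMr; exact: cvg_harmonic.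
have n1 n : 1 <= `|n.+1%:R : R| by rewrite normr_nat ler1n.
apply/norm_cvg0P; apply: (squeeze_cvgr _ (cvg_cst 0) cA).
apply: nearW => n; rewrite normr_ge0/=; apply: le_trans (ler_normB _ _) _.
have h1 := hA _ (n1 n); have := hA (- n.+1%:R); rewrite normrN => /(_ (n1 n)) h2.
apply: le_trans (lerD h1 h2) _.
by rewrite normr_nat -mulrA [leRHS]mulr_natl mulr2n.
Qed.

Let integrable_g k : mu.-integrable setT (fun x => (g k x)%:E).
Proof.
rewrite /g; under eq_fun do rewrite EFinB (EFinM k%:R) (EFinM (s ^- 2)).
apply: integrableB => //; apply: integrableZl => //; exact: integrable_normal_moment.
Qed.

(** The fundamental theorem of calculus applies on the interval from [- n.+1%:R] to [n.+1%:R], the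
    boundary terms vanish in the limit by [cvg_G], and dominated convergence exhausts the line. *)
Let integral_g k : (\int[mu]_x (g k x)%:E = 0)%E.
Proof.
pose gn n x := ((g k \_ `[- n.+1%:R, n.+1%:R]) x)%:E.
have cg : continuous (g k).
  have cp j (x : R) : y ^+ j * phi y @[y --> x] --> x ^+ j * phi x.
    by apply: cvgM; [exact: exprn_continuous|exact: continuous_normal_pdf].
  by move=> x; apply: cvgB; apply: cvgMr; exact: cp.
have FTC n : (\int[mu]_x gn n x = (G k n.+1%:R - G k (- n.+1%:R))%:E)%E.
  rewrite /gn.
  rewrite (_ : (fun x => _) = (EFin \o g k) \_ `[- n.+1%:R, n.+1%:R]); last first.
    by apply/funext => x; rewrite /patch; case: ifP.
  rewrite -integral_mkcond (@continuous_FTC2 _ (g k) (G k))//.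
  - by rewrite -subr_gt0 opprK addr_gt0// ltr0n.
  - exact: continuous_subspaceT.
  - have dG x : derivable (G k) x 1 by have := is_derive_G k x.
    have cG : continuous (G k).
      by move=> x; apply: differentiable_continuous; exact/derivable1_diffP.
    split => //; first by apply: cvg_at_right_filter; exact: cG.
    by apply: cvg_at_left_filter; exact: cG.
  - by move=> x _; rewrite derive1E; have /@derive_val := is_derive_G k x.
have mg := measurable_int _ (integrable_g k).
have := @dominated_convergence _ _ _ mu setT measurableT gn (EFin \o g k) (fun x => `|(g k x)%:E|%E).
case => //.
- move=> n; apply/measurable_EFinP; rewrite -[X in measurable_fun _ X]/((g k) \_ _).
  apply/(measurable_restrictT _ _).1 => //; apply: measurable_funTS; exact/measurable_EFinP.
- apply: aeW => x _; apply: (@cvg_near_cst _ _ _ _ _ _).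
  have [N hN] : exists N : nat, `|x| <= N%:R.
    by exists (Num.trunc `|x|).+1; rewrite ltW// truncnS_gt.
  exists N => // n /= Nn; rewrite /gn patchE mem_set//= in_itv/=.
  rewrite -ler_norml; apply: le_trans hN _; by rewrite ler_nat; exact: leqW.
- exact: integrable_abse.
- apply: aeW => x n _; rewrite /gn patchE; case: ifP => //=; rewrite normr0 lee_fin//.
move=> _ _; rewrite (_ : [sequence _]_n = (fun n => (G k n.+1%:R - G k (- n.+1%:R))%:E)); last first.
  by apply/funext => n; exact: FTC.
move=> h1; have h2 : (G k n.+1%:R - G k (- n.+1%:R))%:E @[n --> \oo] --> 0%E.
  by apply: cvg_EFin; [exact: nearW|exact: cvg_G].
by rewrite -(cvg_lim _ h1)// -(cvg_lim _ h2).
Qed.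

Lemma normal_moment_rec k :
  (\int[mu]_x (x ^+ k.+1 * phi x)%:E =
   (k%:R * s ^+ 2)%:E * \int[mu]_x (x ^+ k.-1 * phi x)%:E)%E.
Proof.
have := integral_g k; rewrite /g.
under eq_integral do rewrite EFinB (EFinM k%:R) (EFinM (s ^- 2)).
have h j := integrable_normal_moment j.
rewrite integralB//; try exact: integrableZl.
rewrite !integralZl//.
have fA := integrable_fin_num measurableT (h k.-1).
have fB := integrable_fin_num measurableT (h k.+1).
rewrite -(fineK fA) -(fineK fB) -!EFinM -EFinB; move: (fine _) (fine _) => b a [] /eqP.
rewrite subr_eq0 => /eqP e; congr EFin.
have s2 : s ^+ 2 != 0 by rewrite expf_neq0.
by rewrite mulrAC e mulrC mulrA divff ?mul1r.
Qed.

Lemma ge0_integral_normal_prob_powers n :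
  (\int[normal_prob 0 s]_x (`|x ^+ n|)%:E < +oo)%E.
Proof.
rewrite ge0_integral_normal_prob//; last first.
  by apply/measurable_EFinP/measurableT_comp => //; exact: measurable_funX.
have /integrableP[_] := integrable_normal_moment n.
by under eq_integral do rewrite /= normrM (ger0_norm (normal_pdf_ge0 _ _ _)) EFinM.
Qed.

Lemma integral_normal_prob_powers n :
  (\int[normal_prob 0 s]_x (x ^+ n)%:E = \int[mu]_x (x ^+ n * phi x)%:E)%E.
Proof.
have mX : measurable_fun [set: R] (fun x : R => (x ^+ n)%:E).
  by apply/measurable_EFinP; exact: measurable_funX.
rewrite integralE ge0_integral_normal_prob//; last exact: measurable_funepos.
rewrite ge0_integral_normal_prob//; last exact: measurable_funeneg.
rewrite [RHS]integralE; congr (_ - _)%E; apply: eq_integral => x _.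
  by rewrite !funeposE -!EFin_max -EFinM maxr_pMl ?normal_pdf_ge0// mul0r.
rewrite !funenegE -!EFinN -!EFin_max -EFinM maxr_pMl ?normal_pdf_ge0// mul0r.
by rewrite mulNr.
Qed.
End normal_moments.

Lemma normr_mul_le (F : realFieldType) (x y : F) : `|x * y| <= x ^+ 2 + y ^+ 2.
Proof.
rewrite ler_norml; have := sqr_ge0 (x + y); have := sqr_ge0 (x - y).
have := sqr_ge0 x; have := sqr_ge0 y; nra.
Qed.

Section gaussian_expectation.
Context {R : realType} {d : measure_display} {Omega : measurableType d}.
Variable P : probability Omega R.
Implicit Types X Y : Omega -> R.

(** All moments are required so that the class is stable under products; every polynomial in the
    [W h] then belongs to it, and integrability questions become structural. *)
Definition moments X : Prop :=
  measurable_fun [set: Omega] X /\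
  forall n, P.-integrable [set: Omega] (fun w => (X w ^+ n)%:E).

(* A junk value if [X] is not integrable. *)
Definition Ex X : R := fine (\int[P]_w (X w)%:E)%E.

Lemma moments_integrable X : moments X -> P.-integrable [set: Omega] (EFin \o X).
Proof. by move=> [_ /(_ 1%N)]. Qed.

Lemma integrable_even X n : measurable_fun [set: Omega] X ->
  P.-integrable [set: Omega] (fun w => (X w ^+ n.*2)%:E) ->
  P.-integrable [set: Omega] (fun w => (X w ^+ n)%:E).
Proof.
move=> mX hX.
have h1 : P.-integrable [set: Omega] (cst 1%:E) by exact: finite_measure_integrable_cst.
apply: (le_integrable measurableT _ _ (integrableD measurableT h1 hX)).
  by apply/measurable_EFinP; exact: measurable_funX.
move=> w _ /=; rewrite lee_fin.
rewrite -muln2 exprM; set x := X w ^+ n.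
rewrite [leRHS]ger0_norm; last by rewrite addr_ge0 ?sqr_ge0.
by have := normr_mul_le 1 x; rewrite mul1r expr1n.
Qed.

Lemma momentsP X : measurable_fun [set: Omega] X ->
  (forall n, P.-integrable [set: Omega] (fun w => (X w ^+ n.*2)%:E)) -> moments X.
Proof. by move=> mX h; split => // n; exact: integrable_even. Qed.

Lemma momentsM X Y : moments X -> moments Y -> moments (fun w => X w * Y w).
Proof.
move=> [mX hX] [mY hY]; apply: momentsP => [|n]; first exact: measurable_funM.
apply: (le_integrable measurableT _ _ (integrableD measurableT (hX (n.*2.*2)) (hY (n.*2.*2)))).
  by apply/measurable_EFinP; apply: measurable_funX; exact: measurable_funM.
move=> w _ /=; rewrite lee_fin exprMn -!(muln2 n.*2) !exprM.
set x := X w ^+ _; set y := Y w ^+ _.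
rewrite [leRHS]ger0_norm; last by rewrite addr_ge0 ?sqr_ge0.
exact: normr_mul_le.
Qed.

Lemma moments_cst c : moments (fun=> c).
Proof.
split; first exact: measurable_cst.
by move=> n; exact: finite_measure_integrable_cst.
Qed.

Lemma momentsD X Y : moments X -> moments Y -> moments (fun w => X w + Y w).
Proof.
move=> [mX hX] [mY hY]; apply: momentsP => [|n]; first exact: measurable_funD.
have := integrableZl measurableT (4 ^+ n) (integrableD measurableT (hX n.*2) (hY n.*2)).
apply: le_integrable => //=.
  by apply/measurable_EFinP; apply: measurable_funX; exact: measurable_funD.
move=> w _ /=; rewrite lee_fin.
have h (x y : R) : (x + y) ^+ n.*2 <= 4 ^+ n * (x ^+ n.*2 + y ^+ n.*2).
  rewrite -mul2n !exprM.
  wlog xy : x y / x ^+ 2 <= y ^+ 2 => [hw|].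
    case/orP: (le_total (x ^+ 2) (y ^+ 2)) => /hw//.
    by rewrite addrC (addrC (_ ^+ n)).
  apply: (@le_trans _ _ ((4 * y ^+ 2) ^+ n)).
    apply: lerXn2r; rewrite ?nnegrE ?sqr_ge0//; first by rewrite mulr_ge0 ?sqr_ge0.
    by have := sqr_ge0 (x - y); nra.
  by rewrite exprMn ler_wpM2l ?exprn_ge0// lerDr exprn_ge0// sqr_ge0.
rewrite !ger0_norm//.
  rewrite -mul2n !exprM mulr_ge0 ?exprn_ge0// addr_ge0// exprn_ge0// sqr_ge0//.
by rewrite -mul2n exprM exprn_ge0// sqr_ge0.
Qed.

Lemma momentsZ c X : moments X -> moments (fun w => c * X w).
Proof. by apply: momentsM; exact: moments_cst. Qed.

Lemma momentsB X Y : moments X -> moments Y -> moments (fun w => X w - Y w).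
Proof.
move=> hX /(momentsZ (-1)) hY; have := momentsD hX hY.
by under eq_fun do rewrite mulN1r.
Qed.

Lemma momentsX X n : moments X -> moments (fun w => X w ^+ n).
Proof.
move=> hX; elim: n => [|n IH]; first by under eq_fun do rewrite expr0; exact: moments_cst.
by under eq_fun do rewrite exprS; exact: momentsM.
Qed.

Lemma moments_sum (A : Type) (r : seq A) (X : A -> Omega -> R) :
  (forall a, moments (X a)) -> moments (fun w => \sum_(a <- r) X a w).
Proof.
move=> h; elim: r => [|a r IH].
  by under eq_fun do rewrite big_nil; exact: moments_cst.
by under eq_fun do rewrite big_cons; exact: momentsD.
Qed.

Lemma moments_prod (A : Type) (r : seq A) (X : A -> Omega -> R) :
  (forall a, moments (X a)) -> moments (fun w => \prod_(a <- r) X a w).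
Proof.
move=> h; elim: r => [|a r IH].
  by under eq_fun do rewrite big_nil; exact: moments_cst.
by under eq_fun do rewrite big_cons; exact: momentsM.
Qed.

Lemma ExE X : moments X -> (\int[P]_w (X w)%:E)%E = (Ex X)%:E.
Proof.
by move=> /moments_integrable h; rewrite fineK//; exact: integrable_fin_num.
Qed.

Lemma eq_Ex X Y : X =1 Y -> Ex X = Ex Y.
Proof. by move=> /funext ->. Qed.

Lemma ExD X Y : moments X -> moments Y -> Ex (fun w => X w + Y w) = Ex X + Ex Y.
Proof.
move=> hX hY; apply: EFin_inj; rewrite EFinD -!ExE//; last exact: momentsD.
rewrite -integralD_EFin//; exact: moments_integrable.
Qed.

Lemma Ex_cst c : Ex (fun=> c) = c.
Proof. by rewrite /Ex integral_cst//= probability_setT mule1. Qed.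

Lemma ExZ c X : moments X -> Ex (fun w => c * X w) = c * Ex X.
Proof.
move=> hX; apply: EFin_inj; rewrite EFinM -!ExE//; last exact: momentsZ.
by rewrite -integralZl//; exact: moments_integrable.
Qed.

Lemma ExB X Y : moments X -> moments Y -> Ex (fun w => X w - Y w) = Ex X - Ex Y.
Proof.
move=> hX hY; rewrite -mulN1r -ExZ// -ExD//; last exact: momentsZ.
by apply: eq_Ex => w; rewrite mulN1r.
Qed.

Lemma Ex_sum (A : Type) (r : seq A) (X : A -> Omega -> R) :
  (forall a, moments (X a)) ->
  Ex (fun w => \sum_(a <- r) X a w) = \sum_(a <- r) Ex (X a).
Proof.
move=> h; elim: r => [|a r IH].
  by under eq_Ex do rewrite big_nil; rewrite big_nil Ex_cst.
by under eq_Ex do rewrite big_cons; rewrite ExD ?big_cons ?IH//; exact: moments_sum.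
Qed.

(** This recursion is all that is used later of the Gaussian law. The value of [v] is left implicit,
    because the case [k = 1] identifies it with the second moment; a degenerate law has [v = 0]. *)
Lemma gaussian_moments X : centered_gaussian P X ->
  moments X /\ exists v : R, forall k,
    Ex (fun w => X w ^+ k.+1) = k%:R * v * Ex (fun w => X w ^+ k.-1).
Proof.
move=> [mX [s hs]].
have E0 (f : R -> \bar R) : measurable_fun [set: R] f -> (forall x, 0 <= f x)%E ->
    (\int[P]_w f (X w) =
     if s == 0%R then f 0%R else \int[normal_prob 0 s]_x f x)%E.
  move=> mf f0.
  have := @ge0_integral_pushforward _ _ Omega (measurableTypeR R) R X mX P setT f measurableT mf.
  rewrite preimage_setT => h.
  rewrite -[LHS]h//.
  pose X' : {mfun Omega >-> measurableTypeR R} :=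
    HB.pack X (isMeasurableFun.Build _ _ Omega (measurableTypeR R) X mX).
  have e1 m2 := @eq_measure_integral _ (measurableTypeR R) R setT m2 (pushforward P X') f.
  case: eqP hs => [_ hs|_ hs].
    rewrite (e1 mX (\d_(0 : measurableTypeR R))) => [|A mA _]; last exact: hs.
    by rewrite integral_dirac//= diracT mul1e.
  by rewrite (e1 mX (normal_prob 0 s)) => [//|A mA _]; exact: hs.
have mpow n : measurable_fun [set: R] (fun x : R => (x ^+ n)%:E).
  by apply/measurable_EFinP; exact: measurable_funX.
have E1 n : (\int[P]_w (X w ^+ n)%:E =
    if s == 0%R then (0 ^+ n)%:E else \int[normal_prob 0 s]_x (x ^+ n)%:E)%E.
  rewrite integralE; pose f (x : R) := (x ^+ n)%:E.
  transitivity (\int[P]_w f^\+ (X w) - \int[P]_w f^\- (X w))%E.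
    by congr (_ - _)%E; apply: eq_integral => w _; rewrite ?funeposE ?funenegE.
  rewrite (E0 f^\+%E)//; last by apply: measurable_funepos; exact: mpow.
  rewrite (E0 f^\-%E)//; last by apply: measurable_funeneg; exact: mpow.
  case: ifP => _; last by rewrite [RHS]integralE.
  by rewrite -[RHS]/(f 0%R) [in RHS](funeposneg f).
have nX : moments X.
  split => // n; apply/integrableP; split.
    by apply/measurable_EFinP; exact: measurable_funX.
  rewrite (E0 (fun x : R => `|(x ^+ n)%:E|)%E)//; last exact: measurableT_comp.
  case: (eqVneq s 0) => [_|s0]; first by rewrite ltry.
  exact: ge0_integral_normal_prob_powers.
split => //; exists (s ^+ 2) => k; rewrite /Ex !E1.
case: (eqVneq s 0) => [->|s0]; first by rewrite !expr0n/= mulr0 mul0r.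
rewrite !integral_normal_prob_powers// normal_moment_rec// fineM//.
exact: integrable_fin_num (integrable_normal_moment s0 _).
Qed.
End gaussian_expectation.

Lemma poly_ext (F : numFieldType) (p q : {poly F}) : (forall t, p.[t] = q.[t]) -> p = q.
Proof.
move=> h; pose N := maxn (size p) (size q).
have sp : (size p <= N)%N by exact: leq_maxl.
have sq : (size q <= N)%N by exact: leq_maxr.
have e (t : F) : \sum_(a < N) t ^+ a * p`_a = q.[t].
  rewrite -h (horner_coef_wide t sp); by apply: eq_bigr => i _; rewrite mulrC.
apply/polyP => i; have [iN|iN] := ltnP i N.
  exact: (horner_coef_unique sq e (Ordinal iN)).
by rewrite !nth_default// (leq_trans _ iN).
Qed.

Section gaussian_integration_by_parts.
Context {R : realType} {H : completeNormedModType R}.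
Context {d : measure_display} {Omega : measurableType d}.
Variables (P : probability Omega R) (ip : {dot H for idfun}) (W : H -> Omega -> R).
Hypothesis hW : isonormal P ip W.
Local Notation Ex := (Ex P).
Local Notation moments := (moments P).

Lemma ipC x y : ip x y = ip y x.
Proof. by have := hermC ip x y; rewrite /= expr0 mul1r. Qed.

Lemma gaussian_comb n (a : 'I_n -> R) (h : 'I_n -> H) :
  centered_gaussian P (fun w => \sum_(i < n) a i * W (h i) w).
Proof. exact: (isonormal_gaussian hW). Qed.

Lemma moments_W h : moments (W h).
Proof.
have [+ _] := gaussian_moments (gaussian_comb (fun=> 1) (fun _ : 'I_1 => h)).
by under eq_fun do rewrite big_ord1 mul1r.
Qed.

Lemma Ex_WW x y : Ex (fun w => W x w * W y w) = ip x y.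
Proof.
apply: EFin_inj; rewrite -(isonormal_covariance hW) unlock ExE//.
by apply: momentsM; exact: moments_W.
Qed.

Section univariate.
Variables (n : nat) (y : 'I_n -> H) (S : {set 'I_n}) (x : H).
Let Y w := \sum_(l in S) W (y l) w.
Let Z t w := Y w + t * W x w.

Let nY : moments Y.
Proof.
have -> : Y = fun w => \sum_(l < n) (if l \in S then 1 else 0) * W (y l) w.
  apply/funext => w; rewrite /Y big_mkcond; apply: eq_bigr => l _.
  by case: ifP; rewrite ?mul1r ?mul0r.
by apply: moments_sum => l; apply: momentsZ; exact: moments_W.
Qed.

Let gZ t : moments (Z t) /\ exists v : R, forall k,
  Ex (fun w => Z t w ^+ k.+1) = k%:R * v * Ex (fun w => Z t w ^+ k.-1).
Proof.
apply: gaussian_moments.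
have := gaussian_comb (fun i : 'I_n.+1 => if unlift ord_max i is Some l then
   (if l \in S then 1 else 0) else t) (fun i => if unlift ord_max i is Some l then y l else x).
congr (centered_gaussian P _); apply/funext => w; rewrite big_ord_recr/= unlift_none.
congr (_ + _); rewrite /Y [RHS]big_mkcond; apply: eq_bigr => l _.
have -> : widen_ord (leqnSn n) l = lift ord_max l.
  by apply: val_inj; rewrite /= /bump leqNgt ltn_ord.
by rewrite liftK; case: ifP; rewrite ?mul1r ?mul0r.
Qed.

Let m i j := Ex (fun w => Y w ^+ i * W x w ^+ j).

Let nYW i j : moments (fun w => Y w ^+ i * W x w ^+ j).
Proof. by apply: momentsM; apply: momentsX => //; exact: moments_W. Qed.

Let q k : {poly R} := \sum_(i < k.+1) ('C(k, i)%:R * m (k - i) i) *: 'X^i.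

Let horner_q k t : (q k).[t] = Ex (fun w => Z t w ^+ k).
Proof.
rewrite horner_sum.
transitivity (Ex (fun w => \sum_(i < k.+1) ('C(k, i)%:R * t ^+ i) * (Y w ^+ (k - i) * W x w ^+ i))).
  rewrite Ex_sum => [|i]; last exact: momentsZ.
  apply: eq_bigr => i _; rewrite hornerZ hornerXn ExZ//; by rewrite /m; ring.
apply: eq_Ex => w; rewrite exprDn; apply: eq_bigr => i _.
by rewrite exprMn -mulr_natl; ring.
Qed.

(** The implicit [v] is replaced by the second moment, [q 2]; the recursion holds for every real [t]
    and is therefore an identity of polynomials. *)
Let qrec k : q k.+1 = k%:R *: (q 2 * q k.-1).
Proof.
apply: poly_ext => t; rewrite hornerZ hornerM !horner_q.
have [_ [v hv]] := gZ t; rewrite !hv.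
have -> : Ex (fun w => Z t w ^+ 1.-1) = 1.
  by under eq_Ex do rewrite expr0; rewrite Ex_cst.
by ring.
Qed.

Let coef_q k i : (i <= k)%N -> (q k)`_i = 'C(k, i)%:R * m (k - i) i.
Proof.
move=> ik; rewrite /q coef_sum (bigD1 (Ordinal (ik : (i < k.+1)%N)))//= coefZ coefXn eqxx mulr1.
rewrite big1 ?addr0// => j ji; rewrite coefZ coefXn (_ : (i == j) = false) ?mulr0//.
by apply: contraNF ji => /eqP ij; apply/eqP/val_inj.
Qed.

Let mrec k : m k.+1 0 = k%:R * m 2 0 * m k.-1 0.
Proof.
have := congr1 (fun p : {poly R} => p`_0) (qrec k).
by rewrite coefZ coef0M !coef_q// !bin0 !mul1r !subn0 mulrA.
Qed.

(* The [k]-th moment of the centered Gaussian variable [Y + t * W x] is the polynomial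
   [q k] in [t]; the formula is the coefficient of [t] in the recursion [qrec]. *)
Lemma gaussian_ibp_power k : Ex (fun w => W x w * Y w ^+ k) =
  k%:R * (\sum_(l in S) ip x (y l)) * Ex (fun w => Y w ^+ k.-1).
Proof.
have e1 j : Ex (fun w => W x w * Y w ^+ j) = m j 1.
  by apply: eq_Ex => w; rewrite expr1 mulrC.
have e0 j : Ex (fun w => Y w ^+ j) = m j 0.
  by apply: eq_Ex => w; rewrite expr0 mulr1.
have es : \sum_(l in S) ip x (y l) = m 1 1.
  rewrite -e1 (eq_Ex P (Y := fun w => \sum_(l < n) (if l \in S then 1 else 0) * (W x w * W (y l) w))).
    rewrite Ex_sum => [|l]; last by apply: momentsZ; apply: momentsM; exact: moments_W.
    rewrite big_mkcond; apply: eq_bigr => l _; rewrite ExZ; last by apply: momentsM; exact: moments_W.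
    by rewrite Ex_WW; case: ifP; rewrite ?mul1r ?mul0r.
  move=> w; rewrite expr1 /Y mulr_sumr big_mkcond; apply: eq_bigr => l _.
  by case: ifP; rewrite ?mul1r ?mul0r.
rewrite e1 e0 es.
have qk j : j.+2%:R * m j.+1 1 = j.+1%:R * (2 * m 1 1 * m j 0 + m 2 0 * (j%:R * m j.-1 1)).
  have := congr1 (fun p : {poly R} => p`_1) (qrec j.+1).
  rewrite coefZ coefM big_ord_recl big_ord1/= subn0 (_ : bump 0 0 = 1)// subnn.
  rewrite (coef_q (k := j.+2))// (coef_q (k := 2) (i := 0))// (coef_q (k := 2) (i := 1))//.
  rewrite (coef_q (k := j) (i := 0))// !bin0 !bin1 !subn0 !subn1/= !mul1r.
  case: j => [|j]; last by rewrite !coef_q// bin1 subn1/= => ->; ring.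
  rewrite (_ : (q 0)`_1 = 0); last by rewrite nth_default// /q big_ord1 expr0 (leq_trans (size_scale_leq _ _)) ?size_poly1.
  by move=> h; rewrite [LHS]h; ring.
have m01 : m 0 1 = 0.
  have := congr1 (fun p : {poly R} => p`_1) (qrec 0).
  by rewrite coef_q// scale0r coef0 binn mul1r.
have [j] := ubnP k; elim: j k => // j IH [|k]; first by rewrite m01 !mul0r.
rewrite ltnS => kj; apply: (@mulfI _ k.+2%:R); first by rewrite pnatr_eq0.
rewrite qk/=; case: k kj => [|[|k]] kj.
- by rewrite mul0r mulr0 addr0; ring.
- by rewrite (mrec 0)/= m01; ring.
- rewrite (IH k.+1)/=; last by rewrite (leq_trans _ kj).
  by rewrite (mrec k.+1)/=; ring.
Qed.
End univariate.

(* The derivative of [\prod_(y <- ys) W y] in the direction [x]. *)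
Fixpoint wdiff (x : H) (ys : seq H) (w : Omega) : R :=
  if ys is y :: ys' then ip x y * (\prod_(z <- ys') W z w) + W y w * wdiff x ys' w
  else 0.

Lemma moments_Wprod ys : moments (fun w => \prod_(z <- ys) W z w).
Proof. by apply: moments_prod => z; exact: moments_W. Qed.

Lemma moments_wdiff x ys : moments (wdiff x ys).
Proof.
elim: ys => [|y ys IH] /=; first exact: moments_cst.
apply: momentsD; first by apply: momentsZ; exact: moments_Wprod.
by apply: momentsM => //; exact: moments_W.
Qed.

(** [W y] shifted along [t x], as a polynomial in [t]. Ryser's formula for these polynomials yields
    the product of the [W z] through its value at 0, and [wdiff] through its derivative at 0. *)
Let linp x w (y : H) : {poly R} := (W y w)%:P + (ip x y) *: 'X.

Let linp0 x w y : (linp x w y).[0] = W y w.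
Proof. by rewrite /linp hornerD hornerC hornerZ hornerX mulr0 addr0. Qed.

Let deriv_linp x w y : (linp x w y)^`() = (ip x y)%:P.
Proof. by rewrite /linp derivD derivC derivZ derivX add0r alg_polyC. Qed.

Let deriv_prod_linp x w ys : ((\prod_(y <- ys) linp x w y)^`()).[0] = wdiff x ys w.
Proof.
elim: ys => [|y ys IH] /=; first by rewrite big_nil derivC horner0.
rewrite big_cons derivM hornerD !hornerM IH deriv_linp linp0 hornerC horner_prod.
by congr (_ * _ + _); apply: eq_bigr => z _; rewrite linp0.
Qed.

(* By [ryser], a product of [n] variables is a combination of [n]-th powers of partial sums. *)
Lemma gaussian_ibp x ys : Ex (fun w => W x w * \prod_(z <- ys) W z w) = Ex (wdiff x ys).
Proof.
pose n := size ys; pose y (l : 'I_n) := tnth (in_tuple ys) l.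
pose Y (S : {set 'I_n}) w := \sum_(l in S) W (y l) w.
have nYS S : moments (Y S).
  have -> : Y S = fun w => \sum_(l < n) (if l \in S then 1 else 0) * W (y l) w.
    apply/funext => w; rewrite /Y big_mkcond; apply: eq_bigr => l _.
    by case: ifP; rewrite ?mul1r ?mul0r.
  by apply: moments_sum => l; apply: momentsZ; exact: moments_W.
have poly w : \sum_(S : {set 'I_n}) (-1) ^+ (n - #|S|) * (\sum_(l in S) linp x w (y l)) ^+ n =
    (\prod_(z <- ys) linp x w z) *+ n`!.
  have := ryser (fun l _ : 'I_n => linp x w (y l)).
  under [X in X = _ -> _]eq_bigr do rewrite big_const_ord iter_mulr_1.
  move=> ->.
  rewrite [LHS](eq_bigr (fun=> \prod_(z <- ys) linp x w z)) => [|s _].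
    rewrite (eq_bigl (fun s => s \in [set: 'S_n]%SET)) => [|s]; last by rewrite inE.
    by rewrite sumr_const cardsT card_Sn.
  rewrite -(reindex_inj (@perm_inj _ s) (P := xpredT) (F := fun k => linp x w (y k))).
  by rewrite [RHS](big_tuple _ _ (in_tuple ys)).
have f0 : n`!%:R != 0 :> R := fact_neq0 n.
have eP w : n`!%:R * (\prod_(z <- ys) W z w) = \sum_(S : {set 'I_n}) (-1) ^+ (n - #|S|) * Y S w ^+ n.
  have := congr1 (fun p : {poly R} => p.[0]) (poly w); rewrite hornerMn horner_prod => h.
  rewrite mulr_natl (eq_bigr (fun z => (linp x w z).[0])) => [|z _]; last by rewrite linp0.
  rewrite -h horner_sum; apply: eq_bigr => S _; rewrite -polyC1 -polyCN -polyC_exp.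
  rewrite hornerM horner_exp horner_sum hornerC; congr (_ * _ ^+ _).
  by apply: eq_bigr => l _; rewrite linp0.
have eD w : n`!%:R * wdiff x ys w = \sum_(S : {set 'I_n})
    ((-1) ^+ (n - #|S|) * (n%:R * \sum_(l in S) ip x (y l))) * Y S w ^+ n.-1.
  have := congr1 (fun p : {poly R} => (p^`()).[0]) (poly w).
  rewrite derivMn hornerMn deriv_prod_linp mulr_natl => <-.
  rewrite linear_sum/= horner_sum; apply: eq_bigr => S _.
  rewrite -polyC1 -polyCN -polyC_exp derivM derivC mul0r add0r hornerM hornerC.
  rewrite deriv_exp hornerMn hornerM horner_exp -!mulrA; congr (_ * _).
  have -> : (\sum_(l in S) linp x w (y l)).[0] = Y S w.
    by rewrite horner_sum; apply: eq_bigr => l _; rewrite linp0.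
  have -> : ((\sum_(l in S) linp x w (y l))^`()).[0] = \sum_(l in S) ip x (y l).
    by rewrite linear_sum/= horner_sum; apply: eq_bigr => l _; rewrite deriv_linp hornerC.
  by rewrite -mulr_natl; ring.
apply: (mulfI f0); rewrite -!ExZ; [|exact: moments_wdiff|by apply: momentsM; [exact: moments_W|exact: moments_Wprod]].
transitivity (Ex (fun w => \sum_(S : {set 'I_n}) (-1) ^+ (n - #|S|) * (W x w * Y S w ^+ n))).
  apply: eq_Ex => w; rewrite mulrCA eP mulr_sumr; apply: eq_bigr => S _; by rewrite mulrCA.
under [RHS]eq_Ex do rewrite eD.
rewrite !Ex_sum => [|S|S]; last 2 first.
- by apply: momentsZ; exact: momentsX.
- by apply: momentsZ; apply: momentsM; [exact: moments_W|exact: momentsX].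
apply: eq_bigr => S _; rewrite !ExZ; [|exact: momentsX|by apply: momentsM; [exact: moments_W|exact: momentsX]].
by rewrite -mulrA; congr (_ * _); exact: gaussian_ibp_power.
Qed.
End gaussian_integration_by_parts.

(** * Products of four Hermite polynomials *)

(* The binomial formula for [(A + B)^a]. *)
Lemma iter_addop (R : comNzRingType) (J : Type) (A B : (J -> R) -> J -> R) (g : nat -> J -> R) :
  (forall n (c : 'I_n -> R) (f : 'I_n -> J -> R) s,
     A (fun s => \sum_(i < n) c i * f i s) s = \sum_(i < n) c i * A (f i) s) ->
  (forall n (c : 'I_n -> R) (f : 'I_n -> J -> R) s,
     B (fun s => \sum_(i < n) c i * f i s) s = \sum_(i < n) c i * B (f i) s) ->
  (forall f, A (B f) = B (A f)) ->
  (forall a s, g a.+1 s = A (g a) s + B (g a) s) ->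
  forall a s, g a s = \sum_(i < a.+1) 'C(a, i)%:R * iter i A (iter (a - i) B (g 0)) s.
Proof.
move=> linA linB AB gS a; elim: a => [|a IH] s; first by rewrite big_ord1 bin0 mul1r.
have BA i f : B (iter i A f) = iter i A (B f).
  by elim: i => //= i <-; rewrite AB.
rewrite gS (funext IH : g a = _) linA linB.
rewrite [RHS]big_ord_recl bin0 mul1r subn0.
under [X in _ + X]eq_bigr => i _ do rewrite (BA i (iter (a - i) B (g 0))) -iterS.
rewrite [X in _ + X]big_ord_recl bin0 mul1r subn0 addrCA; congr (_ + _).
under [RHS]eq_bigr => i _ do rewrite lift0 subSS binS natrD mulrDl.
rewrite big_split/= addrC; congr (_ + _).
rewrite [RHS]big_ord_recr [X in _ = X]/= bin_small// mul0r addr0; apply: eq_bigr => i _.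
by rewrite /bump leq0n add1n add0n -[B (iter _ _ _)]iterS subnSK.
Qed.

Section hermite_polynomials.
Context {R : realType}.

(* [|x|^n H_n (v / |x|)] as a polynomial in [v], where [s] stands for [|x|^2]. *)
Definition hermiteh (s : R) (n : nat) : {poly R} :=
  iter n (fun p => 'X * p - s *: p^`()) 1.

Lemma hermiteh1 n : hermiteh 1 n = hermite n.
Proof. by elim: n => //= n ->; rewrite scale1r. Qed.

Lemma deriv_hermiteh s n : (hermiteh s n)^`() = n%:R *: hermiteh s n.-1.
Proof.
elim: n => [|n IH]; first by rewrite /= derivC scale0r.
rewrite /= derivB derivM derivX mul1r derivZ IH derivZ.
case: n IH => [|n] IH; first by rewrite !scale0r scaler0 mulr0 subr0 addr0 scale1r.
rewrite -scalerAr (scalerA s) (mulrC s) -(scalerA _ s) -addrA -scalerBr.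
by rewrite -[X in _ *: X]/(hermiteh s n.+1) -[in RHS]natr1 scalerDl scale1r addrC.
Qed.

Lemma hermitehS s n : hermiteh s n.+1 = 'X * hermiteh s n - (n%:R * s) *: hermiteh s n.-1.
Proof. by rewrite -[LHS]/('X * _ - s *: _) deriv_hermiteh scalerA (mulrC s). Qed.

Lemma horner_hermitehS s n v :
  (hermiteh s n.+1).[v] = v * (hermiteh s n).[v] - n%:R * s * (hermiteh s n.-1).[v].
Proof. by rewrite hermitehS hornerD hornerN hornerM hornerX hornerZ. Qed.

(** [multiple_integral_hermite] concerns unit vectors; this homogeneity covers the others. The
    Hermite recursion has three terms, hence the strong induction. *)
Lemma hermiteh_scale c s n v : (hermiteh (c ^+ 2 * s) n).[c * v] = c ^+ n * (hermiteh s n).[v].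
Proof.
have [k] := ubnP n; elim: k n => // k IH [|n]; first by rewrite !hornerC mulr1.
rewrite ltnS => nk; rewrite !horner_hermitehS IH//.
case: n nk => [|n] nk; first by rewrite !hornerC; ring.
by rewrite IH ?(ltn_trans _ nk)//= !exprS; ring.
Qed.
End hermite_polynomials.

Section hermite_products.
Context {R : realType} {H : completeNormedModType R}.
Context {d : measure_display} {Omega : measurableType d}.
Variables (P : probability Omega R) (ip : {dot H for idfun}) (W : H -> Omega -> R).
Hypothesis hW : isonormal P ip W.
Local Notation Ex := (Ex P).
Local Notation moments := (moments P).

Lemma moments_horner (p : {poly R}) y : moments (fun w => p.[W y w]).
Proof.
under eq_fun do rewrite horner_coef.
by apply: moments_sum => i; apply: momentsZ; apply: momentsX; exact: moments_W hW y.
Qed.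

Let n4 (p q r s : {poly R}) x y z t : moments (fun w => p.[W x w] * (q.[W y w] * (r.[W z w] * s.[W t w]))).
Proof. by do 3![apply: momentsM; first exact: moments_horner]; exact: moments_horner. Qed.

(* [G'] plays the role of the derivative of [G] in the direction [x]. *)
Definition ibp x (G G' : Omega -> R) : Prop :=
  [/\ moments G, moments G' & forall ys, Ex (fun w => W x w * (G w * \prod_(z <- ys) W z w)) =
     Ex (fun w => G' w * (\prod_(z <- ys) W z w) + G w * wdiff ip W x ys w)].

Let nW := moments_W hW.
Let nWp := moments_Wprod hW.
Let nd := moments_wdiff hW.

Lemma ibp1 x : ibp x (fun=> 1) (fun=> 0).
Proof.
split; [exact: moments_cst|exact: moments_cst|move=> ys].
rewrite [RHS](eq_Ex P (Y := wdiff ip W x ys)) => [|w]; last by rewrite mul0r add0r mul1r.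
by rewrite -(gaussian_ibp hW); apply: eq_Ex => w; rewrite mul1r.
Qed.

(** The factor [W y] is absorbed into the list [ys]; this is why [ibp] quantifies over all lists. *)
Lemma ibpW x y G G' : ibp x G G' ->
  ibp x (fun w => W y w * G w) (fun w => ip x y * G w + W y w * G' w).
Proof.
move=> [nG nG' h]; split.
- exact: momentsM.
- by apply: momentsD; [exact: momentsZ|exact: momentsM].
- move=> ys; have := h (y :: ys) => /= h'.
  transitivity (Ex (fun w => W x w * (G w * \prod_(z <- y :: ys) W z w))).
    by apply: eq_Ex => w; rewrite big_cons; ring.
  by rewrite h'; apply: eq_Ex => w; rewrite big_cons; ring.
Qed.

Lemma ibpD x G1 G1' G2 G2' : ibp x G1 G1' -> ibp x G2 G2' ->
  ibp x (fun w => G1 w + G2 w) (fun w => G1' w + G2' w).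
Proof.
move=> [nG1 nG1' h1] [nG2 nG2' h2]; split; [exact: momentsD|exact: momentsD|move=> ys].
transitivity (Ex (fun w => W x w * (G1 w * \prod_(z <- ys) W z w) + W x w * (G2 w * \prod_(z <- ys) W z w))).
  by apply: eq_Ex => w; ring.
rewrite ExD; last 2 first.
- by apply: momentsM => //; exact: momentsM.
- by apply: momentsM => //; exact: momentsM.
rewrite h1 h2 -ExD; last 2 first.
- by apply: momentsD; apply: momentsM.
- by apply: momentsD; apply: momentsM.
by apply: eq_Ex => w; ring.
Qed.

Lemma ibpZ x c G G' : ibp x G G' -> ibp x (fun w => c * G w) (fun w => c * G' w).
Proof.
move=> [nG nG' h]; split; [exact: momentsZ|exact: momentsZ|move=> ys].
transitivity (Ex (fun w => c * (W x w * (G w * \prod_(z <- ys) W z w)))).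
  by apply: eq_Ex => w; ring.
rewrite ExZ; last by apply: momentsM => //; exact: momentsM.
rewrite h -ExZ; last by apply: momentsD; apply: momentsM.
by apply: eq_Ex => w; ring.
Qed.

Lemma eq_ibp x G1 G1' G2 G2' : G1 =1 G2 -> G1' =1 G2' -> ibp x G1 G1' -> ibp x G2 G2'.
Proof. by move=> /funext -> /funext ->. Qed.

(** Horner's scheme: a polynomial in [W y] is built from multiplications by [W y], scalings and
    sums, under which [ibp] is stable. *)
Lemma ibp_horner x y (p : {poly R}) G G' : ibp x G G' ->
  ibp x (fun w => p.[W y w] * G w)
        (fun w => ip x y * (p^`()).[W y w] * G w + p.[W y w] * G' w).
Proof.
move=> h; elim/poly_ind: p => [|p c IH].
  by apply: eq_ibp (ibpZ 0 h) => w; rewrite ?deriv0 !horner0; ring.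
apply: eq_ibp (ibpD (ibpW y IH) (ibpZ c h)) => w.
  by rewrite hornerMXaddC; ring.
by rewrite derivMXaddC hornerMXaddC hornerD hornerMX; ring.
Qed.

Lemma ibp4 x y z t (p q r s : {poly R}) :
  Ex (fun w => W x w * (p.[W x w] * (q.[W y w] * (r.[W z w] * s.[W t w])))) =
  ip x x * Ex (fun w => (p^`()).[W x w] * (q.[W y w] * (r.[W z w] * s.[W t w]))) +
  ip x y * Ex (fun w => p.[W x w] * ((q^`()).[W y w] * (r.[W z w] * s.[W t w]))) +
  ip x z * Ex (fun w => p.[W x w] * (q.[W y w] * ((r^`()).[W z w] * s.[W t w]))) +
  ip x t * Ex (fun w => p.[W x w] * (q.[W y w] * (r.[W z w] * (s^`()).[W t w]))).
Proof.
have [_ _ /(_ [::])] := ibp_horner x p (ibp_horner y q (ibp_horner z r (ibp_horner t s (ibp1 x)))).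
have nz c (p1 q1 r1 s1 : {poly R}) := momentsZ c (n4 p1 q1 r1 s1 x y z t).
rewrite -!ExZ// -!ExD//; last 2 first.
- by do 2![apply: momentsD => //].
- by apply: momentsD.
move=> h; transitivity (Ex (fun w => W x w *
    (p.[W x w] * (q.[W y w] * (r.[W z w] * (s.[W t w] * 1))) * \prod_(z <- [::]) W z w))).
  by apply: eq_Ex => w; rewrite big_nil !mulr1.
by rewrite h; apply: eq_Ex => w; rewrite big_nil /=; ring.
Qed.

Local Notation hx x n w := ((hermiteh (ip x x) n).[W x w]).

Definition hermite4 x y z t (a b c n : nat) : R :=
  Ex (fun w => hx x a w * (hx y b w * (hx z c w * hx t n w))).

(** The derivative of the first factor in its own direction contributes [ip x x * a%:R] times the
    Hermite polynomial of order [a.-1], exactly what the Hermite recursion subtracts. Only pairings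
    of [x] with the other three vectors remain. *)
Lemma hermite4S x y z t a b c n : hermite4 x y z t a.+1 b c n =
  b%:R * ip x y * hermite4 x y z t a b.-1 c n +
  c%:R * ip x z * hermite4 x y z t a b c.-1 n +
  n%:R * ip x t * hermite4 x y z t a b c n.-1.
Proof.
have := ibp4 x y z t (hermiteh (ip x x) a) (hermiteh (ip y y) b) (hermiteh (ip z z) c) (hermiteh (ip t t) n).
rewrite !deriv_hermiteh => h.
transitivity (Ex (fun w => W x w * (hx x a w * (hx y b w * (hx z c w * hx t n w)))) -
   ip x x * Ex (fun w => (a%:R *: hermiteh (ip x x) a.-1).[W x w] * (hx y b w * (hx z c w * hx t n w)))).
  rewrite -ExZ// -ExB//; last first.
  - exact: momentsZ.
  - by apply: momentsM; [exact: nW|exact: n4].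
  by apply: eq_Ex => w; rewrite horner_hermitehS hornerZ; ring.
rewrite h [X in X - _ = _](_ : _ = ip x x * Ex (fun w => (a%:R *: hermiteh (ip x x) a.-1).[W x w] * (hx y b w * (hx z c w * hx t n w))) +
  (b%:R * ip x y * hermite4 x y z t a b.-1 c n +
  c%:R * ip x z * hermite4 x y z t a b c.-1 n +
  n%:R * ip x t * hermite4 x y z t a b c n.-1)).
  by rewrite addrC addKr.
rewrite -!addrA; congr (_ + _).
rewrite /hermite4 ![_%:R * ip _ _]mulrC -!mulrA -!ExZ; try by [apply: n4|apply: momentsZ; apply: n4].
by congr (_ + (_ + _)); apply: eq_Ex => w; rewrite hornerZ; ring.
Qed.

Let linop c (n : nat) (k : 'I_n -> R) (f : 'I_n -> R) :
  c * (\sum_(i < n) k i * f i) = \sum_(i < n) k i * (c * f i).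
Proof. by rewrite mulr_sumr; apply: eq_bigr => i _; rewrite mulrCA. Qed.

(** Iterating a weighted lowering operator accumulates a falling factorial, the number of ordered
    choices of [i] partners among [n s] slots. *)
Let iter_ff (J : Type) (n : J -> nat) (pr : J -> J) (c : R) i (f : J -> R) s :
  (forall s, n (pr s) = (n s).-1) ->
  iter i (fun f s => (n s)%:R * c * f (pr s)) f s =
    (n s ^_ i)%:R * c ^+ i * f (iter i pr s).
Proof.
move=> hn; elim: i s => [|i IH] s; first by rewrite /= ffactn0 expr0 !mul1r.
by rewrite iterS IH ffactnS -iterSr hn natrM exprS; ring.
Qed.

Lemma hermite4_n000 t x y z n : hermite4 t x y z n 0 0 0 = (n == 0)%:R.
Proof.
case: n => [|n]; last by rewrite hermite4S !mul0r !addr0.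
rewrite /hermite4 (eq_Ex P (Y := fun=> 1)) ?Ex_cst// => w.
by rewrite /= !hornerC !mul1r.
Qed.

Lemma hermite4_n00n z x y t c n : hermite4 z x y t c 0 0 n = (c == n)%:R * c`!%:R * ip z t ^+ c.
Proof.
elim: c n => [|c IH] n.
  rewrite expr0 fact0 !mulr1 eq_sym -(hermite4_n000 t x y z).
  by apply: eq_Ex => w; rewrite /= !hornerC; ring.
rewrite hermite4S !mul0r !add0r IH; case: n => [|n]; first by rewrite !mul0r.
rewrite eqSS; case: eqP => [->|]; last by rewrite !mul0r mulr0.
by rewrite factS natrM exprS; ring.
Qed.

(** Each slot of [y] is paired with [z] (operator [A]) or with [t] (operator [B]). The two operators
    commute, so the binomial formula applies, and what remains is the orthogonality
    [hermite4_n00n]. *)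
Lemma hermite4_n0nn y x z t b c n : hermite4 y x z t b 0 c n =
  \sum_(i < b.+1) 'C(b, i)%:R * ((c ^_ i)%:R * ip y z ^+ i) *
    ((n ^_ (b - i))%:R * ip y t ^+ (b - i)) *
    ((c - i == n - (b - i))%N%:R * (c - i)`!%:R * ip z t ^+ (c - i)).
Proof.
pose A (f : nat * nat -> R) s := s.1%:R * ip y z * f (s.1.-1, s.2).
pose B (f : nat * nat -> R) s := s.2%:R * ip y t * f (s.1, s.2.-1).
rewrite (@iter_addop R (nat * nat) A B (fun b s => hermite4 y x z t b 0 s.1 s.2) _ _ _ _ b (c, n)).
- apply: eq_bigr => i _.
  have pr1 k s : iter k (fun s : nat * nat => (s.1.-1, s.2)) s = (s.1 - k, s.2)%N.
    by elim: k => [|k IH] /=; [rewrite subn0; case: s|rewrite IH/= subnS].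
  have pr2 k s : iter k (fun s : nat * nat => (s.1, s.2.-1)) s = (s.1, s.2 - k)%N.
    by elim: k => [|k IH] /=; [rewrite subn0; case: s|rewrite IH/= subnS].
  rewrite /A (iter_ff (n := fst) (pr := fun s => (s.1.-1, s.2)))// pr1/=.
  rewrite /B (iter_ff (n := snd) (pr := fun s => (s.1, s.2.-1)))// pr2/=.
  rewrite -(hermite4_n00n z x y t).
  have -> : hermite4 y x z t 0 0 (c - i) (n - (b - i)) = hermite4 z x y t (c - i) 0 0 (n - (b - i)).
    by apply: eq_Ex => w; rewrite /= !hornerC; ring.
  ring.
- by move=> k e f s; exact: linop.
- by move=> k e f s; exact: linop.
- by move=> f; apply/funext => s; rewrite /A /B/=; ring.
- by move=> a s; rewrite hermite4S !mul0r add0r.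
Qed.

(** Among the [a] slots of [x], [i] are paired with [y], [j] with [z] and the rest with [t]. The
    three lowering operators commute, and the binomial formula is applied twice. *)
Lemma hermite4_expand x y z t a b c n : hermite4 x y z t a b c n =
  \sum_(i < a.+1) \sum_(j < (a - i).+1) 'C(a, i)%:R * 'C(a - i, j)%:R *
    ((b ^_ i)%:R * ip x y ^+ i) * ((c ^_ j)%:R * ip x z ^+ j) *
    ((n ^_ (a - i - j))%:R * ip x t ^+ (a - i - j)) *
    hermite4 y x z t (b - i) 0 (c - j) (n - (a - i - j)).
Proof.
pose A (f : nat * nat * nat -> R) s := s.1.1%:R * ip x y * f (s.1.1.-1, s.1.2, s.2).
pose B (f : nat * nat * nat -> R) s := s.1.2%:R * ip x z * f (s.1.1, s.1.2.-1, s.2).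
pose C (f : nat * nat * nat -> R) s := s.2%:R * ip x t * f (s.1.1, s.1.2, s.2.-1).
pose BC f s := B f s + C f s.
pose g a s := hermite4 x y z t a s.1.1 s.1.2 s.2.
have linB k (e : 'I_k -> R) (f : 'I_k -> nat * nat * nat -> R) s :
  B (fun s => \sum_(i < k) e i * f i s) s = \sum_(i < k) e i * B (f i) s by exact: linop.
have linC k (e : 'I_k -> R) (f : 'I_k -> nat * nat * nat -> R) s :
  C (fun s => \sum_(i < k) e i * f i s) s = \sum_(i < k) e i * C (f i) s by exact: linop.
rewrite -[LHS]/(g a (b, c, n)) (@iter_addop R (nat * nat * nat) A BC g _ _ _ _ a (b, c, n)).
- apply: eq_bigr => i _.
  have pr1 k s : iter k (fun s : nat * nat * nat => (s.1.1.-1, s.1.2, s.2)) s = (s.1.1 - k, s.1.2, s.2)%N.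
    by elim: k => [|k IH] /=; [rewrite subn0; case: s => [[]]|rewrite IH/= subnS].
  have pr2 k s : iter k (fun s : nat * nat * nat => (s.1.1, s.1.2.-1, s.2)) s = (s.1.1, s.1.2 - k, s.2)%N.
    by elim: k => [|k IH] /=; [rewrite subn0; case: s => [[]]|rewrite IH/= subnS].
  have pr3 k s : iter k (fun s : nat * nat * nat => (s.1.1, s.1.2, s.2.-1)) s = (s.1.1, s.1.2, s.2 - k)%N.
    by elim: k => [|k IH] /=; [rewrite subn0; case: s => [[]]|rewrite IH/= subnS].
  rewrite /A (iter_ff (n := fun s => s.1.1) (pr := fun s => (s.1.1.-1, s.1.2, s.2)))// pr1/=.
  rewrite (@iter_addop R (nat * nat * nat) B C (fun k => iter k BC (g 0)) _ _ _ _ (a - i) _) //.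
  + rewrite !mulr_sumr; apply: eq_bigr => j _.
    rewrite /B (iter_ff (n := fun s => s.1.2) (pr := fun s => (s.1.1, s.1.2.-1, s.2)))// pr2/=.
    rewrite /C (iter_ff (n := snd) (pr := fun s => (s.1.1, s.1.2, s.2.-1)))// pr3/=.
    have -> : g 0 (b - i, c - j, n - (a - i - j))%N =
        hermite4 y x z t (b - i) 0 (c - j) (n - (a - i - j)).
      by apply: eq_Ex => w; rewrite /= !hornerC; ring.
    ring.
  + by move=> f; apply/funext => s; rewrite /B /C/=; ring.
- by move=> k e f s; exact: linop.
- move=> k e f s; rewrite /BC linB linC -big_split/=; apply: eq_bigr => i _; ring.
- by move=> f; apply/funext => s; rewrite /A /BC /B /C/=; ring.
- by move=> k s; rewrite /g hermite4S /A /BC /B /C; ring.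
Qed.

(** Counting slots leaves a single diagram: [p - i - j] pairings of [y] with [z], [j] of [y] with
    [t], and [i] of [z] with [t]. Every other term has unequal remaining degrees. *)
Lemma hermite4_0nnn y x z t (p i j : nat) : (i + j <= p)%N ->
  hermite4 y x z t (p - i) 0 (p - j) (i + j) =
  (p - i)`!%:R * (p - j)`!%:R * (i + j)`!%:R / (i`!%:R * j`!%:R * (p - i - j)`!%:R) *
   (ip z t ^+ i * ip y t ^+ j * ip y z ^+ (p - i - j)).
Proof.
move=> ijp; have [l lE] : exists l, (p = i + j + l)%N by exists (p - i - j)%N; lia.
have -> : (p - i - j = l)%N by lia.
have -> : (p - i = j + l)%N by lia.
have -> : (p - j = i + l)%N by lia.
have li : (l < (j + l).+1)%N by lia.
rewrite hermite4_n0nn (bigD1 (Ordinal li))//= big1 ?addr0 => [|k kl]; last first.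
  have nkl : nat_of_ord k != l by apply: contraNneq kl => kl; apply/eqP/val_inj.
  rewrite (_ : (_ == _) = false) ?mul0r ?mulr0//; apply/negbTE.
  by move: nkl (ltn_ord k); move: (nat_of_ord k) => k'; lia.
rewrite !addnK eqxx mul1r.
have fn (a : nat) : a`!%:R != 0 :> R := fact_neq0 a.
have := bin_fact (leq_addl j l); rewrite addnK => <-.
have := ffact_fact (leq_addl i l); rewrite addnK => <-.
have := ffact_fact (leq_addl i j); rewrite addnK => <-.
rewrite !natrM; field.
by rewrite !fn.
Qed.

(** In a pairing diagram on four vertices of degree [p], opposite edges have equal multiplicities:
    here [k] for [xy] and [zt], [j] for [xz] and [yt], [p - k - j] for [xt] and [yz]. The factorials
    are grouped so as to match [tdot_cpow]. *)
Lemma hermite4_diag x y z t p : hermite4 x y z t p p p p =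
  \sum_(k < p.+1) k`!%:R ^+ 2 * 'C(p, k)%:R ^+ 4 *
    ((ip x y * ip z t) ^+ k * (p - k)`!%:R ^+ 2 *
     \sum_(j < (p - k).+1) 'C(p - k, j)%:R ^+ 2 * (ip x z * ip y t) ^+ j *
       (ip x t * ip y z) ^+ (p - k - j)).
Proof.
rewrite hermite4_expand; apply: eq_bigr => i _; rewrite !mulr_sumr; apply: eq_bigr => j _.
have ip1 : (i <= p)%N by rewrite -ltnS.
have jp1 : (j <= p - i)%N by rewrite -ltnS.
move: (nat_of_ord i) (nat_of_ord j) ip1 jp1 => {}i {}j ip1 jp1.
have -> : (p - (p - i - j) = i + j)%N by lia.
rewrite hermite4_0nnn; last by lia.
have [l lE] : exists l, (p = i + j + l)%N by exists (p - i - j)%N; lia.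
have pl : (p - i - j = l)%N by lia.
have pjl : (p - i = j + l)%N by lia.
have fn (a : nat) : a`!%:R != 0 :> R := fact_neq0 a.
have h1 := bin_fact ip1; have h2 := bin_fact jp1.
have h3 := ffact_fact ip1; have h4 : (p ^_ j * (p - j)`! = p`!)%N by apply: ffact_fact; lia.
have h5 : (p ^_ (p - i - j) * (i + j)`! = p`!)%N.
  by rewrite -(ffact_fact (m := p - i - j) (n := p)); [congr (_ * _`!)%N; lia|lia].
rewrite pl in h2 h5 *.
have eC : 'C(p, i)%:R = p`!%:R / (i`!%:R * (p - i)`!%:R) :> R.
  by rewrite -h1 natrM natrM mulfK// mulf_neq0.
have eC2 : 'C(p - i, j)%:R = (p - i)`!%:R / (j`!%:R * l`!%:R) :> R.
  by rewrite -h2 natrM natrM mulfK// mulf_neq0.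
have e3 : (p ^_ i)%:R = p`!%:R / (p - i)`!%:R :> R by rewrite -h3 natrM mulfK.
have e4 : (p ^_ j)%:R = p`!%:R / (p - j)`!%:R :> R by rewrite -h4 natrM mulfK.
have e5 : (p ^_ l)%:R = p`!%:R / (i + j)`!%:R :> R by rewrite -h5 natrM mulfK.
rewrite eC eC2 e3 e4 e5 !exprMn (ipC ip y z); field.
by rewrite !fn.
Qed.

Lemma Ex_hermite2 x y a b :
  Ex (fun w => hx x a w * hx y b w) = (a == b)%:R * a`!%:R * ip x y ^+ a.
Proof.
rewrite -(hermite4_n00n x x x y); apply: eq_Ex => w; rewrite /= !hornerC; ring.
Qed.

End hermite_products.

(** * Multiple integrals of finite sums of tensor powers *)

Section scalar_product.
Context {R : realType} {H : completeNormedModType R} (ip : {dot H for idfun}).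
Implicit Types x y z : H.

Lemma ipDl x y z : ip (x + y) z = ip x z + ip y z. Proof. exact: linearDl. Qed.
Lemma ipDr x y z : ip x (y + z) = ip x y + ip x z. Proof. by rewrite linearD. Qed.
Lemma ipZl a x y : ip (a *: x) y = a * ip x y. Proof. exact: linearZl_LR. Qed.
Lemma ipZr a x y : ip x (a *: y) = a * ip x y. Proof. by rewrite ipC ipZl ipC. Qed.
Lemma ipNl x y : ip (- x) y = - ip x y. Proof. by rewrite -scaleN1r ipZl mulN1r. Qed.
Lemma ipNr x y : ip x (- y) = - ip x y. Proof. by rewrite ipC ipNl ipC. Qed.
Lemma ipBl x y z : ip (x - y) z = ip x z - ip y z. Proof. by rewrite ipDl ipNl. Qed.
Lemma ipBr x y z : ip x (y - z) = ip x y - ip x z. Proof. by rewrite ipDr ipNr. Qed.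
Lemma ip0l x : ip 0 x = 0. Proof. by rewrite -[0 in LHS](scale0r (0 : H)) ipZl mul0r. Qed.

Lemma ip_suml (A : Type) (s : seq A) (Q : pred A) (E : A -> H) y :
  ip (\sum_(a <- s | Q a) E a) y = \sum_(a <- s | Q a) ip (E a) y.
Proof. exact: linear_sumlz. Qed.

Lemma ip_sumr (A : Type) (s : seq A) (E : A -> H) y :
  ip y (\sum_(a <- s) E a) = \sum_(a <- s) ip y (E a).
Proof. by rewrite ipC ip_suml; apply: eq_bigr => a _; rewrite ipC. Qed.

Hypothesis hip : hilbert_product ip.

Lemma ip_ge0 x : 0 <= ip x x. Proof. by rewrite -hip sqr_ge0. Qed.

Lemma ip_le x y : `|ip x y| <= `|x| * `|y|.
Proof.
rewrite -ler_sqr ?nnegrE ?mulr_ge0// exprMn !hip real_normK ?num_real//.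
have [y0|y0] := eqVneq (ip y y) 0.
  have -> : y = 0 by apply/normr0_eq0/eqP; rewrite -sqrf_eq0 hip y0.
  by rewrite ipC !ip0l mulr0 expr0n.
have := ip_ge0 (ip y y *: x - ip x y *: y).
rewrite ipBl !ipBr !ipZl !ipZr (ipC ip y x).
rewrite (_ : _ - _ = ip y y * (ip x x * ip y y - ip x y ^+ 2)); last by ring.
by rewrite pmulr_rge0 ?subr_ge0// lt_def y0 ip_ge0.
Qed.

Lemma cvg_ipr (u : nat -> H) x y : u n @[n --> \oo] --> x -> ip (u n) y @[n --> \oo] --> ip x y.
Proof.
move=> ux; apply/cvgrPdist_lt => eps e0.
have c0 : 0 < `|y| + 1 by rewrite ltr_wpDl.
have /cvgrPdist_lt/(_ (eps / (`|y| + 1))) := ux; rewrite divr_gt0// => /(_ isT).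
apply: filterS => n h; rewrite -ipBl; apply: le_lt_trans (ip_le _ _) _.
apply: (@le_lt_trans _ _ (`|x - u n| * (`|y| + 1))); first by rewrite ler_wpM2l// lerDl.
by rewrite -ltr_pdivlMr.
Qed.

End scalar_product.

(** * Parseval's formula, and the Gram determinant as a limit of sums of squared minors *)

Section parseval.
Context {R : realType} {H : completeNormedModType R} (ip : {dot H for idfun}).
Variable e : nat -> H.
Hypothesis hip : hilbert_product ip.
Hypothesis he : complete_orthonormal ip e.
Implicit Types x y z : H.

Definition coords x : nat -> R := fun a => ip x (e a).

Lemma bessel x (s : seq nat) : uniq s -> \sum_(a <- s) coords x a ^+ 2 <= ip x x.
Proof.
move=> us; have := ip_ge0 hip (x - \sum_(a <- s) coords x a *: e a).
have h y : ip y (\sum_(a <- s) coords x a *: e a) = \sum_(a <- s) coords x a * coords y a.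
  by rewrite ip_sumr; apply: eq_bigr => a _; rewrite ipZr.
rewrite ipBl !ipBr [ip (\sum_(_ <- _) _) x]ipC !h.
rewrite [X in _ - X](_ : _ = 0) ?subr0 => [|].
  by rewrite subr_ge0.
apply/eqP; rewrite subr_eq0 big_seq [X in _ == X]big_seq; apply/eqP; apply: eq_bigr => a sa.
congr (_ * _); rewrite [RHS]/coords ip_suml (bigD1_seq a)//= ipZl (he.1) eqxx mulr1.
by rewrite big1 ?addr0// => b ba; rewrite ipZl he.1 (negbTE ba) mulr0.
Qed.

Lemma l2_coords x : l2 (coords x).
Proof.
apply: (@asumP _ _ _ (ip x x)) => s us; apply: le_trans (bessel x us).
by apply: ler_sum => a _; rewrite ger0_norm ?sqr_ge0.
Qed.

Lemma norm_sqr_partial x m n :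
  ip (\sum_(m <= k < n) coords x k *: e k) (\sum_(m <= k < n) coords x k *: e k) =
  \sum_(m <= k < n) coords x k ^+ 2.
Proof.
rewrite ip_sumr big_seq [RHS]big_seq; apply: eq_bigr => a; rewrite mem_index_iota => amn.
rewrite ipZr ip_suml (bigD1_seq a)/= ?iota_uniq ?mem_index_iota//.
rewrite ipZl he.1 eqxx mulr1 big1 ?addr0 ?expr2// => b ba.
by rewrite ipZl he.1 (negbTE ba) mulr0.
Qed.

Lemma cvg_sum_coords_sqr x : cvgn (series (fun k => coords x k ^+ 2)).
Proof.
apply: nondecreasing_is_cvgn.
  by apply/nondecreasing_seqP => n; rewrite /series/= big_nat_recr//= lerDl sqr_ge0.
exists (ip x x) => _ [n _ <-]; rewrite /series/=.
by rewrite (bessel x)// iota_uniq.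
Qed.

(** Bessel's inequality makes the series Cauchy. Its limit has the same coordinates as [x], and the
    completeness of [e] identifies the two. *)
Lemma cvg_expansion x : series (fun k => coords x k *: e k) @ \oo --> x.
Proof.
have hc : cvgn (series (fun k => coords x k *: e k)).
  apply/cauchy_cvgP/cauchy_seriesP => eps e0.
  have /cauchy_cvgP/cauchy_seriesP/(_ (eps ^+ 2)) := @cvg_sum_coords_sqr x.
  rewrite exprn_gt0// => /(_ isT); apply: filterS => -[m n]/= h.
  rewrite -(@ltr_pXn2r _ 2)// ?nnegrE//; last exact: ltW.
  rewrite hip norm_sqr_partial; exact: le_lt_trans (ler_norm _) h.
suff lx : limn (series (fun k => coords x k *: e k)) = x by rewrite -[X in _ --> X]lx.
apply/eqP; rewrite -subr_eq0; apply/eqP/he.2 => j.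
set y := limn _.
have hj : (fun n => ip (series (fun k => coords x k *: e k) n) (e j)) @ \oo --> ip y (e j).
  apply/cvgrPdist_lt => eps e0.
  have /cvgrPdist_lt/(_ eps e0) : series (fun k => coords x k *: e k) @ \oo --> y by [].
  apply: filterS => n; rewrite -ipBl => h; apply: le_lt_trans (ip_le hip _ _) _.
  have -> : `|e j| = 1.
    by apply/eqP; rewrite -(@eqrXn2 _ 2)// hip he.1 eqxx expr1n.
  by rewrite mulr1.
have : ip y (e j) = ip x (e j).
  apply: (cvg_unique _ hj) => //; apply: (@cvg_near_cst _ _ _ _ _ _); exists j.+1 => //= n jn.
  rewrite /series/= ip_suml (bigD1_seq j)/= ?iota_uniq ?mem_index_iota//.
  rewrite ipZl he.1 eqxx mulr1 big1 ?addr0// => b bj.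
  by rewrite ipZl he.1 (negbTE bj) mulr0.
by rewrite ipBl => ->; rewrite subrr.
Qed.

Lemma cvg_parseval x : series (fun k => coords x k ^+ 2) @ \oo --> ip x x.
Proof.
have h : (fun n => `|series (fun k => coords x k *: e k) n| ^+ 2) @ \oo --> `|x| ^+ 2.
  rewrite expr2; under eq_fun do rewrite expr2.
  by apply: cvgM; apply: cvg_norm; exact: cvg_expansion.
rewrite hip in h; apply: cvg_trans h; apply: near_eq_cvg; near=> n.
by rewrite hip /series/= norm_sqr_partial.
Unshelve. all: by end_near. Qed.

Lemma cvg_parseval2 x y : series (fun k => coords x k * coords y k) @ \oo --> ip x y.
Proof.
have -> : ip x y = (ip (x + y) (x + y) - ip x x - ip y y) / 2.
  by rewrite ipDl !ipDr (ipC ip y x); field.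
have h : (fun n => (series (fun k => coords (x + y) k ^+ 2) n - series (fun k => coords x k ^+ 2) n
      - series (fun k => coords y k ^+ 2) n) / 2) @ \oo -->
    (ip (x + y) (x + y) - ip x x - ip y y) / 2.
  apply: cvgMl; apply: cvgB; last exact: cvg_parseval.
  by apply: cvgB; exact: cvg_parseval.
apply: cvg_trans h; apply: near_eq_cvg; near=> n.
rewrite /series/= -!sumrB mulr_suml; apply: eq_bigr => k _.
by rewrite /coords ipDl; field.
Unshelve. all: by end_near. Qed.

(** [sdot] is an unordered sum, whereas [cvg_parseval] is about a limit of ordered ones. They agree
    on squares, whose terms are nonnegative, and polarization gives the rest. *)
Lemma sdot_coords x y : sdot (coords x) (coords y) = ip x y.
Proof.
have q z : sdot (coords z) (coords z) = ip z z.
  have az : asum (fun a => coords z a * coords z a) by apply: asum_mul; exact: l2_coords.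
  apply/eqP; rewrite eq_le; apply/andP; split.
    apply: tsum_le_seq => [a|s us]; first by rewrite -expr2 sqr_ge0.
    by under eq_bigr do rewrite -expr2; exact: bessel.
  rewrite -(cvg_lim _ (@cvg_parseval z))//; apply: limr_le; first exact: cvg_sum_coords_sqr.
  near=> n; rewrite /series/=; under eq_bigr do rewrite expr2.
  apply: (@tsum_ge_seq _ _ (fun a => coords z a * coords z a)) => // [a|].
    by rewrite -expr2 sqr_ge0.
  by rewrite iota_uniq.
have -> : ip x y = (ip (x + y) (x + y) - ip x x - ip y y) / 2.
  by rewrite ipDl !ipDr (ipC ip y x); field.
have az z z' : asum (fun a => coords z a * coords z' a) by apply: asum_mul; exact: l2_coords.
rewrite -!q /sdot -!tsumB//; last exact: asumB.
rewrite mulrC -tsumZ; last by apply: asumB => //; exact: asumB.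
by apply: eq_tsum => a; rewrite /coords ipDl; field.
Unshelve. all: by end_near. Qed.

Lemma lagrange_identity (X Y : nat -> R) n :
  2^-1 * \sum_(0 <= i < n) \sum_(0 <= l < n) (X i * Y l - X l * Y i) ^+ 2 =
  (\sum_(0 <= i < n) X i ^+ 2) * (\sum_(0 <= i < n) Y i ^+ 2) -
  (\sum_(0 <= i < n) X i * Y i) ^+ 2.
Proof.
have e1 i l : (X i * Y l - X l * Y i) ^+ 2 = X i ^+ 2 * Y l ^+ 2 + Y i ^+ 2 * X l ^+ 2
   - 2 * ((X i * Y i) * (X l * Y l)) by ring.
under eq_bigr => i _ do (under eq_bigr do rewrite e1; rewrite sumrB big_split/=
   -!mulr_sumr).
rewrite sumrB big_split/= -!mulr_suml -mulr_sumr -mulr_suml.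
by field.
Qed.

Lemma cvg_gram_det x y :
  (fun n => 2^-1 * \sum_(0 <= i < n) \sum_(0 <= l < n)
     (coords x i * coords y l - coords x l * coords y i) ^+ 2) @ \oo -->
  ip x x * ip y y - ip x y ^+ 2.
Proof.
under eq_fun do rewrite lagrange_identity.
apply: cvgB; first by apply: cvgM; exact: cvg_parseval.
rewrite expr2; under eq_fun do rewrite expr2.
by apply: cvgM; exact: cvg_parseval2.
Qed.

End parseval.

Section chaos.
Context {R : realType} {H : completeNormedModType R}.
Context {d : measure_display} {Omega : measurableType d}.
Variables (P : probability Omega R) (ip : {dot H for idfun}) (e : nat -> H).
Variable W : H -> Omega -> R.
Hypotheses (hip : hilbert_product ip) (he : complete_orthonormal ip e).
Hypothesis hW : isonormal P ip W.
Local Notation Ex := (Ex P).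
Local Notation moments := (moments P).
Local Notation coords := (coords ip e).
Local Notation hx p x := (fun w => (hermiteh (ip x x) p).[W x w]).

(* A finite list [(c_a, x_a)] stands for [\sum_a c_a x_a^{\otimes p}] and for the
   multiple integral of this tensor. *)
Definition chaos p (s : seq (R * H)) (w : Omega) : R :=
  \sum_(a <- s) a.1 * (hermiteh (ip a.2 a.2) p).[W a.2 w].

Definition ftensor p (s : seq (R * H)) : tensor R p :=
  lincomb s fst (fun a => tpow (coords a.2) p).

Arguments ftensor : clear implicits.

(** Malliavin derivative of [chaos p.+1 s]: the Hermite polynomial of order [p.+1] has derivative
    [p.+1] times that of order [p]. The parameter is thus one less than the order of the chaos. *)
Definition grad p (s : seq (R * H)) (w : Omega) : H :=
  \sum_(a <- s) (a.1 * (p.+1%:R * (hermiteh (ip a.2 a.2) p).[W a.2 w])) *: a.2.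

Definition opp_form (s : seq (R * H)) := [seq (- a.1, a.2) | a <- s].

Definition slice_form p i (s : seq (R * H)) :=
  [seq (p.+1%:R * (a.1 * ip a.2 (e i)), a.2) | a <- s].

(** The list given by the polarization of [trunc M u], each [subset_sum] being realized by a vector
    of [H]. *)
Definition trunc_form n M (u : tensor R n) : seq (R * H) :=
  [seq (trunc_coef u a, \sum_(l in a.2) e (tnth a.1 l)) | a <- trunc_index n M].

Lemma l2_ftensor p s : l2 (ftensor p s).
Proof. by apply: l2_lincomb => a; apply: l2_tpow; exact: l2_coords. Qed.

Lemma moments_hermite p x : moments (hx p x).
Proof. exact: (moments_horner hW). Qed.

Lemma moments_chaos p s : moments (chaos p s).
Proof. by apply: moments_sum => a; apply: momentsZ; exact: moments_hermite. Qed.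

(** The constant in front of the norm in [T_k], for [m = p + 1]. *)
Definition chaos_coef (p k : nat) : R :=
  k`!%:R ^+ 2 * 'C(p, k)%:R ^+ 4 * (p + p - k.*2)`!%:R.

(** Both sides are quadrilinear in the lists. For single tensor powers they coincide by
    [hermite4_diag] and [tdot_cpow], the factorial of [p + p - k.*2] being the [N!] of the
    latter. *)
Lemma Ex_chaos4 p s1 s2 s3 s4 :
  Ex (fun w => chaos p s1 w * (chaos p s2 w * (chaos p s3 w * chaos p s4 w))) =
  \sum_(k < p.+1) chaos_coef p k *
    tdot (tcontract_sym k (ftensor p s1) (ftensor p s2))
         (tcontract_sym k (ftensor p s3) (ftensor p s4)).
Proof.
have l2c x : l2 (tpow (coords x) p) by apply: l2_tpow; exact: l2_coords.
rewrite (quadlinear_expand (Q := fun u v w z => \sum_(k < p.+1) chaos_coef p k *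
  tdot (tcontract_sym k u v) (tcontract_sym k w z)))//; last first.
  apply: quadlinear_sum => -[k /= kp]; apply: quadlinear_tdot; exact: tcontract_sym_bilinear.
have e1 (X : Omega -> R) s : moments X -> Ex (fun w => chaos p s w * X w) =
    \sum_(a <- s) a.1 * Ex (fun w => hx p a.2 w * X w).
  move=> nX; rewrite (eq_Ex P (Y := fun w => \sum_(a <- s) a.1 * (hx p a.2 w * X w))).
    rewrite Ex_sum => [|a]; last by apply: momentsZ; apply: momentsM => //; exact: moments_hermite.
    apply: eq_bigr => a _; rewrite ExZ//; apply: momentsM => //; exact: moments_hermite.
  by move=> w; rewrite /chaos mulr_suml; apply: eq_bigr => a _; rewrite mulrA.
have nc := moments_chaos p; have nh := moments_hermite p.
rewrite e1; last by do 2![apply: momentsM => //].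
apply: eq_bigr => a1 _; congr (_ * _).
under eq_Ex do rewrite mulrCA.
rewrite e1; last by do 2![apply: momentsM => //].
apply: eq_bigr => a2 _; congr (_ * _).
rewrite (eq_Ex P (Y := fun w => chaos p s3 w * (hx p a1.2 w * (hx p a2.2 w * chaos p s4 w)))); last first.
  by move=> w; ring.
rewrite e1; last by do 2![apply: momentsM => //].
apply: eq_bigr => a3 _; congr (_ * _).
rewrite (eq_Ex P (Y := fun w => chaos p s4 w * (hx p a1.2 w * (hx p a2.2 w * hx p a3.2 w)))); last first.
  by move=> w; ring.
rewrite e1; last by do 2![apply: momentsM => //].
apply: eq_bigr => a4 _; congr (_ * _).
have := hermite4_diag hW a1.2 a2.2 a3.2 a4.2 p; rewrite /hermite4 => h.
rewrite (eq_Ex P (Y := fun w => hx p a1.2 w * (hx p a2.2 w * (hx p a3.2 w * hx p a4.2 w)))); last first.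
  by move=> w; ring.
rewrite h; apply: eq_bigr => -[k /= kp] _; rewrite /chaos_coef -[RHS]mulrA; congr (_ * _).
by rewrite (tdot_cpow (kp : (k <= p)%N)) ?sdot_coords//; exact: l2_coords.
Qed.

(** The second moment of a combination of products of two chaoses depends only on the same
    combination of contractions. This serves for the minors of the approximating gradients and for
    the difference of two such minors. *)
Lemma Ex_chaos_pairs p (A : Type) (q : seq A) (c : A -> R) (u v : A -> seq (R * H)) :
  Ex (fun w => (\sum_(a <- q) c a * (chaos p (u a) w * chaos p (v a) w)) ^+ 2) =
  \sum_(k < p.+1) chaos_coef p k *
    tdot (lincomb q c (fun a => tcontract_sym k (ftensor p (u a)) (ftensor p (v a))))
         (lincomb q c (fun a => tcontract_sym k (ftensor p (u a)) (ftensor p (v a)))).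
Proof.
have nc := moments_chaos p.
have l2t k a : (k < p.+1)%N -> l2 (tcontract_sym k (ftensor p (u a)) (ftensor p (v a))).
  by rewrite ltnS => kp; apply: l2_tcontract_sym => //; exact: l2_ftensor.
transitivity (\sum_(a <- q) \sum_(b <- q) c a * (c b *
  Ex (fun w => chaos p (u a) w * (chaos p (v a) w * (chaos p (u b) w * chaos p (v b) w))))).
  rewrite (eq_Ex P (Y := fun w => \sum_(a <- q) \sum_(b <- q) c a * (c b *
    (chaos p (u a) w * (chaos p (v a) w * (chaos p (u b) w * chaos p (v b) w)))))).
    have n4 a b : moments (fun w => chaos p (u a) w * (chaos p (v a) w * (chaos p (u b) w * chaos p (v b) w))).
      by do 3![apply: momentsM => //].
    rewrite Ex_sum => [|a]; last by apply: moments_sum => b; do 2![apply: momentsZ].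
    apply: eq_bigr => a _; rewrite Ex_sum => [|b]; last by do 2![apply: momentsZ].
    by apply: eq_bigr => b _; rewrite !ExZ//; exact: momentsZ.
  move=> w; rewrite expr2 mulr_suml; apply: eq_bigr => a _.
  by rewrite mulr_sumr; apply: eq_bigr => b _; ring.
under eq_bigr do under eq_bigr do rewrite Ex_chaos4 !mulr_sumr.
under eq_bigr do rewrite exchange_big/=.
rewrite exchange_big/=; apply: eq_bigr => -[k /= kp] _.
rewrite tdot_lincombl => [|a|]; [|exact: l2t|by apply: l2_lincomb => a; exact: l2t].
rewrite mulr_sumr; apply: eq_bigr => a _.
rewrite [tdot _ (lincomb _ _ _)]tdotC tdot_lincombl => [|b|]; [|exact: l2t|exact: l2t].
by rewrite !mulr_sumr; apply: eq_bigr => b _; rewrite [tdot _ (tcontract_sym _ (ftensor p (u a)) _)]tdotC; ring.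
Qed.

Lemma grad_cat p s t w : grad p (s ++ t) w = grad p s w + grad p t w.
Proof. by rewrite /grad big_cat. Qed.

Lemma grad_opp p s w : grad p (opp_form s) w = - grad p s w.
Proof. by rewrite /grad big_map -sumrN; apply: eq_bigr => a _; rewrite mulNr scaleNr. Qed.

Lemma ftensor_sub p s t : ftensor p (s ++ opp_form t) = ftensor p s \- ftensor p t.
Proof.
apply/funext => j; rewrite /ftensor /lincomb big_cat big_map/= -sumrN; congr (_ + _).
by apply: eq_bigr => a _; rewrite mulNr.
Qed.

Lemma ip_grad p s w i : ip (grad p s w) (e i) = chaos p (slice_form p i s) w.
Proof.
rewrite /grad ip_suml /chaos big_map; apply: eq_bigr => a _; rewrite ipZl/=; ring.
Qed.

Lemma ftensor_slice p i s : ftensor p (slice_form p i s) = slice (ftensor p.+1 s) i.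
Proof.
apply/funext => j; rewrite /ftensor /slice /lincomb big_map mulr_sumr; apply: eq_bigr => a _ /=.
rewrite (tpow_totuple (coords a.2) (s := i :: j)) ?big_cons/= ?size_tuple//.
by rewrite /tpow {2}/coords; ring.
Qed.

(** By orthogonality of Hermite polynomials, E|DF|^2 = m m! |f|^2; through this formula, convergence
    of tensors becomes convergence of gradients. *)
Lemma Ex_grad2 p s : Ex (fun w => ip (grad p s w) (grad p s w)) =
  p.+1%:R * p.+1`!%:R * tdot (ftensor p.+1 s) (ftensor p.+1 s).
Proof.
have l2c x : l2 (tpow (coords x) p.+1) by apply: l2_tpow; exact: l2_coords.
have nh := moments_hermite p.
rewrite tdot_lincombl//; last exact: l2_ftensor.
rewrite (eq_Ex P (Y := fun w => \sum_(a <- s) \sum_(b <- s) a.1 * (b.1 * (p.+1%:R ^+ 2 * ip a.2 b.2 * (hx p a.2 w * hx p b.2 w))))).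
  have n2 a b : moments (fun w => p.+1%:R ^+ 2 * ip a b * (hx p a w * hx p b w)) by apply: momentsZ; exact: momentsM.
  rewrite Ex_sum => [|a]; last by apply: moments_sum => b; do 2![apply: momentsZ].
  rewrite mulr_sumr; apply: eq_bigr => a _; rewrite Ex_sum => [|b]; last by do 2![apply: momentsZ].
  rewrite tdotC tdot_lincombl//; rewrite mulrCA !mulr_sumr; apply: eq_bigr => b _.
  rewrite !ExZ//; [|exact: momentsM|exact: momentsZ].
  rewrite (Ex_hermite2 hW) eqxx mul1r tdot_tpow ?sdot_coords//; last exact: l2_coords; last exact: l2_coords.
  by rewrite (ipC ip b.2) factS natrM [_ ^+ p.+1]exprS; ring.
move=> w; rewrite /grad ip_suml; apply: eq_bigr => a _.
by rewrite ip_sumr; apply: eq_bigr => b _; rewrite ipZl ipZr; ring.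
Qed.

Lemma moments_grad2 p s : moments (fun w => ip (grad p s w) (grad p s w)).
Proof.
have -> : (fun w => ip (grad p s w) (grad p s w)) = fun w => \sum_(a <- s) \sum_(b <- s)
   (a.1 * (b.1 * (p.+1%:R ^+ 2 * ip a.2 b.2))) * (hx p a.2 w * hx p b.2 w).
  apply/funext => w; rewrite /grad ip_suml; apply: eq_bigr => a _.
  by rewrite ip_sumr; apply: eq_bigr => b _; rewrite ipZl ipZr; ring.
by do 2![apply: moments_sum => ?]; apply: momentsZ; apply: momentsM; exact: moments_hermite.
Qed.

Lemma moments_ip_grad p s y : moments (fun w => ip (grad p s w) y).
Proof.
have -> : (fun w => ip (grad p s w) y) = fun w => \sum_(a <- s)
   (a.1 * (p.+1%:R * ip a.2 y)) * hx p a.2 w.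
  apply/funext => w; rewrite /grad ip_suml; apply: eq_bigr => a _; rewrite ipZl; ring.
by apply: moments_sum => ?; apply: momentsZ; exact: moments_hermite.
Qed.

Lemma ftensor_trunc n M (u : tensor R n) : symmetric_tensor u ->
  ftensor n (trunc_form M u) = trunc M u.
Proof.
move=> su; rewrite truncE//; apply/funext => j; rewrite /ftensor /lincomb big_map.
apply: eq_bigr => a _; congr (_ * _).
rewrite (_ : coords _ = subset_sum a.1 a.2)//; apply/funext => b /=.
rewrite /coords ip_suml; apply: eq_bigr => l _; exact: he.1.
Qed.

(** For [i >= M] the left side is zero; truncation levels used with a given slice must therefore
    exceed its index. *)
Lemma slice_trunc p M (u : tensor R p.+1) i : (i < M)%N ->
  slice (trunc M u) i = trunc M (slice u i : tensor R p).
Proof.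
move=> iM; apply/funext => j; rewrite /slice /trunc.
have -> : all (ltn^~ M) (totuple p.+1 (i :: j)) = all (ltn^~ M) j.
  by rewrite totupleK/= ?size_tuple// iM.
by case: ifP => // _; rewrite mulr0.
Qed.

End chaos.
Arguments ftensor {R H} ip e p s _.

(** * The Malliavin derivative of a multiple integral *)

Section smooth_polynomials.
Context {R : realType}.
Variable n : nat.
Implicit Types (v : 'rV[R]_n) (p : 'I_n -> {poly R}) (i k : 'I_n).

(** Sums of one-variable polynomials in the coordinates are enough to express a chaos, and partial
    derivatives stay in the class, so smoothness follows by induction on the list of derivatives. *)
Definition sum_horner p v : R := \sum_(k < n) (p k).[v 0 k].

Lemma is_derive_coord v i k :
  is_derive v (delta_mx 0 i : 'rV[R]_n) (fun u : 'rV[R]_n => u 0 k) (i == k)%:R.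
Proof.
have dc := @differentiable_coord R 1 n v 0 k.
apply: DeriveDef; first exact: diff_derivable.
rewrite deriveE//.
have -> : 'd (fun u : 'rV[R]_n => u 0 k) v = (fun u : 'rV[R]_n => u 0 k) :> ('rV[R]_n -> R).
  have lf : linear (fun u : 'rV[R]_n => u 0 k : R^o) by move=> a x y; rewrite !mxE.
  pose f : {linear 'rV[R]_n -> R^o} := HB.pack (fun u : 'rV[R]_n => u 0 k)
    (GRing.isLinear.Build R 'rV[R]_n R^o _ (fun u : 'rV[R]_n => u 0 k) lf).
  by have := @diff_lin _ _ _ f v (@coord_continuous _ _ _ 0 k).
by rewrite mxE eqxx /= eq_sym.
Qed.

Lemma is_derive_horner v i k (q : {poly R}) :
  is_derive v (delta_mx 0 i : 'rV[R]_n) (fun u : 'rV[R]_n => q.[u 0 k])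
    ((i == k)%:R * (q^`()).[v 0 k]).
Proof.
elim/poly_ind: q => [|q c IH].
  rewrite deriv0 horner0 mulr0.
  have -> : (fun u : 'rV[R]_n => (0 : {poly R}).[u 0 k]) = cst 0.
    by apply/funext => u; rewrite horner0.
  exact: is_derive_cst.
have -> : (fun u : 'rV[R]_n => (q * 'X + c%:P).[u 0 k]) =
    ((fun u : 'rV[R]_n => q.[u 0 k]) * (fun u : 'rV[R]_n => u 0 k)) + cst c.
  by apply/funext => u; rewrite hornerMXaddC.
rewrite derivMXaddC hornerD hornerMX.
have h := is_deriveD (is_deriveM IH (is_derive_coord v i k)) (is_derive_cst c v (delta_mx 0 i)).
apply: is_derive_eq h _.
by rewrite addr0 /GRing.scale/=; ring.
Qed.

Lemma is_derive_sum_horner p v i :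
  is_derive v (delta_mx 0 i : 'rV[R]_n) (sum_horner p) (((p i)^`()).[v 0 i]).
Proof.
have -> : sum_horner p = \sum_(k < n) (fun u : 'rV[R]_n => (p k).[u 0 k]).
  by apply/funext => u; rewrite fct_sumE.
apply: is_derive_eq.
  by apply: is_derive_sum => k; exact: is_derive_horner.
by rewrite (bigD1 i)//= eqxx mul1r big1 ?addr0// => k /negbTE; rewrite eq_sym => ->; rewrite mul0r.
Qed.

Lemma derive_sum_horner p i : (fun v => 'D_(delta_mx 0 i) (sum_horner p) v) =
  sum_horner (fun k => if k == i then (p i)^`() else 0).
Proof.
apply/funext => v; have h := is_derive_sum_horner p v i; rewrite derive_val /sum_horner.
by rewrite (bigD1 i)//= eqxx big1 ?addr0// => k /negbTE ->; rewrite horner0.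
Qed.

Lemma iter_partial_sum_horner p (s : seq 'I_n) :
  exists q, iter_partial s (sum_horner p) = sum_horner q.
Proof.
elim: s => [|i s [q IH]] /=; first by exists p.
by rewrite IH derive_sum_horner; eexists.
Qed.

Let polygrowth (f : 'rV[R]_n -> R) :=
  exists (c : R) (N : nat), 0 <= c /\ forall x, `|f x| <= c * (1 + `|x|) ^+ N.

Let growthD f g : polygrowth f -> polygrowth g -> polygrowth (fun x => f x + g x).
Proof.
move=> [c [N [c0 h]]] [c' [N' [c0' h']]]; exists (c + c'), (maxn N N'); split; first exact: addr_ge0.
move=> x; apply: le_trans (ler_normD _ _) _; rewrite mulrDl.
have x1 : 1 <= 1 + `|x| by rewrite lerDl.
apply: lerD; [apply: le_trans (h x) _|apply: le_trans (h' x) _]; rewrite ler_wpM2l//;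
  by rewrite ler_weXn2l ?leq_maxl ?leq_maxr.
Qed.

Let growthM f g : polygrowth f -> polygrowth g -> polygrowth (fun x => f x * g x).
Proof.
move=> [c [N [c0 h]]] [c' [N' [c0' h']]]; exists (c * c'), (N + N')%N; split; first exact: mulr_ge0.
move=> x; rewrite normrM exprD mulrACA; exact: ler_pM.
Qed.

Let growth_cst c : polygrowth (fun=> c).
Proof. by exists `|c|, 0%N; split => // x; rewrite expr0 mulr1. Qed.

Let growth_coord k : polygrowth (fun x => x 0 k).
Proof.
exists 1, 1%N; split => // x; rewrite mul1r expr1.
apply: (@le_trans _ _ `|x|); last by rewrite lerDr.
rewrite [leRHS]/Num.Def.normr/= mx_normrE.
exact: (le_bigmax _ (fun ij : 'I_1 * 'I_n => `|x ij.1 ij.2|) (0, k)).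
Qed.

Lemma sum_horner_smooth p : smooth_polygrowth (sum_horner p).
Proof.
move=> s; have [q ->] := iter_partial_sum_horner p s.
have cont_horner k (r : {poly R}) : continuous (fun u : 'rV[R]_n => r.[u 0 k]).
  move=> u; apply: (@continuous_comp _ _ _ (fun u : 'rV[R]_n => u 0 k) (horner r)).
    exact: coord_continuous.
  exact: continuous_horner.
split.
- rewrite /sum_horner; elim: (index_enum _) => [|k r IH].
    by under eq_fun do rewrite big_nil; exact: cst_continuous.
  under eq_fun do rewrite big_cons; move=> v.
  exact: (cvgD (cont_horner k (q k) v) (IH v)).
- by move=> i v; have [] := is_derive_sum_horner q v i.
- suff [c [N [_ h]]] : polygrowth (sum_horner q) by exists c, N.
  rewrite /sum_horner; elim: (index_enum _) => [|k r IH].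
    by under eq_fun do rewrite big_nil; exact: growth_cst.
  under eq_fun do rewrite big_cons; apply: growthD => //.
  elim/poly_ind: (q k) => [|u c IHu].
    by under eq_fun do rewrite horner0; exact: growth_cst.
  under eq_fun do rewrite hornerMXaddC.
  by apply: growthD; [apply: growthM => //; exact: growth_coord|exact: growth_cst].
Qed.

End smooth_polynomials.

Section smooth_chaos.
Context {R : realType} {H : completeNormedModType R}.
Context {d : measure_display} {Omega : measurableType d}.
Variables (ip : {dot H for idfun}) (W : H -> Omega -> R).

Lemma chaos_smooth_derivative p (s : seq (R * H)) :
  smooth_derivative W (chaos ip W p.+1 s) (grad ip W p s).
Proof.
pose x (i : 'I_(size s)) := tnth (in_tuple s) i.
pose q i : {poly R} := (x i).1 *: hermiteh (ip (x i).2 (x i).2) p.+1.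
exists (size s), (sum_horner q), (fun i => (x i).2); split.
- exact: sum_horner_smooth.
- move=> w; rewrite /chaos /sum_horner (big_tnth _ _ s); apply: eq_bigr => i _.
  by rewrite /q hornerZ mxE.
- move=> w; rewrite /grad (big_tnth _ _ s); apply: eq_bigr => i _; congr (_ *: _).
  have h := is_derive_sum_horner q (\row_k W (x k).2 w) i; rewrite derive_val.
  by rewrite /q derivZ deriv_hermiteh mxE !hornerZ.
Qed.
End smooth_chaos.

(** * Fatou's lemma and second moments of almost sure limits *)

Section almost_everywhere_limits.
Context {R : realType} {d : measure_display} {Omega : measurableType d}.
Variable P : probability Omega R.
Implicit Types X Y Z : Omega -> R.

Lemma fatou_cvg (X : nat -> Omega -> R) Y (c : nat -> R) (l : R) :
  (forall n, measurable_fun [set: Omega] (X n)) -> measurable_fun [set: Omega] Y ->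
  (forall n w, 0 <= X n w) -> (forall w, 0 <= Y w) ->
  {ae P, forall w, X n w @[n --> \oo] --> Y w} ->
  (forall n, (\int[P]_w (X n w)%:E <= (c n)%:E)%E) -> c @ \oo --> l ->
  (\int[P]_w (Y w)%:E <= l%:E)%E.
Proof.
move=> mX mY X0 Y0 XY Xc cl.
have mX' n : measurable_fun [set: Omega] (fun w => (X n w)%:E) by apply/measurable_EFinP.
have mY' : measurable_fun [set: Omega] (fun w => (Y w)%:E) by apply/measurable_EFinP.
have X0' n w : [set: Omega] w -> (0 <= (X n w)%:E)%E by rewrite lee_fin.
have hf := fatou P measurableT mX' X0'.
have : (\int[P]_w (Y w)%:E <= \int[P]_w limn_einf (fun n => (X n w)%:E))%E.
  apply: ae_ge0_le_integral => //.
  - by move=> w _; rewrite lee_fin.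
  - move=> w _; rewrite limn_einf_lim; apply: lime_ge; first exact: is_cvg_einfs.
    by apply: nearW => n; apply: le_ereal_inf_tmp => _ [k _ <-]; rewrite lee_fin.
  - apply: (emeasurable_fun_cvg (fun n w => einfs (fun k => (X k w)%:E) n)).
      exact: (measurable_fun_einfs mX').
    by move=> w _; rewrite limn_einf_lim; exact: is_cvg_einfs.
  - apply: filterS XY => w h _.
    have /cvg_limn_einf_sup[-> _] : (fun n => (X n w)%:E) @ \oo --> (Y w)%:E by apply: cvg_EFin => //; exact: nearW.
    exact: lexx.
move=> /le_trans; apply; apply: le_trans hf _.
have cE : (fun n => (c n)%:E) @ \oo --> l%:E by apply: cvg_EFin => //; exact: nearW.
rewrite limn_einf_lim -(cvg_lim _ cE)//; apply: lee_lim; [exact: is_cvg_einfs|by apply/cvg_ex; exists l%:E|].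
apply: nearW => n; apply: le_trans (Xc n); apply: ereal_inf_lbound; by exists n => /=.
Qed.

(** The limit is known on [A] only; outside [A] the sequence is replaced by the fixed measurable
    function [Y]. *)
Lemma measurable_lim_on (A : set Omega) (h : nat -> Omega -> R) X Y : measurable A ->
  (forall n, measurable_fun [set: Omega] (h n)) -> measurable_fun [set: Omega] Y ->
  (forall w, A w -> h n w @[n --> \oo] --> X w) -> (forall w, ~ A w -> X w = Y w) ->
  measurable_fun [set: Omega] X.
Proof.
move=> mA mh mY hX XY.
apply: (measurable_fun_cvg (h := fun n w => \1_A w * h n w + (1 - \1_A w) * Y w)).
  move=> n; apply: measurable_funD; apply: measurable_funM => //.
  by apply: measurable_funB; [exact: measurable_cst|exact: measurable_indic].
move=> w _; rewrite indicE; have [Aw|nAw] := pselect (A w).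
  rewrite mem_set//= subrr mul0r; under eq_fun do rewrite mul1r addr0.
  exact: hX.
rewrite memNset//= subr0 mul1r; under eq_fun do rewrite mul0r add0r.
by rewrite XY//; exact: cvg_cst.
Qed.

(* The lower bound on the integral of [Z ^+ 2] comes from
   [Zn n ^+ 2 <= (1 + t) * Z ^+ 2 + (1 + t^-1) * (Zn n - Z) ^+ 2]. *)
Lemma integral_sqr_limit (Zn : nat -> Omega -> R) Z (q r : nat -> R) (Q : R) :
  (forall n, measurable_fun [set: Omega] (Zn n)) -> measurable_fun [set: Omega] Z ->
  {ae P, forall w, Zn n w @[n --> \oo] --> Z w} ->
  (forall n, \int[P]_w (Zn n w ^+ 2)%:E = (q n)%:E)%E -> q @ \oo --> Q ->
  (forall n k, \int[P]_w ((Zn n w - Zn k w) ^+ 2)%:E <= (r n + r k)%:E)%E ->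
  r @ \oo --> (0 : R) ->
  (\int[P]_w (Z w ^+ 2)%:E = Q%:E)%E.
Proof.
move=> mZn mZ cZ hq cq hr cr.
have m2 (X : Omega -> R) : measurable_fun [set: Omega] X -> measurable_fun [set: Omega] (fun w => X w ^+ 2).
  by move=> mX; exact: measurable_funX.
have le1 : (\int[P]_w (Z w ^+ 2)%:E <= Q%:E)%E.
  apply: (fatou_cvg (X := fun n w => Zn n w ^+ 2) (c := q)) => //.
  - by move=> n; exact: m2.
  - exact: m2.
  - by move=> n w; exact: sqr_ge0.
  - by move=> w; exact: sqr_ge0.
  - apply: filterS cZ => w h; rewrite expr2; under eq_fun do rewrite expr2; exact: cvgM.
  - by move=> n; rewrite hq.
(* Fatou's lemma in [k], at fixed [n], turns the Cauchy estimate into a bound on the distance to the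
   limit. *)
have le2 n : (\int[P]_w ((Zn n w - Z w) ^+ 2)%:E <= (r n)%:E)%E.
  apply: (fatou_cvg (X := fun k w => (Zn n w - Zn k w) ^+ 2) (c := fun k => r n + r k)) => //.
  - by move=> k; apply: m2; exact: measurable_funB.
  - by apply: m2; exact: measurable_funB.
  - by move=> k w; exact: sqr_ge0.
  - by move=> w; exact: sqr_ge0.
  - apply: filterS cZ => w h; have h' : (Zn n w - Zn k w) @[k --> \oo] --> Zn n w - Z w.
      by apply: cvgB => //; exact: cvg_cst.
    rewrite expr2; under eq_fun do rewrite expr2; exact: cvgM.
  - by rewrite -[X in _ --> X](addr0 (r n)); apply: cvgD => //; exact: cvg_cst.
have fZ : (\int[P]_w (Z w ^+ 2)%:E)%E \is a fin_num.
  rewrite ge0_fin_numE; first exact: le_lt_trans le1 (ltry _).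
  by apply: integral_ge0 => w _; rewrite lee_fin sqr_ge0.
rewrite -(fineK fZ); congr (_%:E); set S := fine _.
have SQ : S <= Q by rewrite -lee_fin fineK.
apply/eqP; rewrite eq_le SQ/=.
have key t n : 0 < t -> q n <= (1 + t) * S + (1 + t^-1) * r n.
  move=> t0; have t10 : 0 <= 1 + t by rewrite addr_ge0// ltW.
  have ti0 : 0 <= 1 + t^-1 by rewrite addr_ge0// invr_ge0 ltW.
  rewrite -lee_fin EFinD EFinM -hq.
  apply: (@le_trans _ _ (\int[P]_w ((1 + t)%:E * (Z w ^+ 2)%:E + (1 + t^-1)%:E * ((Zn n w - Z w) ^+ 2)%:E))%E).
    apply: ge0_le_integral => //.
    - by move=> w _; rewrite lee_fin sqr_ge0.
    - by apply/measurable_EFinP; exact: m2.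
    - apply: emeasurable_funD; apply: emeasurable_funM => //; apply/measurable_EFinP; apply: m2 => //.
      exact: measurable_funB.
    - move=> w _; rewrite -!EFinM -EFinD lee_fin.
      move: (Zn n w) (Z w) => a b; have -> : a = b + (a - b) by ring.
      move: (a - b) => c; rewrite [b + c - b](_ : _ = c); last by ring.
      rewrite -subr_ge0 (_ : _ - _ = (t * b - c) ^+ 2 / t); last by field; exact: lt0r_neq0.
      by rewrite divr_ge0 ?sqr_ge0// ltW.
  rewrite ge0_integralD//=.
  - rewrite !ge0_integralZl_EFin//=.
    + rewrite fineK//; apply: leeD => //; rewrite EFinM; apply: lee_wpmul2l => //.
    + by move=> w _; rewrite lee_fin sqr_ge0.
    + by apply/measurable_EFinP; apply: m2; exact: measurable_funB.
    + by move=> w _; rewrite lee_fin sqr_ge0.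
    + by apply/measurable_EFinP; exact: m2.
  - by move=> w _; rewrite -EFinM lee_fin mulr_ge0 ?sqr_ge0.
  - by apply: emeasurable_funM => //; apply/measurable_EFinP; exact: m2.
  - by move=> w _; rewrite -EFinM lee_fin mulr_ge0 ?sqr_ge0.
  - by apply: emeasurable_funM => //; apply/measurable_EFinP; apply: m2; exact: measurable_funB.
have lim t : 0 < t -> Q <= (1 + t) * S.
  move=> t0; have c1 : (1 + t) * S + (1 + t^-1) * r n @[n --> \oo] --> (1 + t) * S.
    have : (1 + t) * S + (1 + t^-1) * r n @[n --> \oo] --> (1 + t) * S + (1 + t^-1) * 0.
      by apply: cvgD; [exact: cvg_cst|exact: cvgMr].
    by rewrite mulr0 addr0.
  rewrite -(cvg_lim _ cq)// -(cvg_lim _ c1)//; apply: ler_lim.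
  - by apply/cvg_ex; exists Q.
  - by apply/cvg_ex; eexists; exact: c1.
  - by apply: nearW => n; exact: key.
have S0 : 0 <= S by rewrite fine_ge0// integral_ge0// => w _; rewrite lee_fin sqr_ge0.
apply/ler_addgt0Pr => eps e0.
have := lim (eps / (S + 1)); rewrite divr_gt0 ?ltr_wpDl// => /(_ isT) /le_trans; apply.
rewrite mulrDl mul1r lerD2l mulrAC ler_pdivrMr ?ltr_wpDl//.
by rewrite ler_pM2l// lerDl.
Qed.
End almost_everywhere_limits.

Lemma sum_half_le (R : realType) N : \sum_(0 <= n < N) (2^-1 : R) ^+ n <= 2.
Proof.
suff : \sum_(0 <= n < N) (2^-1 : R) ^+ n <= 2 - 2 * 2^-1 ^+ N.
  by move=> /le_trans; apply; rewrite gerBl mulr_ge0// exprn_ge0.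
elim: N => [|N IH]; first by rewrite big_nil expr0; lra.
rewrite big_nat_recr//= exprS; move: IH; set x := _ ^+ N; set s := \sum_(_ <= _ < _) _.
by move=> IH; lra.
Qed.

(** * Construction of the gradient as an almost sure limit *)

Section gradient_limit.
Context {R : realType} {H : completeNormedModType R}.
Context {d : measure_display} {Omega : measurableType d}.
Variables (P : probability Omega R) (ip : {dot H for idfun}) (e : nat -> H).
Variable W : H -> Omega -> R.
Hypotheses (hip : hilbert_product ip) (he : complete_orthonormal ip e).
Hypothesis hW : isonormal P ip W.
Variables (p : nat) (f : tensor R p.+1) (phi : nat -> nat).
Hypothesis hf : sym_l2 f.
Hypothesis hphi : forall n,
  tdot (f \- trunc (phi n) f) (f \- trunc (phi n) f) <= (8^-1) ^+ n.

Let F n := trunc_form e (phi n) f.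
Let G n := grad ip W p (F n).
Let C : R := p.+1%:R * p.+1`!%:R.
Let C0 : 0 <= C. Proof. by rewrite mulr_ge0. Qed.
Let l2f : l2 f. Proof. exact: (proj1 (square_summableE f) (proj2 hf)). Qed.

Lemma trunc_dist k l : tdot (trunc k f \- trunc l f) (trunc k f \- trunc l f) <=
  2 * (tdot (f \- trunc k f) (f \- trunc k f) + tdot (f \- trunc l f) (f \- trunc l f)).
Proof.
have -> : trunc k f \- trunc l f = (f \- trunc l f) \- (f \- trunc k f).
  by apply/funext => j /=; ring.
rewrite addrC; apply: tdot_sub_le; apply: l2B => //; exact: l2_trunc.
Qed.

Let GB n k w : G n w - G k w = grad ip W p (F n ++ opp_form (F k)) w.
Proof. by rewrite grad_cat grad_opp. Qed.

Lemma grad_dist n k : (\int[P]_w (`|G n w - G k w| ^+ 2)%:E <=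
  (C * 2 * (8^-1) ^+ n + C * 2 * (8^-1) ^+ k)%:E)%E.
Proof.
under eq_integral do rewrite GB hip.
rewrite ExE; last exact: moments_grad2 hW _ _.
rewrite lee_fin (Ex_grad2 hip he hW) -/C ftensor_sub !ftensor_trunc//; try by case: hf.
rewrite -mulrDr -mulrA; apply: ler_wpM2l => //.
apply: le_trans (trunc_dist _ _) _; rewrite ler_wpM2l//; exact: lerD.
Qed.

Let D n w := ip (G n.+1 w - G n w) (G n.+1 w - G n w).
Let mD n : measurable_fun [set: Omega] (D n).
Proof.
rewrite /D; under eq_fun do rewrite !GB.
by have [] := moments_grad2 (P := P) hW p (F n.+1 ++ opp_form (F n)).
Qed.
Let D0 n w : 0 <= D n w. Proof. exact: ip_ge0. Qed.

(** The expectation of [D n] is of order [8 ^- n], so that of [2 ^+ n * D n] is still summable. The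
    weight is there because [a <= t + a ^+ 2 / t], taken at [t = 2 ^- n], makes the norms of the
    increments summable wherever [S] is finite. *)
Let S w : \bar R := (\sum_(0 <= n <oo) (2 ^+ n * D n w)%:E)%E.

Let mS : measurable_fun [set: Omega] S.
Proof.
apply: (ge0_emeasurable_sum (P := xpredT)) => [n w _ _|n _].
  by rewrite lee_fin mulr_ge0// exprn_ge0.
by apply/measurable_EFinP; apply: measurable_funM => //; exact: measurable_cst.
Qed.

Let S0 w : (0 <= S w)%E.
Proof. by apply: nneseries_ge0 => n _ _; rewrite lee_fin mulr_ge0 ?exprn_ge0. Qed.

Let intS : (\int[P]_w S w <= (C * 2 * 2 * 2)%:E)%E.
Proof.
rewrite /S integral_nneseries//; last 2 first.
- by move=> n; apply/measurable_EFinP; apply: measurable_funM => //; exact: measurable_cst.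
- by move=> n w _; rewrite lee_fin mulr_ge0 ?exprn_ge0.
apply: lime_le.
  by apply: is_cvg_nneseries => n _ _; apply: integral_ge0 => w _; rewrite lee_fin mulr_ge0 ?exprn_ge0.
apply: nearW => N; apply: (@le_trans _ _ (\sum_(0 <= n < N) (C * 2 * 2 * 2^-1 ^+ n)%:E)%E); last first.
  by rewrite sumEFin lee_fin -mulr_sumr ler_wpM2l ?mulr_ge0//; exact: sum_half_le.
apply: lee_sum => n _; under eq_integral do rewrite EFinM.
rewrite ge0_integralZl_EFin//; try by [apply/measurable_EFinP|rewrite exprn_ge0|move=> w _; rewrite lee_fin].
have -> : (\int[P]_w (D n w)%:E = \int[P]_w (`|G n.+1 w - G n w| ^+ 2)%:E)%E.
  by apply: eq_integral => w _; rewrite hip.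
apply: le_trans (lee_wpmul2l _ (grad_dist _ _)) _; first by rewrite lee_fin exprn_ge0.
rewrite -EFinM lee_fin.
rewrite [X in _ <= X](_ : _ = C * (2 ^+ n * (4 * (4^-1 ^+ n)))); last first.
  have -> : (2^-1 : R) ^+ n = 2 ^+ n * 4^-1 ^+ n by rewrite -exprMn; congr (_ ^+ n); field.
  by ring.
rewrite [X in X <= _](_ : _ = C * (2 ^+ n * (2 * ((8^-1) ^+ n.+1 + (8^-1) ^+ n)))); last by ring.
rewrite ler_wpM2l// ler_wpM2l ?exprn_ge0//.
apply: (@le_trans _ _ (2 * (8^-1 ^+ n + 8^-1 ^+ n))).
  by rewrite ler_wpM2l// lerD2r exprS ler_piMl ?exprn_ge0//; lra.
rewrite -mulr2n -[X in 2 * X]mulr_natl mulrA (_ : 2 * 2 = 4); last by ring.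
by rewrite ler_wpM2l// lerXn2r ?nnegrE//; lra.
Qed.

Let A : set Omega := [set w | S w \is a fin_num].
Let mA : measurable A.
Proof. by have := emeasurable_fin_num measurableT mS; rewrite setTI. Qed.

Let aeA : {ae P, forall w, A w}.
Proof.
have iS : P.-integrable [set: Omega] S.
  apply/integrableP; split => //.
  under eq_integral do rewrite gee0_abs//.
  exact: le_lt_trans intS (ltry _).
have := integrable_ae measurableT iS; apply: filterS => w; exact.
Qed.

Let cvgG w : A w -> cvgn (fun n => G n w).
Proof.
move=> Aw; pose u n := G n.+1 w - G n w.
have uN : cvgn (series (fun n => `|u n|)).
  apply: nondecreasing_is_cvgn.
    by apply/nondecreasing_seqP => n; rewrite /series/= big_nat_recr//= lerDl.
  exists (2 + fine (S w)) => _ [N _ <-]; rewrite /series/=.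
  apply: (@le_trans _ _ (\sum_(0 <= n < N) (2^-1 ^+ n + 2 ^+ n * D n w))).
    apply: ler_sum => n _; rewrite /D -hip -/(u n).
    have t0 : 0 < (2^-1 : R) ^+ n by rewrite exprn_gt0.
    have -> : (2 : R) ^+ n = (2^-1 ^+ n)^-1 by rewrite exprVn invrK.
    move: (_ ^+ n) t0 `|u n| => t t0 a; rewrite -subr_ge0.
    rewrite (_ : _ - _ = ((t - a / 2) ^+ 2 + 3 / 4 * a ^+ 2) / t); last by field; exact: lt0r_neq0.
    apply: divr_ge0; last exact: ltW.
    by apply: addr_ge0; [exact: sqr_ge0|apply: mulr_ge0; [rewrite divr_ge0|exact: sqr_ge0]].
  rewrite big_split/=; apply: lerD; first exact: sum_half_le.
  rewrite -lee_fin fineK// -sumEFin; apply: nneseries_lim_ge => n _ _.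
  by rewrite lee_fin mulr_ge0 ?exprn_ge0.
have /cvg_ex[l hl] := normed_cvg uN.
apply/cvg_ex; exists (G 0 w + l).
have -> : (fun n => G n w) = (fun n => G 0 w + series u n).
  by apply/funext => n; rewrite /series/= telescope_sumr//; rewrite addrC subrK.
by apply: cvgD => //; exact: cvg_cst.
Qed.

(** The value 0 outside [A] makes [U] a pointwise limit on [A] and constant elsewhere, hence weakly
    measurable. *)
Let U w : H := if S w \is a fin_num then limn (fun n => G n w) else 0.

Let U0 w : ~ A w -> U w = 0.
Proof. by move=> nA; rewrite /U ifF//; apply/negP. Qed.

Let cvgU w : A w -> G n w @[n --> \oo] --> U w.
Proof. by move=> Aw; rewrite /U (Aw : S w \is a fin_num); exact: cvgG. Qed.

Let wmU : weakly_measurable ip U.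
Proof.
move=> h; apply: (measurable_lim_on (A := A) (h := fun n w => ip (G n w) h) (Y := cst 0)) => //.
- by move=> n; have [] := moments_ip_grad (P := P) hW p (F n) h.
- by move=> w Aw; apply: cvg_ipr => //; exact: cvgU.
- by move=> w nA; rewrite U0// ip0l.
Qed.

Let mGU n : measurable_fun [set: Omega] (fun w => `|G n w - U w| ^+ 2).
Proof.
apply: (measurable_lim_on (A := A) (h := fun k w => `|G n w - G k w| ^+ 2) (Y := fun w => `|G n w| ^+ 2)) => //.
- move=> k; under eq_fun do rewrite GB hip.
  by have [] := moments_grad2 (P := P) hW p (F n ++ opp_form (F k)).
- under eq_fun do rewrite hip.
  by have [] := moments_grad2 (P := P) hW p (F n).
- move=> w Aw; rewrite expr2; under eq_fun do rewrite expr2.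
  by apply: cvgM; apply: cvg_norm; apply: cvgB; [exact: cvg_cst|exact: cvgU|exact: cvg_cst|exact: cvgU].
- by move=> w nA; rewrite U0// subr0.
Qed.

(* Along a fast subsequence, the series [\sum_n 2 ^+ n * `|G n.+1 w - G n w| ^+ 2] is
   almost surely finite, which makes [G n w] a Cauchy sequence in [H]. *)
Lemma grad_limit : exists U : Omega -> H, [/\ weakly_measurable ip U,
  {ae P, forall w, G n w @[n --> \oo] --> U w} &
  forall n, (\int[P]_w (`|G n w - U w| ^+ 2)%:E <= (C * 2 * (8^-1) ^+ n)%:E)%E].
Proof.
exists U; split => //; first by apply: filterS aeA => w; exact: cvgU.
move=> n; apply: (fatou_cvg (X := fun k w => `|G n w - G k w| ^+ 2)
    (c := fun k => C * 2 * (8^-1) ^+ n + C * 2 * (8^-1) ^+ k)) => //.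
- move=> k; under eq_fun do rewrite GB hip.
  by have [] := moments_grad2 (P := P) hW p (F n ++ opp_form (F k)).
- apply: filterS aeA => w Aw; rewrite expr2; under eq_fun do rewrite expr2.
  by apply: cvgM; apply: cvg_norm; apply: cvgB; [exact: cvg_cst|exact: cvgU|exact: cvg_cst|exact: cvgU].
- by move=> k; exact: grad_dist.
- have : (C * 2 * (8^-1) ^+ n + C * 2 * (8^-1) ^+ k) @[k --> \oo] --> C * 2 * (8^-1) ^+ n + C * 2 * 0.
    by apply: cvgD; [exact: cvg_cst|apply: cvgMr; apply: cvg_expr; rewrite ger0_norm//; lra].
  by rewrite mulr0 addr0.
Qed.

End gradient_limit.

Lemma cvg_trunc_dist (R : realType) n (f : tensor R n) : l2 f ->
  tdot (f \- trunc k f) (f \- trunc k f) @[k --> \oo] --> 0.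
Proof.
move=> hf; have hb := l2_norm hf.
have cv j : f j - trunc k f j @[k --> \oo] --> (0 : R).
  by rewrite -(subrr (f j)); apply: cvgB; [exact: cvg_cst|exact: cvg_trunc].
have le_ k j : `|f j - trunc k f j| <= `|f j|.
  by rewrite /trunc; case: ifP => _; rewrite ?subrr ?subr0// normr0.
have -> : 0 = tdot (fun=> 0 : R) (fun _ : n.-tuple nat => 0 : R).
  by rewrite /tdot; under eq_tsum do rewrite mul0r; rewrite tsum0.
exact: (cvg_tdot hb hb).
Qed.

(** One sequence serves both tensors, so that minors mixing [f] and [g] are approximated at a common
    level; [k <= phi k] brings any given slice index below that level. *)
Lemma fast_truncation (R : realType) n (f g : tensor R n) : l2 f -> l2 g ->
  exists phi : nat -> nat, [/\ forall k, (k <= phi k)%N,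
    forall k, tdot (f \- trunc (phi k) f) (f \- trunc (phi k) f) <= (8^-1) ^+ k &
    forall k, tdot (g \- trunc (phi k) g) (g \- trunc (phi k) g) <= (8^-1) ^+ k].
Proof.
move=> hf hg.
have ex k : exists N, [/\ (k <= N)%N,
    tdot (f \- trunc N f) (f \- trunc N f) <= (8^-1 : R) ^+ k &
    tdot (g \- trunc N g) (g \- trunc N g) <= (8^-1 : R) ^+ k].
  have e0 : 0 < (8^-1 : R) ^+ k by rewrite exprn_gt0.
  have near_le (u : tensor R n) : l2 u ->
      \forall N \near \oo, tdot (u \- trunc N u) (u \- trunc N u) <= (8^-1 : R) ^+ k.
    move=> hu; have /cvgrPdist_le/(_ _ e0) := cvg_trunc_dist hu.
    by apply: filterS => N; rewrite sub0r normrN => /(le_trans (ler_norm _)).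
  have [N _ hN] : \forall N \near \oo, [/\ (k <= N)%N,
    tdot (f \- trunc N f) (f \- trunc N f) <= (8^-1 : R) ^+ k &
    tdot (g \- trunc N g) (g \- trunc N g) <= (8^-1 : R) ^+ k].
    near=> N; split; near: N; [exact: nbhs_infty_ge|exact: near_le|exact: near_le].
  by exists N; apply: hN => /=.
have [phi hphi] := choice ex.
by exists phi; split => k; have [] := hphi k.
Unshelve. all: by end_near. Qed.

Section multiple_integral_chaos.
Context {R : realType} {H : completeNormedModType R}.
Context {d : measure_display} {Omega : measurableType d}.
Variables (P : probability Omega R) (ip : {dot H for idfun}) (e : nat -> H).
Variable W : H -> Omega -> R.
Hypotheses (hip : hilbert_product ip) (he : complete_orthonormal ip e).
Hypothesis hW : isonormal P ip W.
Local Notation Ex := (Ex P).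
Local Notation moments := (moments P).
Local Notation coords := (coords ip e).

Lemma tensor_powerE m x : tensor_power ip e m x = tpow (coords x) m.
Proof. by apply/funext => j; rewrite /tensor_power /tpow big_tuple. Qed.

(** Homogeneity comes from the covariance: expanding the square, the second moment of the difference
    is zero. *)
Lemma W_scale c y : {ae P, forall w, W (c *: y) w = c * W y w}.
Proof.
have nW := moments_W hW.
have nD : moments (fun w => (W (c *: y) w - c * W y w) ^+ 2).
  by apply: momentsX; apply: momentsB => //; exact: momentsZ.
have E0 : Ex (fun w => (W (c *: y) w - c * W y w) ^+ 2) = 0.
  rewrite (eq_Ex P (Y := fun w => W (c *: y) w * W (c *: y) w - (2 * c) * (W (c *: y) w * W y w)
     + c ^+ 2 * (W y w * W y w))); last by move=> w; ring.
  have n2 x z : moments (fun w => W x w * W z w) by exact: momentsM.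
  rewrite ExD ?ExB ?ExZ//; last 3 first.
  - exact: momentsZ.
  - by apply: momentsB => //; exact: momentsZ.
  - exact: momentsZ.
  by rewrite !(Ex_WW hW) !ipZl !ipZr; ring.
have mD : measurable_fun [set: Omega] (fun w => ((W (c *: y) w - c * W y w) ^+ 2)%:E).
  by apply/measurable_EFinP; have [] := nD.
have := (ae_eq_integral_abs P measurableT mD).1.
have -> : (\int[P]_w `|((W (c *: y) w - c * W y w) ^+ 2)%:E| = 0)%E.
  by rewrite -[RHS]/(0%:E) -E0 -ExE//; apply: eq_integral => w _; rewrite gee0_abs// lee_fin sqr_ge0.
move=> /(_ erefl); apply: filterS => w /(_ I) [] /eqP.
by rewrite sqrf_eq0 subr_eq0 => /eqP.
Qed.

Variables (p : nat) (I : tensor R p.+1 -> Omega -> R).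
Hypothesis hI : multiple_integral P ip e W I.

Lemma sym_l2_tpow x : sym_l2 (tpow (coords x) p.+1).
Proof.
split; first exact: tpow_sym.
by apply/square_summableE; apply: l2_tpow; exact: l2_coords.
Qed.

Lemma sym_l2_lin a (f g : tensor R p.+1) : sym_l2 f -> sym_l2 g ->
  sym_l2 (fun j => a * f j + g j).
Proof.
move=> [sf /square_summableE lf] [sg /square_summableE lg]; split.
  by move=> s j; rewrite sf sg.
by apply/square_summableE; apply: l2D => //; exact: l2Z.
Qed.

Lemma sym_l2_0 : sym_l2 (fun _ : p.+1.-tuple nat => 0 : R).
Proof.
split => //; apply/square_summableE; rewrite /l2; under eq_fun do rewrite expr0n.
exact: asum0.
Qed.

Lemma sym_l2_ftensor s : sym_l2 (ftensor ip e p.+1 s).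
Proof.
elim: s => [|a s IH].
  have -> : ftensor ip e p.+1 [::] = fun=> 0 by apply/funext => j; rewrite /ftensor /lincomb big_nil.
  exact: sym_l2_0.
have -> : ftensor ip e p.+1 (a :: s) = fun j => a.1 * tpow (coords a.2) p.+1 j + ftensor ip e p.+1 s j.
  by apply/funext => j; rewrite /ftensor /lincomb big_cons.
by apply: sym_l2_lin => //; exact: sym_l2_tpow.
Qed.

Lemma I_0 : {ae P, forall w, I (fun=> 0) w = 0}.
Proof.
have := multiple_integral_linear hI (-1) sym_l2_0 sym_l2_0.
have -> : (fun _ : p.+1.-tuple nat => -1 * 0 + 0 : R) = fun=> 0.
  by apply/funext => j; rewrite mulr0 addr0.
by apply: filterS => w ->; rewrite mulN1r addNr.
Qed.

(** A nonzero [x] is rescaled to norm 1, and [hermiteh_scale] undoes the scaling. For [x = 0] both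
    sides vanish, because the order [p.+1] is positive. *)
Lemma I_tpow x : {ae P, forall w, I (tpow (coords x) p.+1) w = (hermiteh (ip x x) p.+1).[W x w]}.
Proof.
have h0 : (hermiteh (0 : R) p.+1).[0] = 0.
  by have := hermiteh_scale (0 : R) 0 p.+1 0; rewrite expr0n !mul0r expr0n mul0r.
have [->|x0] := eqVneq x 0.
  have -> : tpow (coords 0) p.+1 = fun=> 0.
    apply/funext => j; case/tupleP: j => a j; rewrite /tpow/= big_cons {1}/coords.
    by rewrite ip0l mul0r.
  have := W_scale 0 0; have := I_0; apply: filterS2 => w -> /=.
  by rewrite scale0r mul0r => ->; rewrite ip0l h0.
have nx : `|x| != 0 by rewrite normr_eq0.
pose y := `|x|^-1 *: x.
have ny : `|y| = 1 by rewrite normrZ normfV normr_id mulVf.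
have xy : x = `|x| *: y by rewrite scalerA divff// scale1r.
have -> : tpow (coords x) p.+1 = fun j => `|x| ^+ p.+1 * tpow (coords y) p.+1 j + 0.
  apply/funext => j; rewrite addr0 /tpow !big_tuple.
  have -> : `|x| ^+ p.+1 = \prod_(i < p.+1) `|x| by rewrite big_const_ord iter_mulr_1.
  by rewrite -big_split/=; apply: eq_bigr => i _; rewrite {1}/coords {1}xy ipZl.
have h4 := multiple_integral_linear hI (`|x| ^+ p.+1) (sym_l2_tpow y) sym_l2_0.
have h3 := multiple_integral_hermite hI ny; rewrite tensor_powerE in h3.
have h2 := W_scale `|x| y; rewrite -xy in h2.
apply: filterS3 h4 h3 (filterI I_0 h2) => w -> -> [-> ->].
by rewrite addr0 -hip -[X in hermiteh X _]mulr1 hermiteh_scale hermiteh1.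
Qed.

Lemma I_chaos s : {ae P, forall w, I (ftensor ip e p.+1 s) w = chaos ip W p.+1 s w}.
Proof.
elim: s => [|a s IH].
  have -> : ftensor ip e p.+1 [::] = fun=> 0 by apply/funext => j; rewrite /ftensor /lincomb big_nil.
  by apply: filterS I_0 => w ->; rewrite /chaos big_nil.
have -> : ftensor ip e p.+1 (a :: s) = fun j => a.1 * tpow (coords a.2) p.+1 j + ftensor ip e p.+1 s j.
  by apply/funext => j; rewrite /ftensor /lincomb big_cons.
have h := multiple_integral_linear hI a.1 (sym_l2_tpow a.2) (sym_l2_ftensor s).
by apply: filterS3 h IH (I_tpow a.2) => w -> -> ->; rewrite /chaos big_cons.
Qed.

Lemma I_chaos_dist f s : sym_l2 f ->
  (\int[P]_w ((chaos ip W p.+1 s w - I f w) ^+ 2)%:E =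
   (p.+1`!%:R * tdot (f \- ftensor ip e p.+1 s) (f \- ftensor ip e p.+1 s))%:E)%E.
Proof.
move=> hf; have hs := sym_l2_ftensor s.
have hd := sym_l2_lin (-1) hs hf.
have fs : f \- ftensor ip e p.+1 s = fun j => -1 * ftensor ip e p.+1 s j + f j.
  by apply/funext => j /=; ring.
rewrite fs -tnorm_sqr -(multiple_integral_isometry hI hd) unlock.
apply: ge0_ae_eq_integral => //.
- apply/measurable_EFinP; apply: measurable_funX; apply: measurable_funB.
    by have [] := moments_chaos hW p.+1 s.
  exact: multiple_integral_measurable hI _ hf.
- by apply/measurable_EFinP; apply: measurable_funX; exact: multiple_integral_measurable hI _ hd.
- by move=> w _; rewrite lee_fin sqr_ge0.
- by move=> w _; rewrite lee_fin sqr_ge0.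
have h := multiple_integral_linear hI (-1) hs hf.
by apply: filterS2 h (I_chaos s) => w -> -> _; congr (_%:E); ring.
Qed.

(** [chaos] and [grad] along the truncations are the smooth approximations that [malliavin_graph]
    asks for; the hypothesis on [D] then identifies [D (I f)] with [U] almost surely. *)
Lemma malliavin_graph_I f (phi : nat -> nat) U : sym_l2 f ->
  (forall n, tdot (f \- trunc (phi n) f) (f \- trunc (phi n) f) <= (8^-1) ^+ n) ->
  weakly_measurable ip U ->
  (forall n, (\int[P]_w (`|grad ip W p (trunc_form e (phi n) f) w - U w| ^+ 2)%:E <=
    (p.+1%:R * p.+1`!%:R * 2 * (8^-1) ^+ n)%:E)%E) ->
  malliavin_graph P ip W (I f) U.
Proof.
move=> hf hphi wU hU; split => //; first exact: multiple_integral_measurable hI _ hf.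
have geo (c : R) : (c * (8^-1) ^+ n)%:E @[n --> \oo] --> 0%E.
  apply: cvg_EFin; first exact: nearW.
  rewrite -[X in _ --> X](mulr0 c); apply: cvgMr; apply: cvg_expr; rewrite ger0_norm//; lra.
exists (fun n => chaos ip W p.+1 (trunc_form e (phi n) f)), (fun n => grad ip W p (trunc_form e (phi n) f)).
split.
- by move=> n; exact: chaos_smooth_derivative.
- rewrite unlock; apply: (@squeeze_cvge _ _ _ _ (cst 0%E) _ (fun n => (p.+1`!%:R * (8^-1) ^+ n)%:E)); last 2 first.
  + exact: cvg_cst.
  + exact: geo.
  apply: nearW => n; apply/andP; split.
    by apply: integral_ge0 => w _; rewrite lee_fin sqr_ge0.
  rewrite I_chaos_dist// (ftensor_trunc he); last by case: hf.
  by rewrite lee_fin ler_wpM2l.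
- rewrite unlock; apply: (@squeeze_cvge _ _ _ _ (cst 0%E) _ (fun n => (p.+1%:R * p.+1`!%:R * 2 * (8^-1) ^+ n)%:E)); last 2 first.
  + exact: cvg_cst.
  + exact: geo.
  apply: nearW => n; apply/andP; split => //.
  by apply: integral_ge0 => w _; rewrite lee_fin sqr_ge0.
Qed.

End multiple_integral_chaos.

(** * The expectation of the determinant *)

Lemma cvg_box_sum (R : realType) (a : nat * nat -> R) : asum a ->
  \sum_(0 <= i < N) \sum_(0 <= l < N) a (i, l) @[N --> \oo] --> tsum a.
Proof.
move=> ha; pose aN N il := if (il.1 < N)%N && (il.2 < N)%N then a il else 0.
have E N : \sum_(0 <= i < N) \sum_(0 <= l < N) a (i, l) = tsum (aN N).
  rewrite (@tsum_fin _ _ _ [seq (i, l) | i <- index_iota 0 N, l <- index_iota 0 N]).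
  - rewrite big_allpairs_dep/=; rewrite big_seq [RHS]big_seq; apply: eq_bigr => i.
    rewrite mem_index_iota /= => iN; rewrite big_seq [RHS]big_seq; apply: eq_bigr => l.
    by rewrite mem_index_iota /= /aN => lN; rewrite iN lN.
  - by apply: allpairs_uniq => [||[x1 x2] [y1 y2] _ _ []-> ->//]; exact: iota_uniq.
  - move=> [i l]; apply: contraNeq => /=; rewrite /aN/=; case: ifP => [/andP[iN lN] _|]; last by rewrite eqxx.
    by apply/allpairsP; exists (i, l); rewrite /= !mem_index_iota.
rewrite (funext E).
apply: (tsum_dominated (asum_norm ha) _ _).2 => [N il|[i l]].
  by rewrite /aN; case: ifP => // _; rewrite normr0.
apply: (@cvg_near_cst _ _ _ _ _ _); exists (maxn i l).+1 => //= N /= hN.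
by rewrite /aN/= !(leq_trans _ hN)// ltnS ?leq_maxl ?leq_maxr.
Qed.

Section gram_determinant.
Context {R : realType} {H : completeNormedModType R}.
Context {d : measure_display} {Omega : measurableType d}.
Variables (P : probability Omega R) (ip : {dot H for idfun}) (e : nat -> H).
Variable W : H -> Omega -> R.
Hypotheses (hip : hilbert_product ip) (he : complete_orthonormal ip e).
Hypothesis hW : isonormal P ip W.
Variables (p : nat) (f g : tensor R p.+1) (phi : nat -> nat) (Uf Ug : Omega -> H).
Hypotheses (hf : sym_l2 f) (hg : sym_l2 g) (hphi : forall n, (n <= phi n)%N).
Hypotheses (wf : weakly_measurable ip Uf) (wg : weakly_measurable ip Ug).
Hypothesis cf : {ae P, forall w, grad ip W p (trunc_form e (phi n) f) w @[n --> \oo] --> Uf w}.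
Hypothesis cg : {ae P, forall w, grad ip W p (trunc_form e (phi n) g) w @[n --> \oo] --> Ug w}.
Local Notation Ex := (Ex P).
Local Notation coords := (coords ip e).

Definition wedge il w : R :=
  coords (Uf w) il.1 * coords (Ug w) il.2 - coords (Uf w) il.2 * coords (Ug w) il.1.

Lemma measurable_wedge il : measurable_fun [set: Omega] (wedge il).
Proof.
by apply: measurable_funB; apply: measurable_funM; [exact: wf|exact: wg|exact: wf|exact: wg].
Qed.

Let lf : l2 f. Proof. exact: (proj1 (square_summableE f) (proj2 hf)). Qed.
Let lg : l2 g. Proof. exact: (proj1 (square_summableE g) (proj2 hg)). Qed.

(** The minors [Z n] of the approximating gradients converge almost surely to [wedge il].
    [Ex_chaos_pairs] gives their second moments and mutual L^2 distances, and [integral_sqr_limit]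
    passes to the limit. *)
Lemma integral_wedge il : (\int[P]_w (wedge il w ^+ 2)%:E =
  (\sum_(k < p.+1) chaos_coef p k *
    tdot (slice_antisym f g k il) (slice_antisym f g k il))%:E)%E.
Proof.
(* The shift by [K] keeps the truncation level above [i] and [l] for every [n], as [slice_trunc]
   requires. *)
case: il => i l; pose K := (maxn i l).+1; pose psi n := phi (n + K)%N.
have iK n : (i < psi n)%N.
  by apply: leq_trans (hphi _); rewrite /K addnS ltnS (leq_trans (leq_maxl i l))// leq_addl.
have lK n : (l < psi n)%N.
  by apply: leq_trans (hphi _); rewrite /K addnS ltnS (leq_trans (leq_maxr i l))// leq_addl.
have psioo : psi n @[n --> \oo] --> \oo.
  apply/cvgnyPge => A; exists A => //= n /= An; apply: leq_trans An _.
  by apply: leq_trans (hphi _); exact: leq_addr.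
pose sf n i := slice_form ip e p i (trunc_form e (psi n) f).
pose sg n i := slice_form ip e p i (trunc_form e (psi n) g).
have Tf n a : (a < psi n)%N -> ftensor ip e p (sf n a) = trunc (psi n) (slice f a : tensor R p).
  by move=> an; rewrite ftensor_slice ftensor_trunc//; [exact: slice_trunc|case: hf].
have Tg n a : (a < psi n)%N -> ftensor ip e p (sg n a) = trunc (psi n) (slice g a : tensor R p).
  by move=> an; rewrite ftensor_slice ftensor_trunc//; [exact: slice_trunc|case: hg].
pose J := chaos ip W p.
pose Z n w := J (sf n i) w * J (sg n l) w - J (sf n l) w * J (sg n i) w.
have nJ s : moments P (J s) by exact: moments_chaos.
have nZ n : moments P (Z n) by apply: momentsB; exact: momentsM.
have Lf a : @l2 R (p.-tuple nat) (slice f a) := l2_slice a lf.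
have Lg a : @l2 R (p.-tuple nat) (slice g a) := l2_slice a lg.
pose At k n := @antisym R p k (trunc (psi n) (slice f i : tensor R p)) (trunc (psi n) (slice g l : tensor R p))
  (trunc (psi n) (slice f l : tensor R p)) (trunc (psi n) (slice g i : tensor R p)).
pose A k := slice_antisym f g k (i, l).
apply: (integral_sqr_limit (Zn := Z)
  (q := fun n => \sum_(k < p.+1) chaos_coef p k * tdot (At k n) (At k n))
  (r := fun n => \sum_(k < p.+1) chaos_coef p k * (2 * tdot (At k n \- A k) (At k n \- A k)))).
- by move=> n; have [] := nZ n.
- exact: measurable_wedge.
- apply: filterS2 cf cg => w hcf hcg.
  have c1 a : J (sf n a) w @[n --> \oo] --> coords (Uf w) a.
    rewrite /J /sf; under eq_fun do rewrite -ip_grad.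
    apply: (@cvg_ipr _ _ _ hip (fun n => grad ip W p (trunc_form e (psi n) f) w)).
    exact: (cvg_comp (fun n => (n + K)%N) (fun n => grad ip W p (trunc_form e (phi n) f) w) (cvg_addnr K) hcf).
  have c2 a : J (sg n a) w @[n --> \oo] --> coords (Ug w) a.
    rewrite /J /sg; under eq_fun do rewrite -ip_grad.
    apply: (@cvg_ipr _ _ _ hip (fun n => grad ip W p (trunc_form e (psi n) g) w)).
    exact: (cvg_comp (fun n => (n + K)%N) (fun n => grad ip W p (trunc_form e (phi n) g) w) (cvg_addnr K) hcg).
  by apply: cvgB; apply: cvgM.
- move=> n; rewrite ExE; last exact: momentsX.
  congr (_%:E).
  rewrite (eq_Ex P (Y := fun w => (\sum_(b <- [:: true; false]) (if b then 1 else -1) *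
    (J (sf n (if b then i else l)) w * J (sg n (if b then l else i)) w)) ^+ 2)); last first.
    by move=> w; rewrite !big_cons big_nil /Z; congr (_ ^+ 2); ring.
  rewrite (Ex_chaos_pairs hip he hW); apply: eq_bigr => k _; congr (_ * _).
  have -> : lincomb [:: true; false] (fun b : bool => if b then 1 else -1)
     (fun b : bool => tcontract_sym k (ftensor ip e p (sf n (if b then i else l)))
      (ftensor ip e p (sg n (if b then l else i)))) = At k n; last by [].
  apply/funext => x; rewrite /lincomb !big_cons big_nil !Tf// !Tg//.
  by rewrite /At /antisym /=; ring.
- apply: cvg_sumr => -[k /= kp]; apply: cvgMr.
  exact: (cvg_comp psi _ psioo (cvg_tdot_antisym (kp : (k <= p)%N) (Lf i) (Lg l) (Lf l) (Lg i))).
- move=> n m; rewrite ExE; last by apply: momentsX; exact: momentsB.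
  rewrite lee_fin -big_split/=.
  (* The four products in [Z n - Z m]: the first boolean selects the term of the minor, the second
     tells [n] from [m]. *)
  pose B := [:: (true, true); (false, true); (true, false); (false, false)].
  rewrite (eq_Ex P (Y := fun w => (\sum_(b <- B) (if b.1 then 1 else -1) * (if b.2 then 1 else -1) *
    (J (sf (if b.2 then n else m) (if b.1 then i else l)) w *
     J (sg (if b.2 then n else m) (if b.1 then l else i)) w)) ^+ 2)); last first.
    by move=> w; rewrite !big_cons big_nil /Z /=; congr (_ ^+ 2); ring.
  rewrite (Ex_chaos_pairs hip he hW); apply: ler_sum => -[k /= kp] _; rewrite -mulrDr.
  apply: ler_wpM2l; first by rewrite /chaos_coef !mulr_ge0// exprn_ge0.
  rewrite -mulrDr.
  (* Inserting the limit [A k] separates [n] from [m], as the form [r n + r m] of the bound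
     demands. *)
  have -> : lincomb B (fun b => (if b.1 then 1 else -1) * (if b.2 then 1 else -1))
     (fun b => tcontract_sym k (ftensor ip e p (sf (if b.2 then n else m) (if b.1 then i else l)))
      (ftensor ip e p (sg (if b.2 then n else m) (if b.1 then l else i)))) =
      (At k n \- A k) \- (At k m \- A k).
    apply/funext => x; rewrite /lincomb !big_cons big_nil !Tf// !Tg//.
    by rewrite /At /antisym /=; ring.
  have lA : l2 (A k) by apply: (l2_antisym (kp : (k <= p)%N)).
  have lAt n' : l2 (At k n') by apply: (l2_antisym (kp : (k <= p)%N)); exact: l2_trunc.
  by apply: tdot_sub_le; exact: l2B.
- rewrite [X in _ --> X](_ : 0 = \sum_(k < p.+1) chaos_coef p k * (2 * 0)); last first.
    by rewrite big1// => k _; rewrite !mulr0.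
  apply: cvg_sumr => -[k /= kp]; apply: cvgMr; apply: cvgMr.
  exact: (cvg_comp psi _ psioo (cvg_antisym_dist (kp : (k <= p)%N) (Lf i) (Lg l) (Lf l) (Lg i))).
Qed.

(** The partial sums in Lagrange's identity increase with [N], so monotone convergence gives the
    value of the integral and its finiteness at once. *)
Lemma integral_gram_det :
  (\int[P]_w (ip (Uf w) (Uf w) * ip (Ug w) (Ug w) - ip (Uf w) (Ug w) ^+ 2)%:E =
   (\sum_(k < p.+1) Tterm f g k)%:E)%E.
Proof.
pose S N w := 2^-1 * \sum_(0 <= i < N) \sum_(0 <= l < N) wedge (i, l) w ^+ 2.
have mS N : measurable_fun [set: Omega] (fun w => (S N w)%:E).
  apply/measurable_EFinP; apply: measurable_funM; first exact: measurable_cst.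
  apply: measurable_sum => i; apply: measurable_sum => l.
  by apply: measurable_funX; exact: measurable_wedge.
have S0 N w : 0 <= S N w.
  by rewrite mulr_ge0// sumr_ge0// => i _; rewrite sumr_ge0// => l _; exact: sqr_ge0.
have Snd w : {homo S^~ w : n m / (n <= m)%N >-> n <= m}.
  move=> n m nm; rewrite ler_wpM2l//.
  rewrite [leRHS](big_cat_nat (n := n))//=.
  rewrite -[leLHS]addr0; apply: lerD.
    apply: ler_sum => i _; rewrite [leRHS](big_cat_nat (n := n))//= lerDl.
    by rewrite sumr_ge0// => l _; exact: sqr_ge0.
  by rewrite sumr_ge0// => i _; rewrite sumr_ge0// => l _; exact: sqr_ge0.
have h := @cvg_monotone_convergence _ _ _ P _ measurableT (fun N w => (S N w)%:E) mS
  (fun N w _ => S0 N w) (fun w _ n m nm => Snd w n m nm).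
have limS w : limn (fun N => (S N w)%:E) =
    (ip (Uf w) (Uf w) * ip (Ug w) (Ug w) - ip (Uf w) (Ug w) ^+ 2)%:E.
  apply: cvg_lim => //; apply: cvg_EFin; first exact: nearW.
  exact: (cvg_gram_det hip he).
under eq_integral do rewrite -limS.
rewrite -(cvg_lim _ h)//; apply: cvg_lim => //.
pose q k il := chaos_coef p k * tdot (slice_antisym f g k il) (slice_antisym f g k il).
have intS N : (\int[P]_w (S N w)%:E = (2^-1 * \sum_(0 <= i < N) \sum_(0 <= l < N) \sum_(k < p.+1) q k (i, l))%:E)%E.
  under eq_integral do rewrite EFinM.
  have mw il : measurable_fun [set: Omega] (fun w => (wedge il w ^+ 2)%:E).
    by apply/measurable_EFinP; apply: measurable_funX; exact: measurable_wedge.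
  have mSS : measurable_fun [set: Omega]
      (fun w => (\sum_(0 <= i < N) \sum_(0 <= l < N) wedge (i, l) w ^+ 2)%:E).
    apply/measurable_EFinP; apply: measurable_sum => i; apply: measurable_sum => l.
    by apply: measurable_funX; exact: measurable_wedge.
  have SS0 w : [set: Omega] w ->
      (0 <= (\sum_(0 <= i < N) \sum_(0 <= l < N) wedge (i, l) w ^+ 2)%:E)%E.
    by move=> _; rewrite lee_fin sumr_ge0// => i _; rewrite sumr_ge0// => l _; exact: sqr_ge0.
  rewrite (ge0_integralZl_EFin P measurableT SS0 mSS)// EFinM; congr (_ * _)%E.
  under eq_integral do rewrite -sumEFin.
  rewrite ge0_integral_sum//; last 2 first.
  - move=> i; apply/measurable_EFinP; apply: measurable_sum => l.
    by apply: measurable_funX; exact: measurable_wedge.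
  - by move=> i w _; rewrite lee_fin sumr_ge0// => l _; exact: sqr_ge0.
  rewrite -sumEFin; apply: eq_bigr => i _.
  under eq_integral do rewrite -sumEFin.
  rewrite ge0_integral_sum//; last first.
    by move=> l w _; rewrite lee_fin sqr_ge0.
  by rewrite -sumEFin; apply: eq_bigr => l _; rewrite integral_wedge.
rewrite (funext intS); apply: cvg_EFin; first exact: nearW.
have aq k : (k < p.+1)%N -> asum (q k).
  by move=> kp; apply: asumZ; exact: (asum_slice_antisym (kp : (k <= p)%N) lf lg).
have -> : \sum_(k < p.+1) Tterm f g k = 2^-1 * \sum_(k < p.+1) tsum (q k).
  rewrite mulr_sumr; apply: eq_bigr => -[k /= kp] _; congr (_ * _); apply: eq_tsum => -[i l].
  rewrite tnorm_sqr /q /chaos_coef; congr (_ * _`!%:R * _).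
  by rewrite -mul2n; lia.
apply: cvgMr.
under eq_fun do (under eq_bigr do (rewrite exchange_big/=); rewrite exchange_big/=).
apply: cvg_sumr => -[k /= kp]; exact: cvg_box_sum (aq k kp).
Qed.

End gram_determinant.

Lemma det_mx22 (R : comNzRingType) (M : 'M[R]_2) :
  \det M = M 0 0 * M 1 1 - M 0 1 * M 1 0.
Proof.
rewrite (expand_det_row _ 0) !big_ord_recl big_ord0 /cofactor !det_mx11 !mxE.
rewrite (_ : lift 0 0 = 1 :> 'I_2); last exact: val_inj.
rewrite (_ : lift 1 0 = 0 :> 'I_2); last exact: val_inj.
by rewrite /= expr0 expr1; ring.
Qed.

(** * Means and covariances of multiple integrals *)

Section covariance.
Context {R : realType} {H : completeNormedModType R}.
Context {d : measure_display} {Omega : measurableType d}.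
Variables (P : probability Omega R) (ip : {dot H for idfun}) (e : nat -> H).
Variable W : H -> Omega -> R.
Hypotheses (hip : hilbert_product ip) (he : complete_orthonormal ip e).
Hypothesis hW : isonormal P ip W.
Variables (p : nat) (I : tensor R p.+1 -> Omega -> R).
Hypothesis hI : multiple_integral P ip e W I.

(** Parseval's formula writes the scalar product as a limit of finite sums of products of measurable
    coordinates. *)
Lemma measurable_ip (U V : Omega -> H) : weakly_measurable ip U -> weakly_measurable ip V ->
  measurable_fun [set: Omega] (fun w => ip (U w) (V w)).
Proof.
move=> wU wV; apply: (measurable_fun_cvg (h := fun n w =>
    series (fun k => coords ip e (U w) k * coords ip e (V w) k) n)) => [n|w _].
  apply: measurable_sum => k; apply: measurable_funM; [exact: wU|exact: wV].
exact: (cvg_parseval2 hip he).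
Qed.

Let mI f : sym_l2 f -> measurable_fun [set: Omega] (I f).
Proof. exact: multiple_integral_measurable hI f. Qed.

Let EI2 f : sym_l2 f -> (\int[P]_w (I f w ^+ 2)%:E = (p.+1`!%:R * tdot f f)%:E)%E.
Proof. by move=> hf; rewrite -tnorm_sqr -(multiple_integral_isometry hI hf) unlock. Qed.

Lemma integrable_I2 f : sym_l2 f -> P.-integrable [set: Omega] (fun w => (I f w ^+ 2)%:E).
Proof.
move=> hf; apply/integrableP; split.
  by apply/measurable_EFinP; apply: measurable_funX; exact: mI.
under eq_integral do rewrite gee0_abs ?lee_fin ?sqr_ge0//.
by rewrite EI2// ltry.
Qed.

Lemma integrable_I f : sym_l2 f -> P.-integrable [set: Omega] (fun w => (I f w)%:E).
Proof. by move=> hf; apply: (@integrable_even _ _ _ P (I f) 1); [exact: mI|exact: integrable_I2]. Qed.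

Lemma integrable_IM f g : sym_l2 f -> sym_l2 g ->
  P.-integrable [set: Omega] (fun w => (I f w * I g w)%:E).
Proof.
move=> hf hg.
apply: (le_integrable measurableT _ _ (integrableD measurableT (integrable_I2 hf) (integrable_I2 hg))).
  by apply/measurable_EFinP; apply: measurable_funM; exact: mI.
move=> w _ /=; rewrite lee_fin [leRHS]ger0_norm ?addr_ge0 ?sqr_ge0//.
exact: normr_mul_le.
Qed.

(** [multiple_integral] prescribes second moments; the mean is obtained by comparison with chaoses,
    which are centered by orthogonality to the constant 1. The bound [|a| <= t + a ^+ 2 / t] passes
    from the L^2 distance to the mean, with [n] tending to infinity first and [t] to 0
    afterwards. *)
Lemma expectation_I f : sym_l2 f -> (\int[P]_w (I f w)%:E = 0)%E.
Proof.
move=> hf; have lf : l2 f by exact: (proj1 (square_summableE f) (proj2 hf)).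
have iI := integrable_I hf; have fI := integrable_fin_num measurableT iI.
rewrite -(fineK fI); congr (_%:E); set c := fine _.
have bound n t : 0 < t -> `|c| <= t + t^-1 * (p.+1`!%:R * tdot (f \- trunc n f) (f \- trunc n f)).
  move=> t0; pose s := trunc_form e n f.
  have nc := moments_chaos hW p.+1 s; have ic := moments_integrable nc.
  have c0 : (\int[P]_w (chaos ip W p.+1 s w)%:E = 0)%E.
    rewrite ExE//; congr (_%:E); rewrite /chaos Ex_sum => [|a]; last first.
      by apply: momentsZ; exact: moments_hermite.
    rewrite big1// => a _; rewrite ExZ; last exact: moments_hermite.
    have := Ex_hermite2 hW a.2 a.2 p.+1 0; rewrite mul0r mul0r => h.
    rewrite -[X in _ * X = _](_ : Ex P (fun w => (hermiteh (ip a.2 a.2) p.+1).[W a.2 w] * (hermiteh (ip a.2 a.2) 0).[W a.2 w]) = _).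
      by rewrite h mulr0.
    by apply: eq_Ex => w; rewrite hornerC mulr1.
  have iD := integrableB measurableT ic iI.
  have cE : (\int[P]_w ((chaos ip W p.+1 s w)%:E - (I f w)%:E) = (- c)%:E)%E.
    by rewrite integralB// c0 sub0e -(fineK fI).
  have i2 : P.-integrable [set: Omega] (fun w => ((chaos ip W p.+1 s w - I f w) ^+ 2)%:E).
    apply/integrableP; split.
      apply/measurable_EFinP; apply: measurable_funX; apply: measurable_funB; last exact: mI.
      by have [] := nc.
    under eq_integral do rewrite gee0_abs ?lee_fin ?sqr_ge0//.
    by rewrite (I_chaos_dist hip he hW hI)// ltry.
  have it : P.-integrable [set: Omega] (cst t%:E) by exact: finite_measure_integrable_cst.
  rewrite -lee_fin -normrN -abse_EFin -cE.
  apply: le_trans (le_abse_integral P measurableT (measurable_int P iD)) _.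
  apply: (@le_trans _ _ (\int[P]_w (t%:E + (t^-1)%:E * ((chaos ip W p.+1 s w - I f w) ^+ 2)%:E))%E).
    apply: ge0_le_integral => //.
    - by apply: measurableT_comp => //; exact: measurable_int iD.
    - by apply: emeasurable_funD => //; apply: emeasurable_funM => //; exact: measurable_int i2.
    - move=> w _; rewrite -EFinB -EFinM -EFinD lee_fin.
      move: (_ - _) => a; rewrite -[a ^+ 2]real_normK ?num_real//; move: `|a| => {}a.
      rewrite -subr_ge0 (_ : _ - _ = ((t - a / 2) ^+ 2 + 3 / 4 * a ^+ 2) / t); last by field; exact: lt0r_neq0.
      apply: divr_ge0; last exact: ltW.
      by apply: addr_ge0; [exact: sqr_ge0|apply: mulr_ge0; [rewrite divr_ge0|exact: sqr_ge0]].
  rewrite integralD//=; last exact: integrableZl.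
  rewrite integralZl// (I_chaos_dist hip he hW hI)// integral_cst//= probability_setT mule1.
  by rewrite (ftensor_trunc he)//; case: hf.
apply/eqP; rewrite -normr_eq0 eq_le normr_ge0 andbT.
apply/ler_addgt0Pr => t t0; rewrite add0r.
have : t + t^-1 * (p.+1`!%:R * tdot (f \- trunc n f) (f \- trunc n f)) @[n --> \oo] -->
    t + t^-1 * (p.+1`!%:R * 0).
  by apply: cvgD; [exact: cvg_cst|do 2![apply: cvgMr]; exact: cvg_trunc_dist].
rewrite !mulr0 addr0 => h; rewrite -(cvg_lim _ h)//; apply: limr_ge.
  by apply/cvg_ex; eexists; exact: h.
by apply: nearW => n; exact: bound.
Qed.

(** Polarization of the isometry at [g - f]; the linearity of [I] holds almost surely, which is
    enough under the integral. *)
Lemma expectation_IM f g : sym_l2 f -> sym_l2 g ->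
  (\int[P]_w (I f w * I g w)%:E = (p.+1`!%:R * tdot f g)%:E)%E.
Proof.
move=> hf hg.
have lf : l2 f by exact: (proj1 (square_summableE f) (proj2 hf)).
have lg : l2 g by exact: (proj1 (square_summableE g) (proj2 hg)).
have hd : sym_l2 (fun j => -1 * f j + g j) by exact: sym_l2_lin.
have iM := integrable_IM hf hg; have fM := integrable_fin_num measurableT iM.
have e1 : (\int[P]_w (I (fun j => -1 * f j + g j) w ^+ 2)%:E =
    \int[P]_w ((I f w ^+ 2)%:E + ((-2)%:E * (I f w * I g w)%:E + (I g w ^+ 2)%:E)))%E.
  apply: ae_eq_integral => //.
  - exact: measurable_int (integrable_I2 hd).
  - apply: emeasurable_funD; first exact: measurable_int (integrable_I2 hf).
    apply: emeasurable_funD; last exact: measurable_int (integrable_I2 hg).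
    by apply: emeasurable_funM => //; exact: measurable_int iM.
  - have := multiple_integral_linear hI (-1) hf hg; apply: filterS => w -> _.
    by rewrite -EFinM -!EFinD; congr (_%:E); ring.
move: e1; rewrite EI2// integralD//; last 2 first.
- exact: integrable_I2.
- by apply: integrableD => //; [exact: integrableZl|exact: integrable_I2].
rewrite integralD//; last 2 first.
- exact: integrableZl.
- exact: integrable_I2.
rewrite integralZl// !EI2// -(fineK fM) -EFinM -!EFinD => e1; congr (_%:E).
have {e1} := EFin_inj e1; have -> : (fun j => -1 * f j + g j) = g \- f by apply/funext => j /=; ring.
rewrite tdot_subE// (tdotC g f); move: (fine _) (tdot f f) (tdot g g) (tdot f g) => x a b c.
by move=> h; lra.
Qed.

Lemma covariance_I f g : sym_l2 f -> sym_l2 g ->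
  fine (covariance P (I f) (I g)) = p.+1`!%:R * tdot f g.
Proof.
move=> hf hg; rewrite unlock !unlock !expectation_I//=.
rewrite -[RHS]/(fine (p.+1`!%:R * tdot f g)%:E) -expectation_IM//; congr fine.
by apply: eq_integral => w _; congr (_%:E); rewrite -[LHS]/((I f w - 0) * (I g w - 0)) !subr0.
Qed.

Lemma det_covariance f g : sym_l2 f -> sym_l2 g ->
  \det (covariance_matrix P [tuple I f; I g]) =
  p.+1`!%:R ^+ 2 * (tdot f f * tdot g g - tdot f g ^+ 2).
Proof.
move=> hf hg; rewrite det_mx22 !mxE.
rewrite -![tnth _ 0]/(I f) -![tnth _ 1]/(I g) !covariance_I// (tdotC g f); ring.
Qed.

End covariance.

Theorem theorem2 (R : realType)
    (H : completeNormedModType R) (ip : {dot H for idfun}) (e : nat -> H)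
    (d : measure_display) (Omega : measurableType d) (P : probability Omega R)
    (W : H -> Omega -> R)
    (D : (Omega -> R) -> Omega -> H)
    (m : nat) (I : tensor R m -> Omega -> R) (f g : tensor R m)
    (hip : hilbert_product ip) (he : complete_orthonormal ip e)
    (hW : isonormal P ip W) (hgen : generated_by W)
    (hD : malliavin_derivative P ip W D)
    (hI : multiple_integral P ip e W I)
    (hm : (1 <= m)%N) (hf : sym_l2 f) (hg : sym_l2 g) :
  'E_P[fun w => (\det (malliavin_matrix ip D [tuple I f; I g] w))%R]%E =
  (m%:R ^+ 2 * \det (covariance_matrix P [tuple I f; I g]) +
   (m%:R * m`!%:R) ^+ 2 *
     \sum_(1 <= r < (m.-1)./2.+1)
       ('C(m.-1, r)%:R ^+ 2 - 'C(m.-1, r.-1)%:R ^+ 2) *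
       (tnorm (tcontract r f g) ^+ 2 -
        tnorm (tcontract (m - r) f g) ^+ 2) +
   \sum_(1 <= k < m) Tterm f g k)%:E.
Proof.
case: m I f g hI hm hf hg => [//|p] I f g hI _ hf hg.
have lf : l2 f by exact: (proj1 (square_summableE f) (proj2 hf)).
have lg : l2 g by exact: (proj1 (square_summableE g) (proj2 hg)).
have [phi [phin phif phig]] := fast_truncation lf lg.
have [Uf [wUf cUf dUf]] := grad_limit hip he hW hf phif.
have [Ug [wUg cUg dUg]] := grad_limit hip he hW hg phig.
have [wDf aDf] := hD _ _ (malliavin_graph_I hip he hW hI hf phif wUf dUf).
have [wDg aDg] := hD _ _ (malliavin_graph_I hip he hW hI hg phig wUg dUg).
rewrite unlock.
(* [D (I f)] and [D (I g)] agree almost surely with the limits just constructed, and both integrands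
   are measurable by Parseval's formula. *)
have -> : (\int[P]_w (\det (malliavin_matrix ip D [tuple I f; I g] w))%:E =
    \int[P]_w (ip (Uf w) (Uf w) * ip (Ug w) (Ug w) - ip (Uf w) (Ug w) ^+ 2)%:E)%E.
  have mip := measurable_ip hip he.
  have detE w : \det (malliavin_matrix ip D [tuple I f; I g] w) =
      ip (D (I f) w) (D (I f) w) * ip (D (I g) w) (D (I g) w) -
      ip (D (I f) w) (D (I g) w) ^+ 2.
    rewrite det_mx22 !mxE -![tnth _ 0]/(I f) -![tnth _ 1]/(I g).
    by rewrite [ip (D (I g) w) (D (I f) w)]ipC expr2.
  under eq_integral do rewrite detE.
  apply: ae_eq_integral => //.
  - apply/measurable_EFinP; apply: measurable_funB; last by apply: measurable_funX; exact: mip.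
    by apply: measurable_funM; exact: mip.
  - apply/measurable_EFinP; apply: measurable_funB; last by apply: measurable_funX; exact: mip.
    by apply: measurable_funM; exact: mip.
  - by apply: filterS2 aDf aDg => w -> -> _.
rewrite (integral_gram_det hip he hW hf hg phin wUf wUg cUf cUg); congr (_%:E).
rewrite -(big_mkord xpredT (fun k => Tterm f g k)) big_ltn//; congr (_ + _).
rewrite Tterm0_sum//; [|by case: hf|by case: hg].
rewrite (sum_binomial_telescope (fun r => tdot (tcontract r f g) (tcontract r f g))).
(* The boundary terms [r = 0] and [r = p.+1] leave [|f|^2 |g|^2 - <f, g>^2], and [(m m!)^2] times
   this is [m^2 det C]. *)
rewrite tdot_tcontract0// tdot_tcontractn (det_covariance hip he hW hI)//.
under [in RHS]eq_bigr do rewrite !tnorm_sqr.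
by rewrite mulrDr; congr (_ + _); rewrite [in LHS]exprMn -mulrA.
Qed.
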